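(* Let $n\ge1$. For every $\lambda\in\Lambda_n$ the monic multivariable big $q$-Jacobi polynomial $P_\lambda^B(z)=P_\lambda^B(z;a,b,c,d;q,t)$ satisfies the evaluation formulas $$P_\lambda^B(ct^\rho)=\Delta_\lambda\prod_{i=1}^n\frac{\bigl(qat^{n-i},qabt^{n-i},-\frac{qbc}{d}t^{n-i};q\bigr)_{\lambda_i}}{\bigl(qabt^{2(n-i)};q\bigr)_{2\lambda_i}}d^{\lambda_i}q^{\frac12\lambda_i(\lambda_i-1)},$$ $$P_\lambda^B(-dt^\rho)=\Delta_\lambda\prod_{i=1}^n\frac{\bigl(qbt^{n-i},qabt^{n-i},-\frac{qad}{c}t^{n-i};q\bigr)_{\lambda_i}}{\bigl(qabt^{2(n-i)};q\bigr)_{2\lambda_i}}(-c)^{\lambda_i}q^{\frac12\lambda_i(\lambda_i-1)},$$ $$P_\lambda^B\Bigl(\frac{c}{qa}t^{-\rho}\Bigr)=\Delta_\lambda\prod_{i=1}^n\frac{\bigl(qat^{n-i},qabt^{n-i},-\frac{qad}{c}t^{n-i};q\bigr)_{\lambda_i}}{\bigl(qabt^{2(n-i)};q\bigr)_{2\lambda_i}}\Bigl(\frac{c}{qa}t^{i-n}\Bigr)^{\lambda_i},$$ $$P_\lambda^B\Bigl(-\frac{d}{qb}t^{-\rho}\Bigr)=\Delta_\lambda\prod_{i=1}^n\frac{\bigl(qbt^{n-i},qabt^{n-i},-\frac{qbc}{d}t^{n-i};q\bigr)_{\lambda_i}}{\bigl(qabt^{2(n-i)};q\bigr)_{2\lambda_i}}\Bigl(-\frac{d}{qb}t^{i-n}\Bigr)^{\lambda_i},$$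 where $$\Delta_\lambda=\prod_{1\leq j<k\leq n}\frac{\bigl(qabt^{2n-j-k+1};q\bigr)_{\lambda_j+\lambda_k}\bigl(t^{k-j+1};q\bigr)_{\lambda_j-\lambda_k}}{\bigl(qabt^{2n-j-k};q\bigr)_{\lambda_j+\lambda_k}\bigl(t^{k-j};q\bigr)_{\lambda_j-\lambda_k}}.$$
   Context: $\mathbb{E}=\mathbb{C}(a,b,c,d,q,t)$ is the field of rational functions in six indeterminates. $\Lambda_n$ is the set of partitions $\lambda=(\lambda_1\ge\dots\ge\lambda_n\ge0)$, with dominance order $\mu\le\lambda$ iff $\sum_{j\le i}\mu_j\le\sum_{j\le i}\lambda_j$ for $1\le i\le n$. $(u;q)_j=\prod_{i=0}^{j-1}(1-uq^i)$ and $(u_1,\dots,u_m;q)_j=\prod_s(u_s;q)_j$. $\rho=(n-1,n-2,\dots,0)$, and for a scalar $u$, $ut^{\pm\rho}=(ut^{\pm(n-1)},\dots,ut^{\pm1},u)$, a point for $z=(z_1,\dots,z_n)$. $\mathbb{E}[z]^S$ is the algebra of symmetric polynomials in $z_1,\dots,z_n$ over $\mathbb{E}$, with basis $\widetilde m_\lambda(z)=\sum_{\mu\in S_n\lambda}z^\mu$. The monic multivariable big $q$-Jacobi polynomial $P_\lambda^B(z;a,b,c,d;q,t)\in\mathbb{E}[z]^S$ is the unique element of the form $P_\lambda^B=\widetilde m_\lambda+\sum_{\mu\in\Lambda_n,\mu<\lambda}c^B_{\lambda,\mu}\widetilde m_\mu$ ($c^B_{\lambda,\mu}\in\mathbb{E}$)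 with $D_BP_\lambda^B=E_\lambda P_\lambda^B$, where, with $(T_jf)(z)=f(z_1,\dots,qz_j,\dots,z_n)$, $$D_B=\sum_{j=1}^n\bigl(\phi_j^+(z)(T_j-\mathrm{Id})+\phi_j^-(z)(T_j^{-1}-\mathrm{Id})\bigr),$$ $$\phi_j^+(z)=qt^{n-1}\Bigl(a-\frac{c}{qz_j}\Bigr)\Bigl(b+\frac{d}{qz_j}\Bigr)\prod_{l\ne j}\frac{z_l-tz_j}{z_l-z_j},\qquad\phi_j^-(z)=\Bigl(1-\frac{c}{z_j}\Bigr)\Bigl(1+\frac{d}{z_j}\Bigr)\prod_{l\ne j}\frac{z_j-tz_l}{z_j-z_l},$$ $$E_\lambda=\sum_{j=1}^n\bigl(qabt^{2n-j-1}(q^{\lambda_j}-1)+t^{j-1}(q^{-\lambda_j}-1)\bigr).$$ *)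

(* Defs.v *)
From Stdlib Require Import Rdefinitions.
From mathcomp Require Import all_boot all_order all_algebra.
From mathcomp Require Import fraction complex Rstruct mpoly.

Set Implicit Arguments.
Unset Strict Implicit.
Unset Printing Implicit Defensive.

Import GRing.Theory.
Local Open Scope ring_scope.

(* Partitions of length at most n are the nonincreasing exponent vectors in   *)
(* 'X_{1..n}. Indices start at 0: i : 'I_n stands for the 1-based index i.+1. *)

Definition is_partition (n : nat) (lam : 'X_{1..n}) : bool := sorted geq lam.

(* The total degrees of mu and lam are not required to agree.                 *)
Definition dom_le (n : nat) (mu lam : 'X_{1..n}) : bool :=
  [forall i : 'I_n,
     (\sum_(j < n | j <= i) mu j <= \sum_(j < n | j <= i) lam j)%N].

Definition dom_lt (n : nat) (mu lam : 'X_{1..n}) : bool :=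
  dom_le mu lam && (mu != lam).

Section BigQJacobi.

Variables (F : fieldType) (n : nat).
Implicit Types (u q t a b c d : F) (p : {mpoly F[n]}) (lam mu : 'X_{1..n}).

Definition qpoch q u (j : nat) : F := \prod_(i < j) (1 - u * q ^+ i).

Definition qpochs q (us : seq F) (j : nat) : F := \prod_(u <- us) qpoch q u j.

Definition rho (i : 'I_n) : nat := (n - i.+1)%N.

(* The points u t^rho and u t^(-rho).                                         *)
Definition rho_pt u t (i : 'I_n) : F := u * t ^+ rho i.
Definition rho_ptN u t (i : 'I_n) : F := u * t ^- rho i.

(* The sum over the orbit S_n lam, without multiplicities; every element of   *)
(* the orbit has degree mdeg lam.                                             *)
Definition msymm lam : {mpoly F[n]} :=
  \sum_(mu : 'X_{1..n < (mdeg lam).+1} | perm_eq (mu : 'X_{1..n}) lam) 'X_[mu].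

(* f(z) |-> f(z_1, ..., u z_j, ..., z_n)                                      *)
Definition dilate u (j : 'I_n) p : {mpoly F[n]} :=
  p \mPo [tuple (if l == j then u else 1) *: 'X_l | l < n].

(* The coefficients of the difference operator are rational functions of z.   *)
Notation Fz := {fraction {mpoly F[n]}}.

Definition cst u : Fz := tofrac u%:MP.
Definition zvar (j : 'I_n) : Fz := tofrac 'X_j.

Definition phi_plus a b c d q t (j : 'I_n) : Fz :=
  cst (q * t ^+ n.-1)
  * (cst a - cst c / (cst q * zvar j)) * (cst b + cst d / (cst q * zvar j))
  * \prod_(l < n | l != j) ((zvar l - cst t * zvar j) / (zvar l - zvar j)).

Definition phi_minus c d t (j : 'I_n) : Fz :=
  (1 - cst c / zvar j) * (1 + cst d / zvar j)
  * \prod_(l < n | l != j) ((zvar j - cst t * zvar l) / (zvar j - zvar l)).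

Definition D_B a b c d q t p : Fz :=
  \sum_(j < n) (phi_plus a b c d q t j * tofrac (dilate q j p - p)
                + phi_minus c d t j * tofrac (dilate q^-1 j p - p)).

Definition eigval a b q t lam : F :=
  \sum_(j < n) (q * a * b * t ^+ (2 * n - j.+1 - 1) * (q ^+ lam j - 1)
                + t ^+ j * (q ^- lam j - 1)).

(* The defining properties of the monic big q-Jacobi polynomial P_lam^B. A    *)
(* partition mu below lam in dominance order has degree at most mdeg lam, so  *)
(* the sum below runs over all such partitions.                               *)
Definition is_monic_big_qJacobi a b c d q t lam p : Prop :=
  [/\ p \is symmetric,
      exists coef : 'X_{1..n} -> F,
        p = msymm lam
            + \sum_(mu : 'X_{1..n < (mdeg lam).+1}
                     | is_partition mu && dom_lt mu lam) coef mu *: msymm mu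
    & D_B a b c d q t p = tofrac (eigval a b q t lam *: p)].

Definition Delta a b q t lam : F :=
  \prod_(j < n) \prod_(k < n | (j < k)%N)
    ((qpoch q (q * a * b * t ^+ (2 * n - j.+1 - k.+1 + 1)) (lam j + lam k)
      * qpoch q (t ^+ (k - j + 1)) (lam j - lam k))
     / (qpoch q (q * a * b * t ^+ (2 * n - j.+1 - k.+1)) (lam j + lam k)
        * qpoch q (t ^+ (k - j)) (lam j - lam k))).

End BigQJacobi.

(* The field C(a,b,c,d,q,t).                                                  *)
Definition E : fieldType := {fraction {mpoly R[i][6]}}.

Definition indet (k : 'I_6) : E := tofrac 'X_k.

Definition a : E := indet (@Ordinal 6 0 isT).
Definition b : E := indet (@Ordinal 6 1 isT).
Definition c : E := indet (@Ordinal 6 2 isT).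
Definition d : E := indet (@Ordinal 6 3 isT).
Definition q : E := indet (@Ordinal 6 4 isT).
Definition t : E := indet (@Ordinal 6 5 isT).

(* Main.v *)
Require Import Defs.
From mathcomp Require Import all_boot all_order all_algebra.
From mathcomp Require Import all_fingroup.
From mathcomp Require Import fraction complex Rstruct mpoly.
From mathcomp Require Import ring zify.

(** Write c q^m t^rho for the point with coordinates c q^(m_i) t^(rho_i), m a
    partition, and A_i^+, A_i^- for the products over l != i that occur in the
    coefficients of D_B.

    For a partition m there is exactly one symmetric polynomial R_m of degree
    at most |m| which is 1 at c q^m t^rho and 0 at c q^k t^rho for every other
    partition k with |k| <= |m| ([lat_uniq], [interp_ex]). Only R_0 is nonzero
    at c t^rho, so the first evaluation of the theorem is the coefficient of
    R_0 in the expansion of the eigenfunction P in the R_m. The operator acts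
    on this basis by a two-term rule ([DB_lat]):
      D_B R_m = E_m R_m + sum_i phi_i^+(c q^(m - e_i) t^rho) R_(m - e_i).
    The difference D_B R_m - E_m R_m has degree less than |m|, because R_m has
    leading exponent m ([interp_lead]) and is, up to lower degree, an
    eigenfunction of the two Macdonald operators, of which D_B is a combination
    up to lower degree ([interp_minus], [interp_plus]; the latter rests on the
    commutation [macdonald_comm]). A symmetric polynomial of degree less than |m|
    is known from its values at the points c q^k t^rho with |k| < |m|; R_m
    vanishes there, and it is 0 or 1 at all neighbouring points that D_B
    involves with a nonzero coefficient.

    Hence the coefficients X_k of P satisfy
      (E_lam - E_k) X_k = sum_i phi_i^+(c q^k t^rho) X_(k + e_i),
    a sum over the ways of building lam from k box by box. In phi_i^+ the
    parameters a, b, d enter only through the factor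
    q t^(n-1) (a - c / (q z_i)) (b + d / (q z_i)) at z_i = c q^(k_i) t^(rho_i),
    which depends on the added box but not on the rest of k, and in E only
    through s = a b. Since every path from 0 to lam adds each box of lam once,
    P(c t^rho) = W(lam, s) times the product of these factors over the boxes of
    lam ([eigenfun_value]). The proposed right-hand side has the same shape
    ([eval_rhs_box]); so, for each s, it is enough to treat a single triple
    (a, b, d) with a b = s whose box product is nonzero ([transfer]). This is
    done by induction on n and lam ([eig_eval]):
     - if lam = lam' + (1, ..., 1), take (a, b, d) = (q s, 1/q, 0); then
       P_lam = z_1 ... z_n P_lam', where P_lam' has parameters (q s, q, 0)
       ([Zmul_eig]);
     - if lam_n = 0, take (1/q, q s, 0); at z_n = c the coefficients of the n-th
       term of D_B vanish, and P_lam(z_1, ..., z_(n-1), c) is an eigenfunction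
       in n - 1 variables with parameters t^2/q, q s, c t ([rst_eig]).

    The other three evaluations are the first one for other parameters: D_B is
    invariant under (a, b, c, d) -> (b, a, -d, -c) ([eigenpoly_swap]), and up to
    a scalar under (a, b, c, d, q, t) -> (1/a, 1/b, c/(q a), d/(q b), 1/q, 1/t)
    ([eigenpoly_inv]).

    The argument works over any field of characteristic other than 2 in which
    signed sums of distinct monomials in q, t and a b do not vanish
    ([mono_indep]); this separates the eigenvalues and the points. That D_B maps
    symmetric polynomials to symmetric polynomials is seen by clearing the
    denominator ([Hpol], [qop_polynomial]); after that all identities can be
    checked at points. *)

Set Implicit Arguments.
Unset Strict Implicit.
Unset Printing Implicit Defensive.

Import Order.TTheory GRing.Theory.
Local Open Scope ring_scope.

(** * Dilations, substitutions and the Vandermonde product *)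

Section Poly.
Variables (F : fieldType) (n : nat).
Implicit Types (p r : {mpoly F[n]}) (m k : 'X_{1..n}) (i j l : 'I_n) (u : F).

Lemma mcoeff_dilate u j p m : (dilate u j p)@_m = u ^+ m j * p@_m.
Proof.
elim/mpolyind: p m => [|c m0 p _ _ IH] m.
  by rewrite /dilate raddf0 mcoeff0 mulr0.
rewrite /dilate raddfD /= mcoeffD IH mcoeffD mulrDr; congr (_ + _).
rewrite linearZ /= !mcoeffZ comp_mpolyX mcoeffX mulrCA; congr (_ * _).
under eq_bigr => l _ do rewrite tnth_mktuple exprZn.
rewrite scaler_prod -mpolyXE_id mcoeffZ mcoeffX.
case: eqP => [<-|_]; last by rewrite !mulr0.
congr (_ * _).
rewrite (bigD1 j) //= eqxx big1 ?mulr1 // => l /negPf ->.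
by rewrite expr1n.
Qed.

Lemma dilateB u j : {morph dilate u j : x y / x - y}.
Proof. by move=> x y; rewrite /dilate raddfB. Qed.

Lemma dilateM u j : {morph dilate u j : x y / x * y}.
Proof. by move=> x y; rewrite /dilate rmorphM. Qed.

Definition shift u j (z : 'I_n -> F) l : F := (if l == j then u else 1) * z l.

Lemma meval_dilate u j p z : (dilate u j p).@[z] = p.@[shift u j z].
Proof.
rewrite /dilate comp_mpoly_meval; apply: meval_eq => l.
by rewrite tnth_mktuple mevalZ mevalXU.
Qed.

Lemma mlead_le_sup p m : (forall m', p@_m' != 0 -> (m' <= m)%O) -> (mlead p <= m)%O.
Proof.
move=> h; have [->|p0] := eqVneq p 0; first by rewrite mlead0 le0m.
by apply: h; rewrite mleadc_eq0.
Qed.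

Lemma mlead_dilate u j p : (mlead (dilate u j p) <= mlead p)%O.
Proof.
apply: mlead_le_sup => m; rewrite mcoeff_dilate => h.
apply: msupp_le_mlead; rewrite mcoeff_msupp.
by apply: contraNneq h => ->; rewrite mulr0.
Qed.

Lemma msym_dilate (s : 'S_n) u j p :
  msym s (dilate u j p) = dilate u (s j) (msym s p).
Proof.
apply/mpolyP => m; rewrite mcoeff_sym !mcoeff_dilate mcoeff_sym.
by rewrite mnmE.
Qed.

Lemma msymXU (s : 'S_n) j : msym s 'X_j = 'X_(s j) :> {mpoly F[n]}.
Proof.
rewrite msymX; congr mpolyX; apply/mnmP => i; rewrite mnmE !mnm1E.
by rewrite -(inj_eq (@perm_inj _ s)) permKV.
Qed.

Definition subst j (v : {mpoly F[n]}) p : {mpoly F[n]} :=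
  p \mPo [tuple (if l == j then v else 'X_l) | l < n].

Lemma substX j v l : subst j v 'X_l = if l == j then v else 'X_l.
Proof. by rewrite /subst comp_mpolyXU -tnth_nth tnth_mktuple. Qed.

Lemma subst_dvd j v p : exists r, p - subst j v p = ('X_j - v) * r.
Proof.
pose D p := exists r, p - subst j v p = ('X_j - v) * r.
have DM p1 p2 : D p1 -> D p2 -> D (p1 * p2).
  move=> [r1 e1] [r2 e2]; exists (r1 * p2 + subst j v p1 * r2).
  rewrite mulrDr mulrA -e1 mulrCA -e2 /subst rmorphM /=.
  by rewrite mulrBl mulrBr addrA subrK.
have D1 : D 1 by exists 0; rewrite /subst rmorph1 mulr0 subrr.
rewrite -/(D p); elim/mpolyind: p => [|c m p _ _ [r e]].
  by exists 0; rewrite /subst rmorph0 mulr0 subrr.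
have [r' e'] : D 'X_[m].
  rewrite mpolyXE_id; elim/big_ind: _ => // i _.
  elim: (m i) => [|k IH]; first by rewrite expr0.
  rewrite exprS; apply: DM => //.
  rewrite /D substX; case: eqP => [->|_]; first by exists 1; rewrite mulr1.
  by exists 0; rewrite mulr0 subrr.
exists (c *: r' + r); rewrite mulrDr -e -scalerAr -e' scalerBr.
by rewrite /subst comp_mpolyD comp_mpolyZ opprD [LHS]addrACA.
Qed.

(** Divisibility by pairwise coprime linear factors X_j - v, obtained without
    unique factorization: after splitting off one factor, the quotient still
    vanishes under the remaining substitutions because these do not kill the
    factor already removed. *)
Lemma subst_prod_dvd (s : seq ('I_n * {mpoly F[n]})) p :
    uniq s ->
    {in s &, forall x y, x != y -> subst x.1 x.2 ('X_y.1 - y.2) != 0} ->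
    {in s, forall x, subst x.1 x.2 p = 0} ->
  exists r, p = \prod_(x <- s) ('X_x.1 - x.2) * r.
Proof.
elim: s p => [|x s IH] p /=; first by exists p; rewrite big_nil mul1r.
move=> /andP[xs us] ne pz.
have [r e] := subst_dvd x.1 x.2 p.
move: e; rewrite pz ?mem_head // subr0 => e.
have ne' : {in s &, forall x y, x != y -> subst x.1 x.2 ('X_y.1 - y.2) != 0}.
  by move=> y w ys ws; apply: ne; rewrite inE ?ys ?ws orbT.
have [|r' er] := IH r us ne'; last by exists r'; rewrite big_cons -mulrA -er.
move=> y ys; have := pz y; rewrite inE ys orbT => /(_ isT).
rewrite e /subst rmorphM /= => /eqP; rewrite mulf_eq0 => /orP[|/eqP //].
have /negPf : subst y.1 y.2 ('X_x.1 - x.2) != 0.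
  apply: ne; rewrite ?inE ?eqxx ?ys ?orbT //.
  by apply: contraNneq xs => <-.
by rewrite /subst => ->.
Qed.

(** The common denominator of the coefficients A_j^+ and A_j^-. *)
Definition vandermonde : {mpoly F[n]} := \prod_(i < n) \prod_(j < n | (i < j)%N) ('X_j - 'X_i).

Lemma msym_vdm (s : 'S_n) : msym s vandermonde = (-1) ^+ s * vandermonde.
Proof.
have vE : vandermonde = \det (Vandermonde n (\row_j 'X_j : 'rV[{mpoly F[n]}]_n)).
  rewrite det_Vandermonde; apply: eq_bigr => i _; apply: eq_bigr => j _.
  by rewrite !mxE.
rewrite vE -det_map_mx.
have -> : map_mx (msym s) (Vandermonde n (\row_j 'X_j))
        = col_perm s (Vandermonde n (\row_j 'X_j : 'rV[{mpoly F[n]}]_n)).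
  by apply/matrixP => i j; rewrite !mxE rmorphXn /= msymXU.
by rewrite col_permE det_mulmx det_perm odd_permV mulrC.
Qed.

Lemma mpolyXU_inj : injective (fun i : 'I_n => 'X_i : {mpoly F[n]}).
Proof.
move=> i j /(congr1 (fun p : {mpoly F[n]} => p@_U_(i))); rewrite !mcoeffXU eqxx.
by case: eqVneq => // _ /eqP; rewrite oner_eq0.
Qed.

Lemma mpolyXU_neq0 i : 'X_i != 0 :> {mpoly F[n]}.
Proof.
apply/eqP => /(congr1 (fun p : {mpoly F[n]} => p@_U_(i))).
by rewrite mcoeffXU eqxx mcoeff0 => /eqP; rewrite oner_eq0.
Qed.

Lemma vdm_neq0 : vandermonde != 0.
Proof.
apply/prodf_neq0 => i _; apply/prodf_neq0 => j ij.
rewrite subr_eq0; apply/eqP => /mpolyXU_inj e.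
by rewrite e ltnn in ij.
Qed.

Definition delta : 'X_{1..n} := [multinom rho i | i < n].

Lemma mlead_vdm : mlead vandermonde = delta.
Proof.
have lXX i j : (i < j)%N -> mlead ('X_j - 'X_i : {mpoly F[n]}) = U_(i)%MM.
  move=> ij; rewrite addrC mleadDl ?mleadN ?mleadXm //.
  apply/ltmcP; rewrite ?mdeg1 //; exists i => //=.
    move=> l li; rewrite !mnm1E; congr nat_of_bool.
    by rewrite -!val_eqE /= !gtn_eqF // (ltn_trans li).
  by rewrite !mnm1E eqxx -val_eqE /= gtn_eqF.
have X0 i j : (i < j)%N -> 'X_j - 'X_i != 0 :> {mpoly F[n]}.
  by move=> ij; rewrite subr_eq0; apply/eqP => /mpolyXU_inj e; rewrite e ltnn in ij.
rewrite /vandermonde mlead_prod => [|i _ _]; last by apply/prodf_neq0 => j; apply: X0.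
under eq_bigr => i _.
  rewrite mlead_prod => [|j _]; last exact: X0.
  over.
apply/mnmP => l; rewrite mnmE mnm_sumE [LHS](bigD1 l) //= [X in (_ + X)%N]big1 ?addn0; last first.
  move=> i il; rewrite mnm_sumE big1 // => j ij.
  by rewrite (lXX _ _ ij) mnm1E (negPf il).
rewrite mnm_sumE (eq_bigr (fun=> 1%N)); last first.
  by move=> j lj; rewrite (lXX _ _ lj) mnm1E eqxx.
by rewrite -(big_geq_mkord l.+1 n xpredT (fun=> 1%N)) sum_nat_const_nat muln1.
Qed.
End Poly.

(** * Second-order q-difference operators and their polynomial form *)

Section Op.
Variables (F : fieldType) (n : nat).
Implicit Types (p r : {mpoly F[n]}) (m k : 'X_{1..n}) (i j l : 'I_n) (u t q : F)
  (z : 'I_n -> F) (x : F * F * F).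

(** The coefficients A_j^+ and A_j^- of the Macdonald operators. They are
    evaluated at points; the denominators vanish unless [z] is injective. *)
Definition Ap t z j := \prod_(l < n | l != j) ((z l - t * z j) / (z l - z j)).
Definition Am t z j := \prod_(l < n | l != j) ((z j - t * z l) / (z j - z l)).

(** The operator D_B has coefficients of the form x_0 + x_1/u + x_2/u^2; the
    triple (x_0, x_1, x_2) is kept as the datum because the polynomiality of the
    operator depends on x_2 and its leading term on x_0. *)
Definition laurent x u := x.1.1 + x.1.2 / u + x.2 / u ^+ 2.

Definition qop q t (al be : F -> F) p z :=
  \sum_(j < n) (al (z j) * Ap t z j * (p.@[shift q j z] - p.@[z])
              + be (z j) * Am t z j * (p.@[shift q^-1 j z] - p.@[z])).

(** Writing A_j^- through A_j^+ at 1/t makes both halves of the operator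
    instances of [vdm_dilate]. *)
Lemma Am_Ap t z j : t != 0 -> injective z -> t ^+ n.-1 * Ap t^-1 z j = Am t z j.
Proof.
move=> t0 zi; rewrite /Ap /Am.
have -> : t ^+ n.-1 = \prod_(l < n | l != j) t.
  by rewrite prodr_const cardC1 card_ord.
rewrite -big_split /=; apply: eq_bigr => l lj.
have h1 : z l - z j != 0 by rewrite subr_eq0 (inj_eq zi).
have h2 : z j - z l != 0 by rewrite subr_eq0 (inj_eq zi) eq_sym.
by field; rewrite t0 h1 h2.
Qed.

Lemma meval_vdm z : (vandermonde F n).@[z] = \prod_(i < n) \prod_(j < n | (i < j)%N) (z j - z i).
Proof.
rewrite /vandermonde rmorph_prod; apply: eq_bigr => i _; rewrite rmorph_prod.
by apply: eq_bigr => j _; rewrite rmorphB /= !mevalXU.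
Qed.

Lemma meval_vdm_neq0 z : injective z -> (vandermonde F n).@[z] != 0.
Proof.
move=> zi; rewrite meval_vdm; apply/prodf_neq0 => i _; apply/prodf_neq0 => j ij.
by rewrite subr_eq0 (inj_eq zi) -val_eqE /= gtn_eqF.
Qed.

(** Only the factors of the Vandermonde product that involve z_j change
    under the dilation, and their ratios are the factors of A_j^+. *)
Lemma vdm_dilate t j z : injective z ->
  (dilate t j (vandermonde F n)).@[z] = Ap t z j * (vandermonde F n).@[z].
Proof.
move=> zi; rewrite meval_dilate !meval_vdm.
pose f l := (z l - t * z j) / (z l - z j).
have split1 : Ap t z j = (\prod_(l < n | (l < j)%N) f l) * (\prod_(l < n | (j < l)%N) f l).
  rewrite /Ap (bigID (fun l : 'I_n => (l < j)%N)) /=; congr (_ * _).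
    by apply: eq_bigl => l; rewrite andbC -val_eqE /=; case: ltngtP.
  by apply: eq_bigl => l; rewrite -val_eqE /=; case: ltngtP.
(* a product over all pairs i < l, the factor being 1 unless j is in the pair *)
have -> : Ap t z j = \prod_(i < n) \prod_(l < n | (i < l)%N)
     ((if l == j then f i else 1) * (if i == j then f l else 1)).
  under eq_bigr => i _ do rewrite big_split /=.
  rewrite big_split split1 /=; congr (_ * _).
    rewrite big_mkcond /=; apply: eq_bigr => i _.
    rewrite -big_mkcondr /=; case: ifPn => [ij|ij].
      rewrite (big_pred1 j) // => l /=; rewrite andbC.
      by case: eqP => // ->; rewrite ij.
    rewrite big1 // => l /andP[il /eqP e]; move: ij; rewrite -e il //.
  rewrite [RHS](bigD1 j) //= [X in _ * X]big1 ?mulr1 => [|i /negPf ij].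
    by apply: eq_bigr => l _; rewrite eqxx.
  by rewrite big1 // => l _; rewrite ij.
rewrite -big_split; apply: eq_bigr => i _ /=.
rewrite -big_split; apply: eq_bigr => l il /=.
have li : l == i = false by rewrite -val_eqE /= gtn_eqF.
have h1 : z l - z i != 0 by rewrite subr_eq0 (inj_eq zi) li.
rewrite /shift /f; case: (eqVneq l j) => [lj|lj].
  rewrite -lj [i == l]eq_sym li; have h2 : z i - z l != 0 by rewrite subr_eq0 (inj_eq zi) eq_sym li.
  by field; rewrite h2.
case: (eqVneq i j) => [ij|ij]; last by rewrite !mul1r.
by rewrite -ij; field.
Qed.

(** The exponent of z_1 ... z_n. *)
Definition onem : 'X_{1..n} := [multinom 1%N | i < n].

(** The polynomial (z_1 ... z_n)^2 laurent x z_j, see [meval_cpol]. *)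
Definition cpol j x : {mpoly F[n]} :=
  x.1.1 *: 'X_[onem + onem] + x.1.2 *: 'X_[onem + (onem - U_(j))]
  + x.2 *: 'X_[(onem - U_(j)) + (onem - U_(j))].
(** The quotient of [cpol] by z_1 ... z_n, times z_j, see [cpolX]: one factor
    z_j is supplied by the q-difference of a polynomial. *)
Definition dpol j x : {mpoly F[n]} :=
  x.1.1 *: 'X_[onem + U_(j)] + x.1.2 *: 'X_[onem] + x.2 *: 'X_[onem - U_(j)].

Lemma onemBK j : (onem - U_(j) + U_(j))%MM = onem.
Proof. by rewrite submK //; apply/mnm_lepP => i; rewrite [onem i]mnmE mnm1E; case: (j == i). Qed.

Lemma cpolX j x : cpol j x * 'X_j = 'X_[onem] * dpol j x.
Proof.
rewrite /cpol /dpol !mulrDl !mulrDr -!scalerAl -!scalerAr -!mpolyXD.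
rewrite -!addmA onemBK; congr (_ + _ + _ *: 'X_[_]); exact: addmC.
Qed.

Lemma meval_onem z : ('X_[onem] : {mpoly F[n]}).@[z] = \prod_l z l.
Proof. by rewrite mevalX; apply: eq_bigr => l _; rewrite mnmE expr1. Qed.

Lemma meval_cpol j x z : (forall i, z i != 0) ->
  (cpol j x).@[z] = (\prod_l z l) ^+ 2 * laurent x (z j).
Proof.
move=> z0; rewrite /cpol !mevalD !mevalZ !mpolyXD !mevalM meval_onem.
have -> : ('X_[onem - U_(j)] : {mpoly F[n]}).@[z] = (\prod_l z l) / z j.
  apply: (mulIf (z0 j)); rewrite mulfVK // -meval_onem -{2}(onemBK j).
  by rewrite mpolyXD mevalM mevalXU.
by rewrite /laurent; field.
Qed.

Lemma msym_onem (s : 'S_n) : msym s 'X_[onem] = 'X_[onem] :> {mpoly F[n]}.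
Proof. by rewrite msymX; congr mpolyX; apply/mnmP => i; rewrite !mnmE. Qed.

Lemma msym_cpol (s : 'S_n) j x : msym s (cpol j x) = cpol (s j) x.
Proof.
have E : msym s 'X_[onem - U_(j)] = 'X_[onem - U_(s j)] :> {mpoly F[n]}.
  rewrite msymX; congr mpolyX; apply/mnmP => i; rewrite !mnmE.
  by rewrite -(inj_eq (@perm_inj _ s)) permKV.
by rewrite /cpol !msymD !msymZ !mpolyXD !msymM !E msym_onem.
Qed.

End Op.

Lemma sign_out_ring (A : comNzRingType) (e c v d k c' v' d' : A) :
  c * (e * v) * d + k * (c' * (e * v') * d') = e * (c * v * d + k * (c' * v' * d')).
Proof. by ring. Qed.

(** This identity and its neighbours are used with polynomials or fractions
    of polynomials; stated for an abstract ring, the normalization stays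
    independent of the representation of those types. *)
Lemma pull_out_ring (A : comNzRingType) (X Z c c' k r r' v v' ki d d' : A) :
  c * X = Z * d -> c' * X = Z * d' ->
  v * c * (X * r) + k * (v' * c' * - (ki * (X * r'))) =
  Z * (d * v * r - (k * ki) * (d' * v' * r')).
Proof.
move=> e e'.
transitivity (c * X * v * r - (c' * X) * k * ki * v' * r'); first by ring.
by rewrite e e'; ring.
Qed.

Lemma comp_mpoly_comp (R : comNzRingType) n1 n2 n3 (p : {mpoly R[n1]})
    (T : n1.-tuple {mpoly R[n2]}) (T' : n2.-tuple {mpoly R[n3]}) :
  (p \mPo T) \mPo T' = p \mPo [tuple tnth T i \mPo T' | i < n1].
Proof.
elim/mpolyind: p => [|c m p _ _ IH]; first by rewrite !raddf0.
rewrite !comp_mpolyD IH !comp_mpolyZ !comp_mpolyX rmorph_prod.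
congr (_ *: _ + _); apply: eq_bigr => i _.
by rewrite rmorphXn /= tnth_mktuple.
Qed.

Section PolyOp.
Variables (F : fieldType) (n : nat).
Hypothesis two0 : (2%:R : F) != 0.
Implicit Types (p r : {mpoly F[n]}) (m k : 'X_{1..n}) (i j l : 'I_n) (u : F)
  (z : 'I_n -> F).

Variables (q t : F) (al be : F * F * F).
Hypotheses (q0 : q != 0) (t0 : t != 0) (abE : al.2 = t ^+ n.-1 * q^-1 * be.2).

Let tn := t ^+ n.-1.
Local Notation vdm := (vandermonde F n).
Local Notation Z := ('X_[onem n] : {mpoly F[n]}).

(** The operator [qop] applied to [p] with its denominator, the Vandermonde
    product times (z_1 ... z_n)^2, cleared. *)
Definition Hpol p : {mpoly F[n]} := \sum_j
  (cpol j al * dilate t j vdm * (dilate q j p - p)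
   + tn *: (cpol j be * dilate t^-1 j vdm * (dilate q^-1 j p - p))).

Lemma meval_Hpol p z : injective z -> (forall i, z i != 0) ->
  (Hpol p).@[z] = (\prod_l z l) ^+ 2 * vdm.@[z] * qop q t (laurent al) (laurent be) p z.
Proof.
move=> zi z0; rewrite /Hpol raddf_sum mulr_sumr /=; apply: eq_bigr => j _.
rewrite mevalD mevalZ !mevalM !meval_cpol // !vdm_dilate // !mevalB !meval_dilate.
by rewrite -(Am_Ap j t0 zi) /tn; ring.
Qed.

Lemma msym_Hpol (s : 'S_n) p : p \is symmetric ->
  msym s (Hpol p) = (-1) ^+ s * Hpol p.
Proof.
move=> /issymP ps; rewrite /Hpol raddf_sum mulr_sumr /=.
rewrite [RHS](reindex_inj (@perm_inj _ s)) /=; apply: eq_bigr => j _.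
have dv u : dilate u (s j) ((-1) ^+ s * vdm) = (-1) ^+ s * dilate u (s j) vdm.
  by rewrite dilateM /dilate rmorphXn rmorphN1.
rewrite msymD msymZ !msymM !msym_cpol !msymB !msym_dilate ps msym_vdm !dv.
rewrite -!mul_mpolyC; exact: sign_out_ring.
Qed.

Lemma subst_dilate u j p : subst j 0 (dilate u j p) = subst j 0 p.
Proof.
rewrite /subst /dilate comp_mpoly_comp; congr (p \mPo _); apply: eq_from_tnth => l.
rewrite !tnth_mktuple comp_mpolyZ comp_mpolyXU -tnth_nth tnth_mktuple.
by case: eqP => _; rewrite ?scaler0 ?scale1r.
Qed.

(** A q-difference in z_j vanishes at z_j = 0; both differences come from one
    and the same quotient, which is what makes their poles at z_j = 0 cancel in
    [Hpol_factor]. *)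
Lemma qdiff_ex p : exists r : 'I_n -> {mpoly F[n]}, forall j,
  dilate q j p - p = 'X_j * r j /\
  dilate q^-1 j p - p = - (q^-1 *: ('X_j * dilate q^-1 j (r j))).
Proof.
have : forall j, exists r, dilate q j p - p = 'X_j * r /\
  dilate q^-1 j p - p = - (q^-1 *: ('X_j * dilate q^-1 j r)).
  move=> j.
  have [r e] := subst_dvd j 0 (dilate q j p - p).
  have s0 : subst j 0 (dilate q j p - p) = 0.
    by move: (subst_dilate q j p); rewrite /subst raddfB /= => ->; rewrite subrr.
  move: e; rewrite s0 !subr0 => e; exists r; split=> //.
  have := congr1 (dilate q^-1 j) e.
  rewrite dilateB dilateM.
  have -> : dilate q^-1 j (dilate q j p) = p.
    apply/mpolyP => m; rewrite !mcoeff_dilate mulrA -exprMn mulVf ?expr1n ?mul1r //.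
  have -> : dilate q^-1 j 'X_j = q^-1 *: 'X_j.
    by rewrite /dilate comp_mpolyXU -tnth_nth tnth_mktuple eqxx.
  by rewrite scalerAl => <-; rewrite opprB.
exact: fin_all_exists.
Qed.

Lemma substD j v : {morph @subst F n j v : x y / x + y}.
Proof. by move=> x y; rewrite /subst comp_mpolyD. Qed.
Lemma substB j v : {morph @subst F n j v : x y / x - y}.
Proof. by move=> x y; rewrite /subst comp_mpolyB. Qed.
Lemma substM j v : {morph @subst F n j v : x y / x * y}.
Proof. by move=> x y; rewrite /subst rmorphM. Qed.
Lemma substZ j v (c : F) p : subst j v (c *: p) = c *: subst j v p.
Proof. by rewrite /subst comp_mpolyZ. Qed.

Lemma substXm0 j m : m j != 0%N -> subst j 0 ('X_[m] : {mpoly F[n]}) = 0.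
Proof.
move=> mj; rewrite /subst comp_mpolyX (bigD1 j) //= tnth_mktuple eqxx.
by rewrite expr0n (negPf mj) mul0r.
Qed.

(** After z_j := z_i the transposition of i and j becomes invisible, so an
    antisymmetric polynomial vanishes on z_j = z_i. *)
Lemma subst_msym_tperm i j p :
  subst j 'X_i (msym (tperm i j) p) = subst j 'X_i p.
Proof.
rewrite /subst msym_mPo; congr (p \mPo _); apply: eq_from_tnth => l.
rewrite !tnth_mktuple; case: tpermP => [->|->|/eqP li /eqP lj].
- by rewrite eqxx; case: eqP => // ->.
- by rewrite eqxx; case: eqP => [->|].
- by rewrite (negPf lj).
Qed.

(** The substitutions z_j := z_i (i < j) and z_j := 0, one for each linear
    factor of the denominator. *)
Definition vlist : seq ('I_n * {mpoly F[n]}) :=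
  [seq (x.2, 'X_x.1) | x <- enum [pred x : 'I_n * 'I_n | (x.1 < x.2)%N]] ++
  [seq (j, 0) | j <- enum 'I_n].

Lemma vlist_prod : \prod_(x <- vlist) ('X_x.1 - x.2) = vdm * Z.
Proof.
rewrite /vlist big_cat !big_map !big_enum /=; congr (_ * _).
  by rewrite /vandermonde pair_big_dep.
rewrite mpolyXE_id; apply: eq_bigr => i _; by rewrite subr0 mnmE expr1.
Qed.

Lemma vlist_uniq : uniq vlist.
Proof.
rewrite cat_uniq; apply/and3P; split.
- by rewrite map_inj_uniq ?enum_uniq // => -[i j] [i' j'] /= [-> /mpolyXU_inj ->].
- apply/hasPn => y /mapP[j _ ->]; apply/mapP => -[[i l] _ [_ /eqP]].
  by rewrite eq_sym (negPf (mpolyXU_neq0 _ _)).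
- by rewrite map_inj_uniq ?enum_uniq // => i j [].
Qed.

Lemma vlist_neq : {in vlist &, forall x y, x != y -> subst x.1 x.2 ('X_y.1 - y.2) != 0}.
Proof.
have XX i j : i != j -> 'X_i - 'X_j != 0 :> {mpoly F[n]}.
  by rewrite subr_eq0; apply: contraNneq => /mpolyXU_inj ->.
have X0 i := mpolyXU_neq0 F i.
move=> x y; rewrite !mem_cat => /orP[] /mapP[w]; rewrite mem_enum => hw ->;
  move=> /orP[] /mapP[v]; rewrite mem_enum => hv -> /= ne;
  rewrite /subst comp_mpolyB -!/(subst _ _ _) ?[subst _ _ 0]raddf0 ?subr0 !substX.
- move: ne hw hv; rewrite !inE; case: w v => [i j] [i' j'] /= ne ij ij'.
  have dd : j != j' \/ i != i'.
    by apply/orP; rewrite -negb_and; apply: contraNN ne => /andP[/eqP-> /eqP->].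
  case: (eqVneq j' j) dd => [e|jj] dd.
    have ii : i != i' by case: dd => //; rewrite e eqxx.
    have /negPf -> : i' != j by rewrite -e -val_eqE /= ltn_eqF.
    exact: XX.
  case: (eqVneq i' j) => [e|_]; apply: XX; rewrite -val_eqE /= gtn_eqF //.
  by rewrite (ltn_trans ij) // -e.
- by case: ifP.
- move: hv; rewrite inE => hv; case: (eqVneq v.2 w) => [e1|_]; case: (eqVneq v.1 w) => [e2|_].
  + by move: hv; rewrite e1 e2 ltnn.
  + by rewrite sub0r oppr_eq0.
  + by rewrite subr0.
  + by rewrite XX // -val_eqE /= gtn_eqF.
- by case: (eqVneq v w) ne => [->|//]; rewrite eqxx.
Qed.

(** One factor z_1 ... z_n is pulled out of every summand by means of [cpolX].
    The rest is antisymmetric, so it vanishes for z_i = z_j. For z_j = 0 only the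
    j-th summand survives, and its two halves cancel by the relation between
    the coefficients of 1/u^2. *)
Lemma Hpol_factor p : p \is symmetric ->
  exists2 g, g \is symmetric & Hpol p = Z * (vdm * Z) * g.
Proof.
move=> ps; have [r rE] := qdiff_ex p.
pose h := \sum_j (dpol j al * dilate t j vdm * r j
   - (tn * q^-1) *: (dpol j be * dilate t^-1 j vdm * dilate q^-1 j (r j))).
have Zh : Hpol p = Z * h.
  rewrite /Hpol mulr_sumr; apply: eq_bigr => j _.
  have [-> ->] := rE j.
  rewrite -!mul_mpolyC mpolyCM.
  rewrite (mulrC (cpol j al)) (mulrC (cpol j be)).
  by apply: pull_out_ring; apply: cpolX.
have Z0 : Z != 0 by rewrite -(mleadc_eq0) mleadXm mcoeffX eqxx oner_eq0.
have ah (s : 'S_n) : msym s h = (-1) ^+ s * h.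
  apply: (mulfI Z0); rewrite -{1}(msym_onem F s) -msymM -Zh msym_Hpol // Zh.
  by rewrite mulrCA.
have hz x : x \in vlist -> subst x.1 x.2 h = 0.
  rewrite mem_cat => /orP[] /mapP[].
    move=> [i j]; rewrite mem_enum inE /= => ij -> /=.
    have := subst_msym_tperm i j h.
    have ijN : i != j by rewrite -val_eqE /= ltn_eqF.
    rewrite ah odd_tperm ijN expr1 mulN1r /subst comp_mpolyN => /eqP.
    rewrite -subr_eq0 -opprD oppr_eq0 -mulr2n -scaler_nat scaler_eq0.
    by rewrite (negPf two0) => /eqP.
  move=> j _ -> /=; rewrite /h {1}/subst raddf_sum (bigD1 j) //=.
  have D i (y : F * F * F) : i != j -> subst j 0 (dpol i y) = 0.
    move=> ij; rewrite /dpol !substD !substZ.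
    by rewrite !substXm0 ?scaler0 ?addr0 // !mnmE ?(negPf ij).
  rewrite [X in _ + X]big1 ?addr0 => [|i ij]; last first.
    by rewrite -/(subst _ _ _) substB substZ !substM !D // !mul0r scaler0 subrr.
  rewrite -/(subst _ _ _) substB substZ !substM !subst_dilate.
  have Dj (y : F * F * F) : subst j 0 (dpol j y) = y.2 *: subst j 0 'X_[onem n - U_(j)].
    rewrite /dpol !substD !substZ.
    rewrite (@substXm0 j (onem n + U_(j))%MM) ?(@substXm0 j (onem n)) ?mnmDE ?mnm1E ?mnmE ?eqxx ?addn1 //.
    by rewrite !scaler0 !add0r.
  by rewrite !Dj -!scalerAl scalerA -abE subrr.
have [g gE] := subst_prod_dvd vlist_uniq vlist_neq hz.
exists g; last by rewrite Zh gE vlist_prod mulrA.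
apply/issymP => s; have vZ0 : vdm * Z != 0 by rewrite mulf_neq0 // vdm_neq0.
apply: (mulfI vZ0); move: (ah s); rewrite gE vlist_prod !msymM msym_onem msym_vdm.
rewrite -!mulrA => /(can_inj (signrMK _)).
by rewrite !mulrA.
Qed.

End PolyOp.

Section LeadingTerms.
Variables (F : fieldType) (n : nat).
Implicit Types (p r : {mpoly F[n]}) (m k : 'X_{1..n}) (i j l : 'I_n) (u : F)
  (z : 'I_n -> F).

(** With x = q a b t^(n-1) and y = 1 this is the eigenvalue E_m of D_B; with
    (x, y) = (1, 0) and (0, 1) it is the one of the two Macdonald operators. *)
Definition eigsum (q t x y : F) m := \sum_(j < n)
  (x * t ^+ rho j * (q ^+ m j - 1) + y * t ^+ j * (q ^- m j - 1)).

(** The polynomial [g] represents the operator applied to [p]: it has the right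
    values at all points where the coefficients are defined, the operator is
    triangular for the monomial order, and it lowers the degree as soon as
    both constant coefficients vanish. *)
Definition qop_repr (q t : F) (al be : F * F * F) p g := [/\ g \is symmetric,
    forall z, injective z -> (forall i, z i != 0) ->
      g.@[z] = qop q t (laurent al) (laurent be) p z,
    forall k, (mlead p <= k)%O ->
      (mlead g <= k)%O /\ g@_k = eigsum q t al.1.1 be.1.1 k * p@_k
    & forall d, al.1.1 = 0 -> be.1.1 = 0 -> (msize p <= d.+1)%N -> (msize g <= d)%N].

Lemma mlead_cpol j (y : F * F * F) : (mlead (cpol j y) <= (onem n + onem n)%MM)%O.
Proof.
apply: mlead_le_sup => m; rewrite !mcoeffD !mcoeffZ !mcoeffX.
have h : ((onem n - U_(j))%MM <= onem n)%O by apply/lem_leo/lem_subr.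
have [<- _|_] := (onem n + onem n)%MM =P m; first exact: lexx.
have [<- _|_] := (onem n + (onem n - U_(j)))%MM =P m; first by rewrite lemc_add2r.
have [<- _|_] := (onem n - U_(j) + (onem n - U_(j)))%MM =P m; first exact: lem_add.
by rewrite !mulr0 !addr0 eqxx.
Qed.

Lemma mcoeff_cpol j (y : F * F * F) : (cpol j y)@_(onem n + onem n) = y.1.1.
Proof.
have N k : (onem n - U_(j) + k == onem n + onem n)%MM = (k == onem n + U_(j))%MM.
  by rewrite -{2}(onemBK j) -addmA eqm_add2l addmC.
rewrite !mcoeffD !mcoeffZ !mcoeffX eqxx mulr1 [(onem n + _)%MM]addmC !N.
have -> : (onem n == onem n + U_(j))%MM = false.
  by apply/eqP => /mnmP /(_ j); rewrite mnmDE mnm1E eqxx; lia.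
have -> : (onem n - U_(j) == onem n + U_(j))%MM = false.
  by apply/eqP => /mnmP /(_ j); rewrite mnmDE mnmBE mnm1E eqxx; lia.
by rewrite !mulr0 !addr0.
Qed.

Lemma mleadB_sup p r m : (mlead p <= m)%O -> (mlead r <= m)%O -> (mlead (p - r) <= m)%O.
Proof. by move=> hp hr; apply: (le_trans (mleadB_le _ _)); rewrite leUx hp. Qed.
Lemma mleadD_sup p r m : (mlead p <= m)%O -> (mlead r <= m)%O -> (mlead (p + r) <= m)%O.
Proof. by move=> hp hr; apply: (le_trans (mleadD_le _ _)); rewrite leUx hp. Qed.
Lemma mleadM_sup p r m k : (mlead p <= m)%O -> (mlead r <= k)%O ->
  (mlead (p * r) <= (m + k)%MM)%O.
Proof. by move=> hp hr; apply: (le_trans (mleadM_le _ _)); apply: lem_add. Qed.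

Lemma msize_mleadW p k d : (mlead p <= k)%O -> (mdeg k <= d)%N -> (msize p <= d.+1)%N.
Proof.
move=> pk kd; have [->|p0] := eqVneq p 0; first by rewrite msize0.
by rewrite -mlead_deg // ltnS; apply: leq_trans kd; apply: lemc_mdeg.
Qed.

Lemma msizeB_sup p r d : (msize p <= d)%N -> (msize r <= d)%N -> (msize (p - r)%R <= d)%N.
Proof.
by move=> hp hr; apply: leq_trans (msizeD_le _ _) _; rewrite msizeN geq_max hp.
Qed.
Lemma msizeD_sup p r d : (msize p <= d)%N -> (msize r <= d)%N -> (msize (p + r)%R <= d)%N.
Proof. by move=> hp hr; apply: leq_trans (msizeD_le _ _) _; rewrite geq_max hp. Qed.
Lemma msizeZ_sup (x : F) p d : (msize p <= d)%N -> (msize (x *: p)%R <= d)%N.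
Proof. exact: leq_trans (msizeZ_le _ _). Qed.
Lemma msizeM_sup p r d e : (msize p <= d)%N -> (msize r <= e.+1)%N ->
  (msize (p * r)%R <= d + e)%N.
Proof.
move=> hp hr; have [->|p0] := eqVneq p 0; first by rewrite mul0r msize0.
have [->|r0] := eqVneq r 0; first by rewrite mulr0 msize0.
rewrite msizeM //; move: (msize p) (msize r) hp hr => x y; lia.
Qed.

Lemma mcoeff_msize0 p m : (msize p <= mdeg m)%N -> p@_m = 0.
Proof. by move=> h; apply: memN_msupp_eq0; apply: msize_mdeg_ge. Qed.

Lemma mdeg_onem : mdeg (onem n) = n.
Proof.
by rewrite mdegE (eq_bigr (fun=> 1%N)) => [|i _]; rewrite ?sum1_card ?card_ord ?mnmE.
Qed.

Lemma msize_dilate u j p : (msize (dilate u j p) <= msize p)%N.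
Proof.
rewrite msizeE; apply/bigmax_leqP_seq => m; rewrite mcoeff_msupp mcoeff_dilate => h _.
apply: msize_mdeg_lt; rewrite mcoeff_msupp.
by apply: contraNneq h => ->; rewrite mulr0.
Qed.

Lemma msize_cpol0 j (y : F * F * F) : y.1.1 = 0 -> (msize (cpol j y) <= n + n)%N.
Proof.
move=> y0; rewrite /cpol y0 scale0r add0r.
have d1 : (mdeg (onem n - U_(j))).+1 = n.
  by rewrite -addn1 -(mdeg1 j) -mdegD onemBK mdeg_onem.
by apply: msizeD_sup; apply: msizeZ_sup; rewrite msizeX mdegD ?mdeg_onem; lia.
Qed.

Hypothesis two0 : (2%:R : F) != 0.
Variables (q t : F) (al be : F * F * F).
Hypotheses (q0 : q != 0) (t0 : t != 0) (abE : al.2 = t ^+ n.-1 * q^-1 * be.2).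

(** The leading exponents of the factors add up, and the dilations multiply the
    leading coefficients by powers of q and t. *)
Lemma lead_Hpol p k : (mlead p <= k)%O ->
  let K := (onem n + onem n + delta n + k)%MM in
  (mlead (Hpol q t al be p) <= K)%O /\
  (Hpol q t al be p)@_K = eigsum q t al.1.1 be.1.1 k * p@_k * (vandermonde F n)@_(delta n).
Proof.
move=> pk K; have dp u j : (mlead (dilate u j p - p) <= k)%O.
  by apply: mleadB_sup => //; apply: le_trans (mlead_dilate _ _ _) pk.
have dv u j : (mlead (dilate u j (vandermonde F n)) <= delta n)%O.
  by apply: le_trans (mlead_dilate _ _ _) _; rewrite mlead_vdm.
have dc u j (y : F * F * F) :
    (mlead (cpol j y * dilate u j (vandermonde F n)) <= (onem n + onem n + delta n)%MM)%O.
  by apply: mleadM_sup => //; apply: mlead_cpol.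
split.
  rewrite /Hpol; elim/big_ind: _ => [|x y|j _]; first by rewrite mlead0 le0m.
    exact: mleadD_sup.
  apply: mleadD_sup; first exact: mleadM_sup.
  by apply: le_trans (mleadZ_le _ _) _; apply: mleadM_sup.
rewrite /Hpol raddf_sum /eigsum !mulr_suml; apply: eq_bigr => j _ /=.
rewrite mcoeffD mcoeffZ /K !mleadcMW //; try exact: mlead_cpol.
rewrite !mcoeff_cpol !mcoeffB !mcoeff_dilate mnmE.
have -> : t ^+ j = t ^+ n.-1 * t^-1 ^+ rho j.
  have -> : n.-1 = (j + rho j)%N by rewrite /rho; have := ltn_ord j; lia.
  by rewrite exprD exprVn mulfK // expf_neq0.
rewrite !exprVn. by ring.
Qed.

(** All four properties are transported from [Hpol] to its quotient by the
    denominator, whose leading exponent is known. *)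
Theorem qop_polynomial p : p \is symmetric -> exists g, qop_repr q t al be p g.
Proof.
move=> ps; have [g gs gE] := Hpol_factor two0 q0 abE ps; exists g.
have X0 : 'X_[onem n] != 0 :> {mpoly F[n]} by rewrite -mleadc_eq0 mleadXm mcoeffX eqxx oner_eq0.
have V0 := vdm_neq0 F n.
have LZ : mlead ('X_[onem n] * (vandermonde F n * 'X_[onem n])) = (onem n + (delta n + onem n))%MM.
  by rewrite !mleadM ?mulf_neq0 // mleadXm mlead_vdm.
split=> //; last first.
  move=> d al0 be0 pd; have [->|g0] := eqVneq g 0; first by rewrite msize0.
  have Hd : (msize (Hpol q t al be p) <= n + n + mdeg (delta n) + d)%N.
    have dv u j : (msize (dilate u j (vandermonde F n)) <= (mdeg (delta n)).+1)%N.
      by apply: leq_trans (msize_dilate _ _ _) _; rewrite -mlead_deg // mlead_vdm.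
    have dp u j : (msize (dilate u j p - p)%R <= d.+1)%N.
      by apply: msizeB_sup => //; apply: leq_trans (msize_dilate _ _ _) pd.
    rewrite /Hpol; elim/big_ind: _ => [|x y|j _]; first by rewrite msize0.
      exact: msizeD_sup.
    apply: msizeD_sup; last apply: msizeZ_sup; apply: msizeM_sup => //;
      by apply: msizeM_sup => //; apply: msize_cpol0.
  move: Hd; rewrite gE -mlead_deg ?mulf_neq0 // mleadM ?mulf_neq0 // LZ !mdegD.
  rewrite !mdeg_onem -(mlead_deg g0); move: (mdeg (mlead g)) (mdeg (delta n)) => x y; lia.
  move=> k pk; have [HL HC] := lead_Hpol pk.
  have KE : (onem n + onem n + delta n + k = onem n + (delta n + onem n) + k)%MM.
    by rewrite -[(onem n + onem n + _)%MM]addmA [(onem n + delta n)%MM]addmC.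
  rewrite KE in HL HC.
  have gk : (mlead g <= k)%O.
    have [->|g0] := eqVneq g 0; first by rewrite mlead0 le0m.
    by move: HL; rewrite gE mleadM ?mulf_neq0 // LZ lemc_add2r.
  split=> //; move: HC; rewrite gE mleadcMW ?LZ //.
  rewrite !mleadcMW ?mlead_vdm ?mleadXm //; last by rewrite mleadM // mlead_vdm mleadXm.
  rewrite !mcoeffX !eqxx mul1r mulr1 [RHS]mulrC => /mulfI; apply.
  by rewrite -(mlead_vdm F) mleadc_eq0.
move=> z zi z0; have := meval_Hpol q al be t0 p zi z0.
rewrite gE !mevalM meval_onem => e.
have P0 : \prod_l z l != 0 by apply/prodf_neq0 => l _; apply: z0.
have Vz := meval_vdm_neq0 zi.
apply: (mulfI (mulf_neq0 (expf_neq0 2 P0) Vz)); rewrite -e; ring.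
Qed.
End LeadingTerms.

(** * Partitions, monomial symmetric polynomials and fixing the last variable *)

Section Part.
Variable n : nat.
Implicit Types (m k : 'X_{1..n}) (i j l : 'I_n).

Lemma partP m : reflect (forall i j, (i <= j)%N -> (m j <= m i)%N) (is_partition m).
Proof.
rewrite /is_partition; apply: (iffP idP) => [sm i j ij|h].
  rewrite !(mnm_nth 0).
  apply: (sorted_leq_nth _ _ 0 sm) => //; try by rewrite inE size_tuple.
    by move=> a b c ab bc; apply: leq_trans bc ab.
  by move=> a; rewrite /= leqnn.
apply/(sortedP 0) => i; rewrite size_tuple => ilt.
by have := h (Ordinal (ltnW ilt)) (Ordinal ilt) (leqnSn i); rewrite !(mnm_nth 0).
Qed.

Lemma mperm_perm_eq (s : 'S_n) m : perm_eq [multinom m (s i) | i < n] m.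
Proof.
by apply/tuple_permP; exists s; congr val.
Qed.

Lemma part_perm_eq m k : is_partition m -> is_partition k -> perm_eq m k -> m = k.
Proof.
move=> sm sk mk; do 2 apply: val_inj => /=.
apply: sorted_eq sm sk mk; first by move=> a b c ab bc; apply: leq_trans bc ab.
by move=> a b /= /andP[ab ba]; apply/eqP; rewrite eqn_leq ab ba.
Qed.

Lemma perm_eq_mdeg m k : perm_eq m k -> mdeg m = mdeg k.
Proof. by move=> mk; rewrite /mdeg; apply: perm_big. Qed.
End Part.

Section Msymm.
Variables (F : fieldType) (n : nat).
Implicit Types (m k : 'X_{1..n}) (i j l : 'I_n).

Lemma mcoeff_msymm m k : (msymm F m)@_k = (perm_eq k m)%:R.
Proof.
rewrite /msymm raddf_sum /=; case: (boolP (perm_eq k m)) => [km|km].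
  have kb : (mdeg k < (mdeg m).+1)%N by rewrite (perm_eq_mdeg km).
  rewrite (bigD1 (BMultinom kb)) //= mcoeffX eqxx big1 ?addr0 // => i /andP[_ ik].
  by rewrite mcoeffX; move: ik; rewrite bmeqP /= => /negPf ->.
rewrite big1 // => i im; rewrite mcoeffX; case: eqP => // e.
by rewrite -e im in km.
Qed.

Lemma msymm_sym m : msymm F m \is symmetric.
Proof.
apply/issymP => s; apply/mpolyP => k; rewrite mcoeff_sym !mcoeff_msymm.
by congr (_%:R); have /permPl -> := mperm_perm_eq s k.
Qed.

Lemma msize_msymm m : (msize (msymm F m) <= (mdeg m).+1)%N.
Proof.
rewrite msizeE; apply/bigmax_leqP_seq => k; rewrite mcoeff_msupp mcoeff_msymm => h _.
by case: (boolP (perm_eq k m)) h => [/perm_eq_mdeg -> //|_]; rewrite eqxx.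
Qed.
End Msymm.

Section LinearFactors.
Variables (F : fieldType) (n : nat) (c : F).

Lemma mlead_XsubC (i : 'I_n) : mlead ('X_i - c%:MP : {mpoly F[n]}) = U_(i)%MM.
Proof.
rewrite mleadDl ?mleadXm // mleadN mleadC; apply: lt_mdeg_ltmc.
by rewrite mdeg0 mdeg1.
Qed.

Lemma XsubC_neq0 (i : 'I_n) : 'X_i - c%:MP != 0 :> {mpoly F[n]}.
Proof.
rewrite -mleadc_eq0 mlead_XsubC mcoeffB mcoeffXU eqxx mcoeffC mnm1_eq0 mulr0 subr0.
exact: oner_neq0.
Qed.

Lemma mlead_prodXsubC : mlead (\prod_(i < n) ('X_i - c%:MP) : {mpoly F[n]}) = onem n.
Proof.
rewrite mlead_prod => [|i _ _]; last exact: XsubC_neq0.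
apply/mnmP => i; rewrite mnm_sumE (bigD1 i) //= mlead_XsubC mnm1E eqxx big1 ?mnmE //.
by move=> j ji; rewrite mlead_XsubC mnm1E (negPf ji).
Qed.
End LinearFactors.

(** Multiplicative independence of q and t: the points c q^m t^rho are then
    distinct and have distinct coordinates. *)
Definition qt_free (F : fieldType) (q t : F) :=
  forall i j k l, q ^+ i * t ^+ j = q ^+ k * t ^+ l -> i = k /\ j = l.

Definition lat (F : fieldType) (q t c : F) n (m : 'X_{1..n}) (i : 'I_n) : F :=
  c * q ^+ m i * t ^+ rho i.

Section Restrict.
Variables (F : fieldType) (n : nat).
Implicit Types (c : F) (p : {mpoly F[n.+1]}) (m : 'X_{1..n.+1}) (k : 'X_{1..n}).

(** Here and below z_n is the last variable, of index [ord_max]: [rst] sets it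
    to c in a polynomial, [mrst] drops it from an exponent, [mext] adds an entry
    0 to an exponent, and [zext] adds a coordinate c to a point. *)
Definition rst c p : {mpoly F[n]} :=
  p \mPo [tuple (if unlift ord_max i is Some j then 'X_j else c%:MP) | i < n.+1].

Definition mrst m : 'X_{1..n} := [multinom m (lift ord_max j) | j < n].
Definition mext (k : 'X_{1..n}) : 'X_{1..n.+1} :=
  [multinom (if unlift ord_max i is Some j then k j else 0%N) | i < n.+1].
Definition zext c (z : 'I_n -> F) : 'I_n.+1 -> F :=
  fun i => if unlift ord_max i is Some j then z j else c.

Lemma meval_rst c p z : (rst c p).@[z] = p.@[zext c z].
Proof.
rewrite /rst comp_mpoly_meval; apply: meval_eq => i; rewrite tnth_mktuple /zext.
by case: unlift => [j|]; rewrite ?mevalXU ?mevalC.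
Qed.

Lemma mdeg_mrst m : mdeg m = (mdeg (mrst m) + m ord_max)%N.
Proof.
rewrite !mdegE big_ord_recr /=; congr (_ + _)%N; apply: eq_bigr => i _.
by rewrite mnmE; congr (m _); apply: ord_inj; rewrite lift_max.
Qed.

Lemma mrstK k : mrst (mext k) = k.
Proof. by apply/mnmP => i; rewrite !mnmE liftK. Qed.
Lemma mext_max k : mext k ord_max = 0%N.
Proof. by rewrite mnmE unlift_none. Qed.
Lemma mdeg_mext k : mdeg (mext k) = mdeg k.
Proof. by rewrite mdeg_mrst mrstK mext_max addn0. Qed.
Lemma mext_rst m : m ord_max = 0%N -> mext (mrst m) = m.
Proof.
move=> m0; apply/mnmP => i; rewrite mnmE; case: unliftP => [j ->|->] //.
by rewrite mnmE.
Qed.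

Lemma part_mext k : is_partition k -> is_partition (mext k).
Proof.
move=> /partP kp; apply/partP => i j ij; rewrite !mnmE.
case: unliftP => [j' ej|//]; case: unliftP => [i' ei|ei]; last first.
  by move: ij; rewrite ei ej lift_max leqNgt ltn_ord.
by apply: kp; move: ij; rewrite ei ej !lift_max.
Qed.

Lemma part_mrst m : is_partition m -> is_partition (mrst m).
Proof.
by move=> /partP mp; apply/partP => i j ij; rewrite !mnmE; apply: mp; rewrite !lift_max.
Qed.

Lemma rstE c p : rst c p = \sum_(m <- msupp p) (p@_m * c ^+ m ord_max) *: 'X_[mrst m].
Proof.
rewrite /rst comp_mpolyE; apply: eq_bigr => m _; rewrite -scalerA; congr (_ *: _).
rewrite big_ord_recr /= mulrC tnth_mktuple unlift_none -(rmorphXn (@mpolyC n F)) mul_mpolyC.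
congr (_ *: _); rewrite mpolyXE_id; apply: eq_bigr => i _.
have -> : widen_ord (leqnSn n) i = lift ord_max i.
  by apply: ord_inj; rewrite lift_max.
by rewrite tnth_mktuple liftK mnmE.
Qed.

Lemma msize_rst c p : (msize (rst c p) <= msize p)%N.
Proof.
rewrite rstE; apply: leq_trans (msize_sum _ _ _) _.
apply/bigmax_leqP_seq => m mp _; apply: leq_trans (msizeZ_le _ _) _.
rewrite msizeX; apply: leq_trans (msize_mdeg_lt mp).
by rewrite ltnS (mdeg_mrst m) leq_addr.
Qed.

(** Exponents with a positive last entry contribute to strictly lower degree
    after the restriction. *)
Lemma mcoeff_rst c p (k : 'X_{1..n}) : (msize p <= (mdeg k).+1)%N ->
  (rst c p)@_k = p@_(mext k).
Proof.
move=> ps; rewrite rstE raddf_sum /=.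
have E m : m \in msupp p -> (p@_m * c ^+ m ord_max) * (mrst m == k)%:R
                         = p@_m * (m == mext k)%:R.
  move=> mp; case: eqP => [e|ne]; last first.
    by case: eqP => [e|_]; [case: ne; rewrite e mrstK | rewrite !mulr0].
  have := leq_trans (msize_mdeg_lt mp) ps.
  rewrite ltnS mdeg_mrst e -{2}[mdeg k]addn0 leq_add2l leqn0 => /eqP m0.
  by rewrite m0 expr0 mulr1 -e mext_rst // eqxx.
rewrite big_seq (eq_bigr (fun m => p@_m * (m == mext k)%:R)); last first.
  by move=> m mp; rewrite mcoeffZ mcoeffX E.
rewrite -big_seq {3}(mpolyE p) raddf_sum /=; apply: eq_bigr => m _.
by rewrite mcoeffZ mcoeffX.
Qed.

Lemma msymE_comp n' (s : 'S_n') (p : {mpoly F[n']}) :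
  msym s p = p \mPo [tuple 'X_(s i) | i < n'].
Proof.
rewrite -[LHS]comp_mpoly_id msym_mPo; congr (_ \mPo _); apply: eq_from_tnth => i.
by rewrite !tnth_mktuple.
Qed.

Lemma rst_sym c p : p \is symmetric -> rst c p \is symmetric.
Proof.
move=> /issymP ps; apply/issymP => s.
rewrite -{2}(ps (lift_perm ord_max ord_max s)) /rst msym_mPo msymE_comp comp_mpoly_comp.
congr (_ \mPo _); apply: eq_from_tnth => i; rewrite !tnth_mktuple.
case: unliftP => [j ->|->]; last by rewrite comp_mpolyC lift_perm_id unlift_none.
by rewrite lift_perm_lift liftK comp_mpolyXU -tnth_nth tnth_mktuple.
Qed.

Lemma subst_rst c p : rst c p = 0 -> subst ord_max c%:MP p = 0.
Proof.
move=> p0; rewrite /subst.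
have -> : [tuple if l == ord_max then c%:MP else 'X_l | l < n.+1]
   = [tuple tnth [tuple (if unlift ord_max i is Some j then 'X_j else c%:MP) | i < n.+1] i
        \mPo [tuple 'X_(lift ord_max j) | j < n] | i < n.+1] :> _.-tuple {mpoly F[n.+1]}.
  apply: eq_from_tnth => i; rewrite !tnth_mktuple.
  case: unliftP => [j ->|->]; last by rewrite eqxx comp_mpolyC.
  by rewrite comp_mpolyXU -tnth_nth tnth_mktuple eq_sym (negPf (neq_lift _ _)).
by rewrite -comp_mpoly_comp -/(rst c p) p0 comp_mpoly0.
Qed.

Lemma msym_substC n' (s : 'S_n') j c (p : {mpoly F[n']}) :
  msym s (subst j c%:MP p) = subst (s j) c%:MP (msym s p).
Proof.
rewrite /subst msym_mPo msymE_comp comp_mpoly_comp; congr (_ \mPo _).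
apply: eq_from_tnth => i; rewrite !tnth_mktuple (inj_eq (@perm_inj _ s)).
case: eqP => _; first by rewrite comp_mpolyC.
by rewrite comp_mpolyXU -tnth_nth tnth_mktuple.
Qed.

(** A symmetric polynomial that vanishes for z_n = c vanishes for z_i = c, all
    i. *)
Lemma rst0_dvd c p : p \is symmetric -> rst c p = 0 ->
  exists2 g, g \is symmetric & p = \prod_i ('X_i - c%:MP) * g.
Proof.
move=> /issymP ps p0.
have sz i : subst i c%:MP p = 0.
  rewrite -(ps (tperm ord_max i)) -[X in subst X _ _](tpermL ord_max i).
  by rewrite -msym_substC subst_rst // msym0.
have Xc i : 'X_i - c%:MP != 0 :> {mpoly F[n.+1]} by apply: XsubC_neq0.
pose s : seq ('I_n.+1 * {mpoly F[n.+1]}) := [seq (i, c%:MP) | i <- enum 'I_n.+1].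
have su : uniq s by rewrite map_inj_uniq ?enum_uniq // => i j [].
have [||g gE] := @subst_prod_dvd F n.+1 s p su.
- move=> x y /mapP[i _ ->] /mapP[j _ ->] /= ne.
  have -> : subst i c%:MP ('X_j - c%:MP) = subst i c%:MP 'X_j - c%:MP.
    by rewrite substB; congr (_ - _); rewrite /subst comp_mpolyC.
  rewrite substX; case: (eqVneq j i) => [e|_]; last exact: Xc.
  by rewrite e eqxx in ne.
- by move=> x /mapP[i _ ->].
exists g; last by rewrite gE big_map big_enum.
have P0 : \prod_i ('X_i - c%:MP) != 0 :> {mpoly F[n.+1]} by apply/prodf_neq0.
apply/issymP => w; apply: (mulfI P0); rewrite big_map big_enum /= in gE.
rewrite -gE -[RHS](ps w) gE msymM; congr (_ * _); rewrite rmorph_prod /=.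
rewrite (reindex_inj (@perm_inj _ w)) /=; apply: eq_bigr => i _.
by rewrite msymB msymXU msymE_comp comp_mpolyC.
Qed.
End Restrict.

(** * Interpolation at the points c q^m t^rho *)

Section Lat.
Variables (F : fieldType) (q t : F).
Hypothesis qt : qt_free q t.
Implicit Types (c : F).

Lemma qt_q0 : q != 0.
Proof.
apply/eqP => q0; have [] := @qt 1 0 2 0; last by [].
by rewrite q0 !expr0n.
Qed.
Lemma qt_t0 : t != 0.
Proof.
apply/eqP => t0; have [] := @qt 0 1 0 2; last by [].
by rewrite t0 !expr0n.
Qed.

Lemma qt_q1 : q != 1.
Proof. by apply/eqP => e; have [] := @qt 1 0 0 0; rewrite ?e ?expr1n ?expr0. Qed.
Lemma qt_t1 : t != 1.
Proof. by apply/eqP => e; have [] := @qt 0 1 0 0; rewrite ?e ?expr1n ?expr0. Qed.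

Lemma lat_inj c n (m : 'X_{1..n}) : c != 0 -> injective (lat q t c m).
Proof.
move=> c0 i j; rewrite /lat -!mulrA => /(mulfI c0) /qt[_].
rewrite /rho => e; apply: ord_inj; have := ltn_ord i; have := ltn_ord j; lia.
Qed.

Lemma lat_neq0 c n (m : 'X_{1..n}) i : c != 0 -> lat q t c m i != 0.
Proof. by move=> c0; rewrite !mulf_neq0 ?expf_neq0 ?qt_q0 ?qt_t0. Qed.

(** The points with m_n = 0 have last coordinate c, and the other coordinates
    form a point of the same kind in n - 1 variables, with c t in place of c. *)
Lemma lat_ext c n (k : 'X_{1..n}) : lat q t c (mext k) =1 zext c (lat q t (c * t) k).
Proof.
move=> i; rewrite /lat /zext mnmE; case: unliftP => [j ->|->]; last first.
  by rewrite /rho subnn !expr0 !mulr1.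
have -> : rho (lift ord_max j) = (rho j).+1.
  by rewrite /rho lift_max subSn.
by rewrite exprS; ring.
Qed.

(** The points with m_n > 0 are the points for q c in place of c. *)
Lemma lat_onem c n (k : 'X_{1..n}) : lat q t c (k + onem n)%MM =1 lat q t (q * c) k.
Proof. by move=> i; rewrite /lat mnmDE [onem n i]mnmE addn1 exprS; ring. Qed.

Lemma part_onem n (k : 'X_{1..n}) : is_partition k -> is_partition (k + onem n)%MM.
Proof.
move=> /partP kp; apply/partP => i j ij.
by rewrite !mnmDE [onem n i]mnmE [onem n j]mnmE leq_add2r kp.
Qed.

(** Double induction. On the points with m_n = 0 the restriction of g to z_n = c
    satisfies the same hypothesis in n - 1 variables, so it vanishes and g is
    divisible by the product of the z_i - c. On the points with m_n > 0 this
    product does not vanish, so the quotient, of degree lower by n, satisfies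
    the hypothesis for q c. *)
Lemma lat_uniq n c k (g : {mpoly F[n]}) : c != 0 -> g \is symmetric ->
  (msize g <= k.+1)%N ->
  (forall m, is_partition m -> (mdeg m <= k)%N -> g.@[lat q t c m] = 0) -> g = 0.
Proof.
elim: n c k g => [|n IHn] c k g c0.
  move=> _ _ gv; rewrite (nvar0_mpolyC g).
  have := gv 0%MM; rewrite mdeg0 /= => /(_ _ (leq0n k)).
  rewrite {1}(nvar0_mpolyC g) mevalC => -> //.
  by apply/partP => -[].
elim/ltn_ind: k c g c0 => k IHk c g c0 gs gk gv.
have r0 : rst c g = 0.
  apply: (IHn (c * t) k) => //.
  - by rewrite mulf_neq0 ?qt_t0.
  - exact: rst_sym.
  - exact: leq_trans (msize_rst _ _) gk.
  move=> m mp mk; rewrite meval_rst -(meval_eq _ (lat_ext c m)); apply: gv.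
    exact: part_mext.
  by rewrite mdeg_mext.
have [g2 g2s gE] := rst0_dvd gs r0.
have [e20|g20] := eqVneq g2 0; first by rewrite gE e20 mulr0.
have P0 : \prod_(i < n.+1) ('X_i - c%:MP) != 0 :> {mpoly F[n.+1]}.
  by apply/prodf_neq0 => i _; apply: XsubC_neq0.
have g0 : g != 0 by rewrite gE mulf_neq0.
have sz : (mdeg (mlead g2) + n.+1 <= k)%N.
  move: gk; rewrite -mlead_deg // ltnS gE mleadM // mlead_prodXsubC mdegD mdeg_onem.
  by rewrite addnC.
suff g2z : g2 = 0 by rewrite g2z eqxx in g20.
apply: (IHk (k - n.+1)%N _ (q * c)) => //.
- lia.
- by rewrite mulf_neq0 ?qt_q0.
- by rewrite -mlead_deg // ltnS; lia.
move=> m mp mk.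
have sb : (mdeg (m + onem n.+1)%MM <= k)%N by rewrite mdegD mdeg_onem; clear -mk sz; lia.
have := gv _ (part_onem mp) sb.
rewrite gE mevalM (meval_eq g2 (lat_onem c m)) => /eqP.
rewrite mulf_eq0 => /orP[|/eqP //]; rewrite rmorph_prod /=.
move=> /prodf_eq0[i _]; rewrite mevalB mevalXU mevalC subr_eq0 /lat mnmDE.
rewrite [onem _ i]mnmE -mulrA -[X in _ == X]mulr1 => /eqP /(mulfI c0).
rewrite -(expr0 q) -[X in _ = X]mulr1 -(expr0 t) => /qt[]; lia.
Qed.

(** The monomial symmetric polynomials of degree at most |m| are as many as the
    points, so the evaluation matrix is square, and invertible by uniqueness. *)
Lemma interp_ex n c (m : 'X_{1..n}) : c != 0 -> is_partition m ->
  exists R, [/\ R \is symmetric, (msize R <= (mdeg m).+1)%N &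
    forall k, is_partition k -> (mdeg k <= mdeg m)%N -> R.@[lat q t c k] = (k == m)%:R].
Proof.
move=> c0 mp; pose T := {k : 'X_{1..n < (mdeg m).+1} | is_partition k}.
pose v (i : 'I_#|{: T}|) : 'X_{1..n} := val (val (enum_val i)).
have vp i : is_partition (v i) by apply: (valP (enum_val i)).
have vb i : (mdeg (v i) <= mdeg m)%N by apply: (valP (val (enum_val i))).
have vi : injective v.
  by move=> i j e; apply: enum_val_inj; do 2 apply: val_inj.
have vs k : is_partition k -> (mdeg k <= mdeg m)%N -> exists i, v i = k.
  move=> kp kb; pose x : T := exist _ (BMultinom (kb : mdeg k < (mdeg m).+1)%N) kp.
  by exists (enum_rank x); rewrite /v enum_rankK.
pose comb (a : 'rV[F]_#|{: T}|) := \sum_i a 0 i *: msymm F (v i).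
have combs a : comb a \is symmetric.
  by apply: rpred_sum => i _; rewrite rpredZ // msymm_sym.
have combz a : (msize (comb a) <= (mdeg m).+1)%N.
  apply: leq_trans (msize_sum _ _ _) _; apply/bigmax_leqP => i _.
  apply: leq_trans (msizeZ_le _ _) _; apply: leq_trans (msize_msymm _ _) _.
  by rewrite ltnS.
pose M := \matrix_(i, j) (msymm F (v i)).@[lat q t c (v j)].
have combM a j : (comb a).@[lat q t c (v j)] = (a *m M) 0 j.
  rewrite /comb raddf_sum mxE /=; apply: eq_bigr => i _; by rewrite mevalZ mxE.
have Mu : M \in unitmx.
  rewrite -row_free_unit -kermx_eq0; apply/eqP/row_matrixP => i0; rewrite row0.
  set a := row i0 _; have aM : a *m M = 0 by rewrite -row_mul mulmx_ker row0.
  have ca : comb a = 0.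
    apply: (lat_uniq c0 (combs a) (combz a)) => k kp kb.
    by have [j <-] := vs k kp kb; rewrite combM aM mxE.
  apply/rowP => j; rewrite [RHS]mxE.
  have := congr1 (mcoeff (v j)) ca; rewrite mcoeff0 raddf_sum (bigD1 j) //= big1.
    by rewrite addr0 mcoeffZ mcoeff_msymm perm_refl mulr1 => ->.
  move=> i ij; rewrite mcoeffZ mcoeff_msymm.
  case: (boolP (perm_eq _ _)) => [/part_perm_eq e|_]; last by rewrite mulr0.
  by case/eqP: ij; apply: vi; rewrite e.
have [j0 j0m] := vs m mp (leqnn _).
exists (comb (delta_mx 0 j0 *m invmx M)); split=> // k kp kb.
have [j <-] := vs k kp kb; rewrite combM mulmxKV // mxE eqxx /=.
by rewrite -(inj_eq vi) j0m.
Qed.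

End Lat.

(** * Lagrange interpolation identities and commuting Macdonald operators *)

Section Lagrange.
Variables (F : fieldType) (J : finType) (x : J -> F).
Hypothesis xi : injective x.
Implicit Type P : {poly F}.

Definition lbase j : {poly F} := \prod_(l | l != j) ('X - (x l)%:P).

Lemma size_lbase j : size (lbase j) = #|J|.
Proof.
rewrite /lbase -[LHS]/(size (\prod_(l in predC1 j) ('X - (x l)%:P))) -big_enum.
by rewrite size_prod_XsubC -cardE cardC1 prednK //; apply/card_gt0P; exists j.
Qed.

Lemma lead_lbase j : (lbase j)`_#|J|.-1 = 1.
Proof.
rewrite -[in LHS](size_lbase j) -[LHS]/(lead_coef (lbase j)); apply/eqP.
exact: monic_prod_XsubC.
Qed.

Lemma horner_lbase j y : (lbase j).[y] = \prod_(l | l != j) (y - x l).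
Proof.
by rewrite horner_prod; apply: eq_bigr => l _; rewrite hornerXsubC.
Qed.

Lemma lbase_neq0 j : \prod_(l | l != j) (x j - x l) != 0.
Proof. by apply/prodf_neq0 => l lj; rewrite subr_eq0 (inj_eq xi) eq_sym. Qed.

Lemma lagrange P : (size P <= #|J|)%N ->
  P = \sum_j (P.[x j] / \prod_(l | l != j) (x j - x l)) *: lbase j.
Proof.
move=> sP; apply/eqP; rewrite -subr_eq0; set Q := \sum_j _; apply/negPn/negP => D0.
have := @max_poly_roots _ _ [seq x j | j <- enum J] D0 _ _.
rewrite size_map -cardE map_inj_uniq ?enum_uniq // => H.
have : (#|J| < size (P - Q)%R)%N.
  apply: H => //; apply/allP => _ /mapP[j _ ->]; rewrite rootE hornerD hornerN subr_eq0.
  rewrite /Q horner_sum (bigD1 j) //= [X in _ + X]big1 ?addr0 => [|i ij].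
    by rewrite hornerZ horner_lbase divfK // lbase_neq0.
  by rewrite hornerZ horner_lbase [X in _ * X](bigD1 j) 1?eq_sym //= subrr mul0r mulr0.
rewrite ltnNge; case/negP; apply: leq_trans (size_polyD _ _) _.
rewrite geq_max sP size_polyN /=; apply: leq_trans (size_sum _ _ _) _.
apply/bigmax_leqP => j _; apply: leq_trans (size_scale_leq _ _) _.
by rewrite size_lbase.
Qed.

(** The identities for sums of A_j^+ and A_j^- below compare a polynomial with
    its Lagrange interpolant, in the top coefficient or at 0. *)
Lemma lagrange_lead P : (size P <= #|J|)%N ->
  P`_#|J|.-1 = \sum_j P.[x j] / \prod_(l | l != j) (x j - x l).
Proof.
move=> sP; rewrite {1}(lagrange sP) coef_sum; apply: eq_bigr => j _.
by rewrite coefZ lead_lbase mulr1.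
Qed.

Lemma lagrange_0 P : (size P <= #|J|)%N ->
  P.[0] = \sum_j P.[x j] * \prod_(l | l != j) (- x l / (x j - x l)).
Proof.
move=> sP; rewrite {1}(lagrange sP) horner_sum; apply: eq_bigr => j _.
rewrite hornerZ horner_lbase prodf_div -mulrA [X in _ * X]mulrC; congr (_ * (_ / _)).
by apply: eq_bigr => l _; rewrite sub0r.
Qed.
End Lagrange.

Lemma size_subXn (F : fieldType) k (P Q : {poly F}) :
  (size P <= k.+1)%N -> (size Q <= k.+1)%N -> P`_k = Q`_k -> (size (P - Q)%R <= k)%N.
Proof.
move=> sP sQ e; apply/leq_sizeP => j; rewrite leq_eqVlt => /orP[/eqP <-|kj].
  by rewrite coefB e subrr.
by rewrite coefB !nth_default ?subrr // (leq_trans _ kj).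
Qed.

Lemma coef_prodXsubC_pred (F : fieldType) n (z : 'I_n.+1 -> F) :
  (\prod_l ('X - (z l)%:P))`_n = - \sum_l z l.
Proof.
have := @coefPn_prod_XsubC F [seq z l | l <- index_enum 'I_n.+1].
have -> : size [seq z l | l <- index_enum 'I_n.+1] = n.+1.
  by rewrite size_map /index_enum unlock -enumT size_enum_ord.
by rewrite !big_map /=; apply.
Qed.

Section Sums.
Variables (F : fieldType) (n : nat) (t : F) (z : 'I_n -> F).
Hypotheses (zi : injective z) (z0 : forall i, z i != 0) (t1 : t != 1).

Let P : {poly F} := \prod_l ('X - (t * z l)%:P) - \prod_l ('X - (z l)%:P).

Let sP : (size P <= #|'I_n|)%N.
Proof.
rewrite card_ord; have sz (y : 'I_n -> F) : size (\prod_l ('X - (y l)%:P)) = n.+1.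
  by rewrite size_prod_XsubC /index_enum unlock -enumT size_enum_ord.
apply: size_subXn; rewrite ?sz //.
have lc (y : 'I_n -> F) : (\prod_l ('X - (y l)%:P))`_n = 1.
  have /monicP := monic_prod_XsubC (index_enum 'I_n) xpredT y.
  by rewrite /lead_coef sz.
by rewrite !lc.
Qed.

Let PE j : P.[z j] = (1 - t) * z j * \prod_(l < n | l != j) (z j - t * z l).
Proof.
rewrite /P hornerD hornerN !horner_prod [X in _ - X](bigD1 j) //=.
rewrite hornerXsubC subrr mul0r subr0 (bigD1 j) //= hornerXsubC.
congr (_ * _); first by rewrite mulrBl mul1r.
by apply: eq_bigr => l _; rewrite hornerXsubC.
Qed.

(** Interpolation of prod_l (X - t z_l) - prod_l (X - z_l) at the z_j: its
    value at z_j is (1 - t) z_j times the numerator of A_j^-. *)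
Lemma sum_zAm : \sum_j z j * Am t z j = \sum_j z j.
Proof.
have t1' : 1 - t != 0 by rewrite subr_eq0 eq_sym.
apply: (mulfI t1'); have := lagrange_lead zi sP; rewrite card_ord.
have -> : P`_n.-1 = (1 - t) * \sum_j z j.
  rewrite /P; case: (n) z => [|m] y; first by rewrite !big_ord0 subrr coef0 mulr0.
  rewrite coefB !coef_prodXsubC_pred opprK mulrBl mul1r addrC mulr_sumr.
  by [].
move=> ->; rewrite mulr_sumr; apply: eq_bigr => j _.
by rewrite PE /Am prodf_div !mulrA.
Qed.

(** The same interpolant, compared at X = 0. *)
Lemma sum_Am : \sum_j Am t z j = \sum_(j < n) t ^+ j.
Proof.
have t1' : 1 - t != 0 by rewrite subr_eq0 eq_sym.
have Z0 : \prod_l - z l != 0 by apply/prodf_neq0 => l _; rewrite oppr_eq0.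
apply: (mulfI (mulf_neq0 t1' Z0)).
have := lagrange_0 zi sP; rewrite /P hornerD hornerN !horner_prod.
under eq_bigr => l _ do rewrite hornerXsubC sub0r -mulrN.
rewrite big_split prodr_const card_ord /=.
under [X in _ - X]eq_bigr => l _ do rewrite hornerXsubC sub0r.
rewrite -[X in _ - X]mul1r -mulrBl subrX1 => e.
set Z := \prod_l - z l in e Z0 *; set S := \sum_(j < n) t ^+ j in e *.
have -> : (1 - t) * Z * S = - ((t - 1) * S * Z) by ring.
rewrite e -sumrN mulr_sumr; apply: eq_bigr => j _; rewrite -/P PE /Z (bigD1 j) //=.
rewrite /Am !prodf_div; ring.
Qed.

End Sums.

Section SumsPlus.
Variables (F : fieldType) (n : nat) (t : F) (z : 'I_n -> F).
Hypotheses (zi : injective z) (z0 : forall i, z i != 0) (t1 : t != 1) (t0 : t != 0).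

Let zVi : injective (fun i => (z i)^-1).
Proof. by move=> i j /invr_inj /zi. Qed.
Let zV0 i : (z i)^-1 != 0.
Proof. by rewrite invr_eq0. Qed.

(** The inversion of all coordinates exchanges A_j^+ and A_j^-. *)
Lemma Ap_AmV j : Ap t z j = Am t (fun i => (z i)^-1) j.
Proof.
apply: eq_bigr => l lj; have h : z l - z j != 0 by rewrite subr_eq0 (inj_eq zi).
have h' : z j - z l != 0 by rewrite subr_eq0 (inj_eq zi) eq_sym.
have h2 : (z j)^-1 - (z l)^-1 != 0 by rewrite subr_eq0 (inj_eq zVi) eq_sym.
by field; rewrite !z0 mulN1r h.
Qed.

Lemma sum_Ap : \sum_j Ap t z j = \sum_(j < n) t ^+ j.
Proof.
by rewrite -(sum_Am zVi zV0 t1); apply: eq_bigr => j _; apply: Ap_AmV.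
Qed.

Lemma sum_Ap_div : \sum_j Ap t z j / z j = \sum_j (z j)^-1.
Proof.
rewrite -(sum_zAm zVi t1); apply: eq_bigr => j _.
by rewrite Ap_AmV mulrC.
Qed.

End SumsPlus.

Lemma sum_Am_div (F : fieldType) n (t : F) (z : 'I_n -> F) :
  injective z -> (forall i, z i != 0) -> t != 1 -> t != 0 ->
  \sum_j Am t z j / z j = t ^+ n.-1 * \sum_j (z j)^-1.
Proof.
move=> zi z0 t1 t0; have t1' : t^-1 != 1 by rewrite invr_eq1.
rewrite -(sum_Ap_div zi z0 t1') mulr_sumr; apply: eq_bigr => j _.
by rewrite -Am_Ap // mulrA.
Qed.

Section Comm.
Variables (F : fieldType) (n : nat) (q t : F) (z : 'I_n -> F).
Hypotheses (q0 : q != 0) (t0 : t != 0) (t1 : t != 1) (q1 : q != 1) (qt1 : q != t).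
Hypotheses (z0 : forall i, z i != 0) (zi : injective z)
  (zq : forall i j, i != j -> q * z i != z j).

Let x (s : 'I_n + 'I_n) : F := match s with inl i => z i | inr i => z i / q end.
Let zq' i j : q * z i != z j.
Proof.
case: (eqVneq i j) => [->|]; last exact: zq.
by rewrite -subr_eq0 -{2}[z j]mul1r -mulrBl mulf_neq0 // subr_eq0.
Qed.
Let xi : injective x.
Proof.
have d i j : z i = z j / q -> False.
  by move=> e; have := zq' i j; rewrite e mulrC divfK ?eqxx.
move=> [i|i] [j|j] /= e; first by rewrite (zi e).
- by case: (d _ _ e).
- by case: (d _ _ (esym e)).
- by congr inr; apply: zi; apply: (mulIf (invr_neq0 q0)).
Qed.

Let Q : {poly F} := \prod_l ('X - (z l / t)%:P) * \prod_l ('X - (t * z l / q)%:P).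
Let Q' : {poly F} := \prod_l ('X - (z l)%:P) * \prod_l ('X - (z l / q)%:P).

Let sQ : (size (Q - Q')%R <= #|{: 'I_n + 'I_n}|)%N.
Proof.
have sz (y : 'I_n -> F) : size (\prod_l ('X - (y l)%:P)) = n.+1.
  by rewrite size_prod_XsubC /index_enum unlock -enumT size_enum_ord.
have mz (y : 'I_n -> F) : \prod_l ('X - (y l)%:P) \is monic by apply: monic_prod_XsubC.
have sM (y y' : 'I_n -> F) :
    size (\prod_l ('X - (y l)%:P) * \prod_l ('X - (y' l)%:P)) = (n + n).+1.
  by rewrite size_proper_mul ?sz ?(monicP (mz _)) ?mul1r ?oner_neq0 // addSn addnS.
have lM (y y' : 'I_n -> F) :
    (\prod_l ('X - (y l)%:P) * \prod_l ('X - (y' l)%:P))`_(n + n) = 1.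
  have /monicP : \prod_l ('X - (y l)%:P) * \prod_l ('X - (y' l)%:P) \is monic.
    by rewrite monicMl.
  by rewrite /lead_coef sM.
by rewrite card_sum !card_ord; apply: size_subXn; rewrite ?sM // !lM.
Qed.

(** The coefficients of the identity operator in the product of the two
    Macdonald operators, in either order. *)
Definition Lf j := \prod_(l < n | l != j)
  ((z l - t * z j) * (q * z j - t * z l) / ((z l - z j) * (q * z j - z l))).
Definition Rf j := \prod_(l < n | l != j)
  ((z j - t * z l) * (q * z l - t * z j) / ((z j - z l) * (q * z l - z j))).

(** Interpolation at the 2n nodes z_j and z_j / q of the difference of
    prod_l (X - z_l / t) (X - t z_l / q) and prod_l (X - z_l) (X - z_l / q). Both
    products have the same value at 0, so the interpolation formula at 0 is a
    vanishing sum; its terms are, up to one common factor, the left summands and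
    minus the right ones. *)
Lemma sum_Lf_Rf : \sum_j Lf j = \sum_j Rf j.
Proof.
(* K * G is the factor by which the terms of the interpolation formula differ
   from the summands; G contains z_j^2 and one factor for each l != j *)
pose G := t * q * \prod_l (z l ^+ 2 / (t * q)).
pose K := (t - q) * (1 - t) / (t * q) / (q - 1).
have q1' : q - 1 != 0 by rewrite subr_eq0.
have q1'' : 1 - q != 0 by rewrite subr_eq0 eq_sym.
have GE j : G = z j ^+ 2 * \prod_(l < n | l != j) (z l ^+ 2 / (t * q)).
  by rewrite /G (bigD1 j) //= mulrA; congr (_ * _); field; rewrite q0 t0.
have tq0 : t * q != 0 by rewrite mulf_neq0.
have KG0 : K * G != 0.
  apply: mulf_neq0.
    by rewrite !mulf_neq0 ?invr_eq0 // subr_eq0 eq_sym.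
  apply: mulf_neq0 => //; apply/prodf_neq0 => l _.
  by rewrite mulf_neq0 ?invr_eq0 ?expf_neq0.
have Q'x s : Q'.[x s] = 0.
  rewrite /Q' hornerM !horner_prod; case: s => j /=.
    by rewrite (bigD1 j) //= hornerXsubC subrr !mul0r.
  by rewrite [X in _ * X](bigD1 j) //= hornerXsubC subrr mul0r mulr0.
have QE y : Q.[y] = \prod_l (y - z l / t) * \prod_l (y - t * z l / q).
  by rewrite /Q hornerM !horner_prod; congr (_ * _); apply: eq_bigr => l _; rewrite hornerXsubC.
have := lagrange_0 xi sQ.
have -> : (Q - Q').[0] = 0.
  have Q'E y : Q'.[y] = \prod_l (y - z l) * \prod_l (y - z l / q).
    by rewrite /Q' hornerM !horner_prod; congr (_ * _); apply: eq_bigr => l _; rewrite hornerXsubC.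
  rewrite hornerD hornerN QE Q'E -!big_split /=.
  apply/eqP; rewrite subr_eq0; apply/eqP; apply: eq_bigr => l _.
  by field; rewrite q0 t0.
rewrite big_sumType /= => e.
(* rearrangements that bring the factors for l = j together *)
have mix a b c (p1 p2 p3 p4 p5 : F) :
  a * p1 * (b * p2) * (p3 * (c * p4)) = (a * b * c) * (p1 * p2 * p3 * p4) by move=> *; ring.
have mix2 a b c (p1 p2 p3 p4 p5 : F) :
  a * p1 * (b * p2) * (c * p3 * p4) = (a * b * c) * (p1 * p2 * p3 * p4) by move=> *; ring.
have mix3 (k g p l : F) : k * (g * p) * l = k * g * (p * l) by move=> *; ring.
have zj j i : i != j -> z j - z i != 0 by move=> ij; rewrite subr_eq0 (inj_eq zi) eq_sym.
have zj2 j i : q * z j - z i != 0 by rewrite subr_eq0.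
have zq1 j : z j * q - z j != 0.
  by rewrite -{2}[z j]mulr1 -mulrBr mulf_neq0.
have zq2 j : z j + - z j * q != 0.
  by rewrite mulNr -{1}[z j]mulr1 -mulrBr mulf_neq0.
have zq3 j l : z j + - z l * q != 0.
  by rewrite mulNr -oppr_eq0 opprB mulrC zj2.
have T1 j : (Q - Q').[z j] * (\prod_(s | s != inl j) (- x s / (z j - x s))) = - (K * G * Lf j).
  have -> : (Q - Q').[z j] = Q.[z j] by rewrite hornerD hornerN (Q'x (inl j)) subr0.
  rewrite QE big_sumType /= (bigD1 j) //= [\prod_l (z j - t * z l / q)](bigD1 j) //=.
  rewrite [\prod_l (- (z l / q) / (z j - z l / q))](bigD1 j) //=.
  rewrite mix // -!big_split /= (GE j) mix3 /Lf -big_split -[RHS]mulNr /=; congr (_ * _).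
    by rewrite /K; field; rewrite q1' q0 t0 zq1.
  apply: eq_bigr => l lj; field.
  by rewrite q0 t0 zj2 (zj j l lj) -(opprB (z j)) oppr_eq0 (zj j l lj).
have T2 j : (Q - Q').[z j / q] * (\prod_(s | s != inr j) (- x s / (z j / q - x s))) = K * G * Rf j.
  have -> : (Q - Q').[z j / q] = Q.[z j / q] by rewrite hornerD hornerN (Q'x (inr j)) subr0.
  rewrite QE big_sumType /= (bigD1 j) //= [\prod_l (z j / q - t * z l / q)](bigD1 j) //=.
  rewrite [\prod_l (- z l / (z j / q - z l))](bigD1 j) //=.
  rewrite mix2 // -!big_split /= (GE j) mix3 /Rf -big_split /=; congr (_ * _).
    by rewrite /K; field; rewrite q1' q0 t0 zq2.
  apply: eq_bigr => l lj; field.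
  by rewrite q0 t0 zj // zj2 zq3.
move: e; rewrite (eq_bigr _ (fun j _ => T1 j)) (eq_bigr _ (fun j _ => T2 j)).
rewrite sumrN -!mulr_sumr => e; apply: (mulfI KG0).
by apply/eqP; rewrite eq_sym -subr_eq0 addrC -e.
Qed.

Lemma shiftK_pm j w : shift q^-1 j (shift q j w) =1 w :> ('I_n -> F).
Proof. by move=> l; rewrite /shift; case: eqP => _; rewrite ?mul1r ?mulKf. Qed.
Lemma shiftK_mp j w : shift q j (shift q^-1 j w) =1 w :> ('I_n -> F).
Proof. by move=> l; rewrite /shift; case: eqP => _; rewrite ?mul1r ?mulVKf. Qed.
Lemma shiftC j k w : shift q^-1 k (shift q j w) =1 shift q j (shift q^-1 k w) :> ('I_n -> F).
Proof. by move=> l; rewrite /shift mulrCA. Qed.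

(** The operators sum_j A_j^+ T_j and sum_j A_j^- T_j^-1 commute. The terms in
    which T_j and T_k^-1 act on different variables agree one by one; those
    with j = k compose to the identity, and their sums agree by [sum_Lf_Rf]. *)
Lemma macdonald_comm (f : ('I_n -> F) -> F) :
  (forall w w', w =1 w' -> f w = f w') ->
  \sum_j Ap t z j * (\sum_k Am t (shift q j z) k * f (shift q^-1 k (shift q j z))) =
  \sum_k Am t z k * (\sum_j Ap t (shift q^-1 k z) j * f (shift q j (shift q^-1 k z))).
Proof.
move=> fe.
have zj j i : i != j -> z j - z i != 0 by move=> ij; rewrite subr_eq0 (inj_eq zi) eq_sym.
have zj2 j i : q * z j - z i != 0 by rewrite subr_eq0.
under eq_bigr => j _ do rewrite mulr_sumr (bigD1 j) //=.
under [RHS]eq_bigr => j _ do rewrite mulr_sumr (bigD1 j) //=.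
rewrite !big_split /=; congr (_ + _).
  under eq_bigr => j _ do rewrite (fe _ _ (shiftK_pm j z)) mulrA.
  under [RHS]eq_bigr => j _ do rewrite (fe _ _ (shiftK_mp j z)) mulrA.
  rewrite -!mulr_suml; congr (_ * _).
  transitivity (\sum_j Lf j).
    apply: eq_bigr => j _; rewrite /Ap /Am -big_split; apply: eq_bigr => l lj /=.
    rewrite /shift eqxx (negPf lj) mul1r; field.
    by rewrite zj2 -(opprB (z j)) oppr_eq0 zj.
  rewrite sum_Lf_Rf; apply: eq_bigr => j _; rewrite /Ap /Am -big_split; apply: eq_bigr => l lj /=.
  rewrite /shift eqxx (negPf lj) mul1r; field.
  by rewrite q0 [z l * q]mulrC zj2 zj.
rewrite (exchange_big_dep xpredT) //=; apply: eq_bigr => k _.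
apply: eq_big => [j|j kj]; first by rewrite eq_sym.
rewrite (fe _ _ (shiftC j k z)) !mulrA; congr (_ * _).
have jk : j != k by rewrite eq_sym.
pose P1 := \prod_(l < n | (l != j) && (l != k)) ((z l - t * z j) / (z l - z j)).
pose P2 := \prod_(l < n | (l != k) && (l != j)) ((z k - t * z l) / (z k - z l)).
have -> : Ap t z j = (z k - t * z j) / (z k - z j) * P1 by rewrite /Ap (bigD1 k kj).
have -> : Am t z k = (z k - t * z j) / (z k - z j) * P2 by rewrite /Am (bigD1 j jk).
have -> : Am t (shift q j z) k = (z k - t * (q * z j)) / (z k - q * z j) * P2.
  rewrite /Am (bigD1 j jk) /=; congr (_ * _).
    by rewrite /shift eqxx (negPf kj) mul1r.
  by apply: eq_bigr => l /andP[_ /negPf lj]; rewrite /shift lj (negPf kj) !mul1r.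
have -> : Ap t (shift q^-1 k z) j = (q^-1 * z k - t * z j) / (q^-1 * z k - z j) * P1.
  rewrite /Ap (bigD1 k kj) /=; congr (_ * _).
    by rewrite /shift eqxx (negPf jk) mul1r.
  by apply: eq_bigr => l /andP[_ /negPf lj]; rewrite /shift lj (negPf jk) !mul1r.
by field; rewrite q0 zj // mulNr -oppr_eq0 opprB mulrC zj2.
Qed.
End Comm.

(** * The operator at the interpolation points *)

Section LatOp.
Variables (F : fieldType) (q t c : F) (n : nat).
Hypotheses (qt : qt_free q t) (c0 : c != 0).
Implicit Types (m k v : 'X_{1..n}) (i j : 'I_n).

Local Notation pt_ := (lat q t c).
Let q0 := qt_q0 qt.
Let t0 := qt_t0 qt.

Lemma shift_lat v j : shift q j (pt_ v) =1 pt_ (v + U_(j))%MM.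
Proof.
move=> l; rewrite /shift /lat mnmDE mnm1E eq_sym; case: eqP => _.
  by rewrite addn1 exprS; ring.
by rewrite addn0 mul1r.
Qed.

Lemma shiftV_lat v j : (0 < v j)%N -> shift q^-1 j (pt_ v) =1 pt_ (v - U_(j))%MM.
Proof.
move=> vj l; rewrite /shift /lat mnmBE mnm1E eq_sym; case: eqP => [<-|_]; last first.
  by rewrite subn0 mul1r.
rewrite -{1}(prednK vj) exprS -!mulrA mulrCA mulKf // subn1; ring.
Qed.

(** If a box cannot be added in row j, then rows j - 1 and j have equal length
    and the factor of A_j^+ for that pair vanishes. *)
Lemma Ap_lat0 v j : is_partition v -> ~~ is_partition (v + U_(j))%MM -> Ap t (pt_ v) j = 0.
Proof.
move=> /partP vp nvp.
have [l [lj e]] : exists l : 'I_n, nat_of_ord j = l.+1 /\ v l = v j.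
  case: (posnP j) => [j0|j0].
    case/negP: nvp; apply/partP => a b ab; rewrite !mnmDE !mnm1E.
    have := vp _ _ ab; case: eqP => [jb|_]; last by lia.
    have -> : a = b by apply: ord_inj; move: ab j0; rewrite -jb; lia.
    by rewrite jb eqxx; lia.
  have lt : (j.-1 < n)%N by rewrite (leq_ltn_trans (leq_pred _)).
  exists (Ordinal lt); split; first by rewrite /= prednK.
  apply/eqP; rewrite eqn_leq [X in _ && X]vp /= ?leq_pred // andbT leqNgt.
  apply/negP => h; case/negP: nvp; apply/partP => a b ab; rewrite !mnmDE !mnm1E.
  have := vp _ _ ab; case: (eqVneq j b) => [jb|_]; last by case: eqP; lia.
  case: (eqVneq j a) => [ja|ja]; first by lia.
  have al : (a <= Ordinal lt)%N.
    rewrite /= -ltnS prednK //; move: ab; rewrite -jb leq_eqVlt => /orP[/eqP e|//].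
    by case/eqP: ja; apply: ord_inj.
  by have := vp _ _ al; move: h; rewrite -jb /=; lia.
rewrite /Ap (bigD1 l) /=; last by rewrite -val_eqE /= lj neq_ltn ltnSn.
have -> : pt_ v l - t * pt_ v j = 0; last by rewrite !mul0r.
rewrite /lat e; have -> : rho l = (rho j).+1 by rewrite /rho lj; have := ltn_ord j; lia.
by rewrite exprS; ring.
Qed.

(** If no box can be removed from row j, then either rows j and j + 1 have equal
    length, or j is the last row and is empty; in the second case the point has
    z_j = c. *)
Lemma Am_lat0 v j : is_partition v -> ~~ ((0 < v j)%N && is_partition (v - U_(j))%MM) ->
  (1 - c / pt_ v j) * Am t (pt_ v) j = 0.
Proof.
move=> /partP vp nvp.
have [[jn vj]|[l [lj e]]] : (j.+1 = n /\ v j = 0%N) \/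
    exists l : 'I_n, nat_of_ord l = j.+1 /\ v l = v j.
  case: (eqVneq j.+1 n) => [jn|jn].
    case: (posnP (v j)) => [vj|vj]; first by left.
    case/negP: nvp; rewrite vj; apply/partP => a b ab; rewrite !mnmBE !mnm1E.
    have := vp _ _ ab; case: (eqVneq j a) => [ja|_]; last by case: eqP; lia.
    have -> : b = a by apply: ord_inj; have := ltn_ord b; move: ab; rewrite -ja; lia.
    by rewrite ja eqxx.
  right; have lt : (j.+1 < n)%N by rewrite ltn_neqAle jn ltn_ord.
  exists (Ordinal lt); split => //; apply/eqP; rewrite eqn_leq vp //=.
  case: (posnP (v j)) => [-> //|vj]; rewrite leqNgt; apply/negP => h.
  case/negP: nvp; rewrite vj; apply/partP => a b ab; rewrite !mnmBE !mnm1E.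
  have := vp _ _ ab; case: (eqVneq j a) => [ja|_]; last by case: eqP; lia.
  case: (eqVneq j b) => [jb|jb]; first by lia.
  have al : (Ordinal lt <= b)%N.
    rewrite /= ltn_neqAle ja ab andbT; apply: contraNneq jb => e.
    by apply/eqP/ord_inj; rewrite ja.
  by have := vp _ _ al; move: h; rewrite -ja /=; lia.
  rewrite /lat vj /rho jn subnn !expr0 !mulr1 divff // subrr mul0r //.
rewrite /Am (bigD1 l) /=; last by rewrite -val_eqE /= lj neq_ltn ltnSn orbT.
have -> : pt_ v j - t * pt_ v l = 0; last by rewrite !mul0r mulr0.
rewrite /lat e; have -> : rho j = (rho l).+1 by rewrite /rho lj; have := ltn_ord l; lia.
by rewrite exprS; ring.
Qed.

(** This makes the operator with coefficients 0 and 1 - c/u diagonal on the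
    interpolation polynomials. *)
Lemma sum_phi_star v : \sum_j (1 - c / pt_ v j) * Am t (pt_ v) j = - eigsum q t 0 1 v.
Proof.
have t1 := qt_t1 qt.
under eq_bigr => j _ do rewrite mulrBl mul1r -mulrA [_^-1 * _]mulrC.
rewrite big_split /= (sum_Am (lat_inj qt _) _ t1) //; last by move=> i; apply: lat_neq0.
rewrite sumrN -mulr_sumr (sum_Am_div (lat_inj qt _) _ t1) //; last by move=> i; apply: lat_neq0.
rewrite !mulr_sumr -sumrN -big_split /eigsum -sumrN; apply: eq_bigr => j _ /=.
have -> : t ^+ j = t ^+ n.-1 / t ^+ rho j.
  have -> : n.-1 = (j + rho j)%N by rewrite /rho; have := ltn_ord j; lia.
  by rewrite exprD mulfK // expf_neq0.
rewrite /lat; field.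
by rewrite c0 !expf_neq0.
Qed.
End LatOp.

(** * The operators on interpolation polynomials *)

Lemma qop_eq (F : fieldType) n (q t : F) (al be al' be' : F -> F) (p : {mpoly F[n]}) z :
  (forall j, al (z j) = al' (z j)) -> (forall j, be (z j) = be' (z j)) ->
  qop q t al be p z = qop q t al' be' p z.
Proof. by move=> ea eb; apply: eq_bigr => j _; rewrite ea eb. Qed.

Lemma qop_ext (F : fieldType) n (q t : F) (al be : F -> F) (p : {mpoly F[n]}) z z' :
  z =1 z' -> qop q t al be p z = qop q t al be p z'.
Proof.
move=> e; apply: eq_bigr => j _; rewrite e (meval_eq p e).
have es u : shift u j z =1 shift u j z' by move=> l; rewrite /shift e.
rewrite !(meval_eq p (es _)).
have -> : Ap t z j = Ap t z' j by apply: eq_bigr => l _; rewrite !e.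
by have -> : Am t z j = Am t z' j by apply: eq_bigr => l _; rewrite !e.
Qed.

Section QopLin.
Variables (F : fieldType) (n : nat) (q t : F).
Implicit Types (p r : {mpoly F[n]}) (al be : F -> F).
Lemma qopB al be p r z : qop q t al be (p - r) z = qop q t al be p z - qop q t al be r z.
Proof. by rewrite /qop -sumrB; apply: eq_bigr => j _; rewrite !mevalB; ring. Qed.
Lemma qopD al be p r z : qop q t al be (p + r) z = qop q t al be p z + qop q t al be r z.
Proof. by rewrite /qop -big_split; apply: eq_bigr => j _ /=; rewrite !mevalD; ring. Qed.
Lemma qopZ al be x p z : qop q t al be (x *: p) z = x * qop q t al be p z.
Proof. by rewrite /qop mulr_sumr; apply: eq_bigr => j _; rewrite !mevalZ; ring. Qed.
Lemma qop_sum al be (I : Type) (s : seq I) (P : pred I) (f : I -> {mpoly F[n]}) z :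
  qop q t al be (\sum_(i <- s | P i) f i) z = \sum_(i <- s | P i) qop q t al be (f i) z.
Proof.
elim/big_rec2: _ => [|i y p _ <-]; last exact: qopD.
by rewrite /qop big1 // => j _; rewrite !meval0 subrr !mulr0 addr0.
Qed.
End QopLin.

Definition interp (F : fieldType) (q t c : F) n (m : 'X_{1..n}) (R : {mpoly F[n]}) :=
  [/\ R \is symmetric, (msize R <= (mdeg m).+1)%N &
    forall k, is_partition k -> (mdeg k <= mdeg m)%N -> R.@[lat q t c k] = (k == m)%:R].

Section Interp.
Variables (F : fieldType) (q t c : F) (n : nat).
Hypotheses (two0 : (2%:R : F) != 0) (qt : qt_free q t) (c0 : c != 0).
Hypothesis e_inj : forall m k : 'X_{1..n}, is_partition m -> is_partition k ->
  eigsum q t 0 1 m = eigsum q t 0 1 k -> m = k.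
Implicit Types (m k v : 'X_{1..n}) (i j : 'I_n) (p r : {mpoly F[n]}).

Local Notation pt_ := (lat q t c).
Local Notation qop_repr := (@qop_repr F n q t).
Let q0 := qt_q0 qt.
Let t0 := qt_t0 qt.

(** The form in which [lat_uniq] is used. *)
Lemma lat_eq (k : nat) p r : p \is symmetric -> r \is symmetric ->
  (msize p <= k.+1)%N -> (msize r <= k.+1)%N ->
  (forall v, is_partition v -> (mdeg v <= k)%N -> p.@[pt_ v] = r.@[pt_ v]) -> p = r.
Proof.
move=> ps rs pk rk e; apply/eqP; rewrite -subr_eq0; apply/eqP.
apply: (lat_uniq qt c0 (rpredB ps rs) (msizeB_sup pk rk)) => v vp vk.
by rewrite mevalB e // subrr.
Qed.

Lemma part_mlead p : p \is symmetric -> is_partition (mlead p).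
Proof. by move=> ps; apply/partP; apply: mlead_msym_sorted. Qed.

Lemma msize_poly_op (al be : F * F * F) p g (d : nat) : (msize p <= d.+1)%N ->
  (forall k, (mlead p <= k)%O -> (mlead g <= k)%O /\ g@_k = eigsum q t al.1.1 be.1.1 k * p@_k) ->
  (msize g <= d.+1)%N.
Proof.
move=> pk h; have [gl ge] := h _ (lexx _).
have [p0|p0] := eqVneq p 0.
  move: gl; rewrite p0 mlead0 => gl.
  by apply: (@msize_mleadW _ _ _ 0%MM) gl _; rewrite mdeg0.
by apply: msize_mleadW gl _; rewrite -ltnS mlead_deg.
Qed.

Lemma qop_repr_ex (al be : F * F * F) p : al.2 = t ^+ n.-1 * q^-1 * be.2 -> p \is symmetric ->
  exists g, qop_repr al be p g.
Proof.
by move=> e ps; exact: (qop_polynomial two0 q0 t0 e ps).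
Qed.

Lemma qop_repr_lat (al be : F * F * F) p g : qop_repr al be p g ->
  forall v, g.@[pt_ v] = qop q t (laurent al) (laurent be) p (pt_ v).
Proof.
move=> [_ ge _ _] v; apply: ge; first exact: lat_inj.
by move=> i; apply: lat_neq0.
Qed.

Let sumA z : injective z -> (forall i : 'I_n, z i != 0) ->
  \sum_j Ap t z j = \sum_j Am t z j.
Proof.
move=> zi z0; have t1 := qt_t1 qt.
by rewrite sum_Ap ?sum_Am.
Qed.

Lemma qop_plus p z : qop q t (laurent (1, 0, 0)) (laurent (0, 0, 0)) p z =
  \sum_j Ap t z j * p.@[shift q j z] - (\sum_j Ap t z j) * p.@[z].
Proof.
rewrite /qop mulr_suml -sumrB; apply: eq_bigr => j _; rewrite /laurent /=.
by rewrite !mul0r !addr0; ring.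
Qed.
Lemma qop_minus p z : qop q t (laurent (0, 0, 0)) (laurent (1, 0, 0)) p z =
  \sum_j Am t z j * p.@[shift q^-1 j z] - (\sum_j Am t z j) * p.@[z].
Proof.
rewrite /qop mulr_suml -sumrB; apply: eq_bigr => j _; rewrite /laurent /=.
by rewrite !mul0r !addr0; ring.
Qed.

Lemma shift_inj u j (z : 'I_n -> F) : u != 0 -> injective z ->
  (forall i, i != j -> u * z j != z i) -> injective (shift u j z).
Proof.
move=> u0 zi h a b; rewrite /shift; case: (eqVneq a j) => [->|aj]; case: (eqVneq b j) => [->|bj] //.
- by rewrite mul1r => e; have := h _ bj; rewrite e eqxx.
- by rewrite mul1r => e; have := h _ aj; rewrite e eqxx.
- by rewrite !mul1r => /zi.
Qed.

Lemma lat_q v i j : i != j -> q * pt_ v i != pt_ v j.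
Proof.
move=> ij; apply/eqP => e; have := @qt (v i).+1 (rho i) (v j) (rho j).
case=> [|_]; last by move/eqP: ij => ij e'; apply: ij; apply: ord_inj; move: e';
  rewrite /rho; have := ltn_ord i; have := ltn_ord j; lia.
by apply: (mulfI c0); rewrite !mulrA -[RHS]e /lat exprS; ring.
Qed.

(** The operators of [macdonald_comm] are those of [qop_plus] and [qop_minus]
    up to an additive constant, the same for both by [sum_Ap] and [sum_Am]. *)
Lemma qop_comm p gA gB v : qop_repr (1, 0, 0) (0, 0, 0) p gA -> qop_repr (0, 0, 0) (1, 0, 0) p gB ->
  qop q t (laurent (0, 0, 0)) (laurent (1, 0, 0)) gA (pt_ v) =
  qop q t (laurent (1, 0, 0)) (laurent (0, 0, 0)) gB (pt_ v).
Proof.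
move=> oA oB; have [_ eA _ _] := oA; have [_ eB _ _] := oB.
have z0 i : pt_ v i != 0 by apply: lat_neq0.
have zi := lat_inj qt c0 : injective (pt_ v).
have s0 u j i : u != 0 -> shift u j (pt_ v) i != 0.
  by move=> u0; rewrite /shift; case: (i == j); rewrite mulf_neq0 ?oner_eq0.
have si j : injective (shift q j (pt_ v)).
  by apply: shift_inj => // i ij; rewrite lat_q // eq_sym.
have siV j : injective (shift q^-1 j (pt_ v)).
  apply: shift_inj; rewrite ?invr_eq0 // => i ij.
  apply/eqP => e; have := lat_q v ij; rewrite -e mulVKf ?eqxx //.
have q1 := qt_q1 qt; have t1 := qt_t1 qt.
have qt1 : q != t.
  by apply/eqP => e; have [] := @qt 1 0 0 1; rewrite ?e ?expr1 ?expr0 ?mulr1 ?mul1r.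
rewrite qop_minus qop_plus !(qop_repr_lat oA) !(qop_repr_lat oB) qop_plus qop_minus sumA //.
have sA z : injective z -> (forall i, z i != 0) -> \sum_j Ap t z j = \sum_(j < n) t ^+ j.
  by move=> wi w0; rewrite sum_Ap.
have sB z : injective z -> (forall i, z i != 0) -> \sum_j Am t z j = \sum_(j < n) t ^+ j.
  by move=> wi w0; rewrite sum_Am.
set S := \sum_(j < n) t ^+ j in sA sB.
rewrite sB //; set v1 := pt_ v in zi z0 s0 si siV *.
have -> : \sum_j Am t v1 j * gA.@[shift q^-1 j v1] =
   \sum_k Am t v1 k * (\sum_j Ap t (shift q^-1 k v1) j * p.@[shift q j (shift q^-1 k v1)])
   - S * \sum_k Am t v1 k * p.@[shift q^-1 k v1].
  rewrite mulr_sumr -sumrB; apply: eq_bigr => k _.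
  rewrite eA // => [|i]; last by rewrite s0 ?invr_eq0.
  by rewrite qop_plus sA // => [|i]; [ring | rewrite s0 ?invr_eq0].
have -> : \sum_j Ap t v1 j * gB.@[shift q j v1] =
   \sum_j Ap t v1 j * (\sum_k Am t (shift q j v1) k * p.@[shift q^-1 k (shift q j v1)])
   - S * \sum_j Ap t v1 j * p.@[shift q j v1].
  rewrite mulr_sumr -sumrB; apply: eq_bigr => k _.
  rewrite eB // => [|i]; last by rewrite s0.
  by rewrite qop_minus sB // => [|i]; [ring | rewrite s0].
rewrite (@macdonald_comm _ _ _ _ _ q0 t0 t1 q1 qt1 z0 zi _ (fun z => p.@[z])) //.
- by ring.
- by move=> i j ij; apply: lat_q.
- by move=> w w'; apply: meval_eq.
Qed.

Section OneInterp.
Variables (m : 'X_{1..n}) (R : {mpoly F[n]}).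
Hypotheses (mp : is_partition m) (iR : interp q t c m R).
Let em := eigsum q t 0 1 m.
Let Rs : R \is symmetric. Proof. by case: iR. Qed.
Let Rk : (msize R <= (mdeg m).+1)%N. Proof. by case: iR. Qed.
Let Rv k : is_partition k -> (mdeg k <= mdeg m)%N -> R.@[pt_ k] = (k == m)%:R.
Proof. by case: iR => _ _; apply. Qed.

Lemma interp_neq0 : R != 0.
Proof.
apply/eqP => R0; have := Rv mp (leqnn _); rewrite R0 meval0 eqxx => /eqP.
by rewrite eq_sym oner_eq0.
Qed.

(** At the points below degree |m| the polynomial R vanishes; of its neighbours
    only those that are one box below m contribute. The factor 1 - c/u, common
    to the coefficients of the inverse shifts considered, is needed to stay
    within partitions. *)
Lemma interp_down al be v : is_partition v -> (mdeg v < mdeg m)%N ->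
  qop q t al (fun u => (1 - c / u) * be u) R (pt_ v) =
  \sum_j (v + U_(j) == m)%MM%:R * (al (pt_ v j) * Ap t (pt_ v) j).
Proof.
move=> vp vm; have Rv0 : R.@[pt_ v] = 0.
  by rewrite Rv ?(ltnW vm) //; case: eqP vm => // ->; rewrite ltnn.
apply: eq_bigr => j _; rewrite Rv0 !subr0.
have -> : (1 - c / pt_ v j) * be (pt_ v j) * Am t (pt_ v) j * R.@[shift q^-1 j (pt_ v)] = 0.
  rewrite -[X in X * _]mulrA (mulrC (be _)) mulrA -mulrA.
  case: (boolP ((0 < v j)%N && is_partition (v - U_(j))%MM)) => [/andP[vj vjp]|h].
    rewrite (meval_eq R (shiftV_lat c qt vj)) Rv //; last exact: leq_trans (mdegB _ _) (ltnW vm).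
    case: eqP => [e|_]; last by rewrite !mulr0.
    by have := leq_ltn_trans (mdegB v U_(j)) vm; rewrite e ltnn.
  by rewrite Am_lat0 ?mul0r.
rewrite addr0; case: (boolP (is_partition (v + U_(j))%MM)) => h.
  rewrite (meval_eq R (shift_lat q t c v j)) Rv // ?mdegD ?mdeg1 ?addn1 //.
  by rewrite mulrC.
by rewrite Ap_lat0 // !(mulr0, mul0r).
Qed.

(** Removing a box from a partition of size at most |m| never gives m, so at the
    points in question only the diagonal terms survive. *)
Lemma interp_star g : qop_repr (0, 0, 0) (1, - c, 0) R g -> g = em *: R.
Proof.
move=> go; have [gs _ gl _] := go.
have gE v : g.@[pt_ v] = qop q t (fun=> 0) (fun u => 1 - c / u) R (pt_ v).
  rewrite (qop_repr_lat go); apply: qop_eq => j; rewrite /laurent /=; [by rewrite !mul0r !addr0|].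
  by rewrite mulNr mul0r addr0.
apply: (@lat_eq (mdeg m)) => //; first by rewrite rpredZ.
- exact: msize_poly_op gl.
- exact: msizeZ_sup.
move=> v vp vm; rewrite gE mevalZ Rv //.
have -> : em * (v == m)%:R = - (R.@[pt_ v]) * (- eigsum q t 0 1 v).
  by rewrite Rv // mulrNN; case: eqP => [->|_]; rewrite ?mul1r ?mulr1 ?mulr0 ?mul0r.
rewrite -(sum_phi_star qt c0) mulr_sumr; apply: eq_bigr => j _.
rewrite !mul0r add0r; case: (boolP ((0 < v j)%N && is_partition (v - U_(j))%MM)) => h.
  have [vj vjp] := andP h.
  have dv : (mdeg (v - U_(j))%MM < mdeg v)%N.
    rewrite -[X in (_ < mdeg X)%N](@submK _ U_(j) v) ?mdegD ?mdeg1 ?addn1 //.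
    by rewrite lep1mP -lt0n.
  rewrite (meval_eq R (shiftV_lat c qt vj)) (Rv vjp) ?(ltnW (leq_trans dv vm)) //.
  case: eqP => [e|_]; last by rewrite sub0r mulrC.
  by have := leq_trans dv vm; rewrite e ltnn.
by rewrite Am_lat0 // mulr0 mul0r.
Qed.

(** By [interp_star] the polynomial R is an eigenfunction of a triangular
    operator with eigenvalue that of m, and these eigenvalues separate the
    partitions. *)
Lemma interp_lead : mlead R = m.
Proof.
have [|g go] := @qop_repr_ex (0, 0, 0) (1, - c, 0) R _ Rs; first by rewrite /= mulr0.
have gE := interp_star go; have [_ _ gl _] := go.
have [_] := gl _ (lexx _); rewrite gE mcoeffZ => /mulIf e.
apply: e_inj => //; first exact: part_mlead.
by rewrite -e // mleadc_eq0 interp_neq0.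
Qed.

(** The operator differs from the one of [interp_star] by one that lowers the
    degree. *)
Lemma interp_minus g : qop_repr (0, 0, 0) (1, 0, 0) R g -> (msize (g - em *: R)%R <= mdeg m)%N.
Proof.
move=> go; have [gs _ gl _] := go.
have [|g1 go1] := @qop_repr_ex (0, 0, 0) (1, - c, 0) R _ Rs; first by rewrite /= mulr0.
have [|g2 go2] := @qop_repr_ex (0, 0, 0) (0, c, 0) R _ Rs; first by rewrite /= mulr0.
have [g2s _ g2l g2d] := go2.
have -> : g - em *: R = g2; last exact: g2d.
rewrite -(interp_star go1); have [g1s _ g1l _] := go1.
apply: (@lat_eq (mdeg m)) => //; first exact: rpredB.
- by apply: msizeB_sup; [apply: msize_poly_op gl | apply: msize_poly_op g1l].
- exact: msize_poly_op g2l.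
move=> v _ _; rewrite mevalB (qop_repr_lat go) (qop_repr_lat go1) (qop_repr_lat go2).
  rewrite /qop -sumrB; apply: eq_bigr => j _.
by rewrite /laurent /=; ring.
Qed.

Let ep := eigsum q t 1 0 m.

(** The image w of R under the first operator, minus its expected multiple, is
    by commutation an eigenfunction of the second operator with the eigenvalue
    of m, up to the contribution of terms of lower degree. If w had degree |m|,
    its leading exponent would then be m; but the coefficient of w there is 0 by
    [interp_lead]. *)
Lemma interp_plus g : qop_repr (1, 0, 0) (0, 0, 0) R g -> (msize (g - ep *: R)%R <= mdeg m)%N.
Proof.
move=> oA; have [As _ Al _] := oA.
have [|B oB] := @qop_repr_ex (0, 0, 0) (1, 0, 0) R _ Rs; first by rewrite /= mulr0.
have [Bs _ Bl _] := oB; have Br := interp_minus oB.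
set r := B - em *: R in Br; have rs : r \is symmetric by rewrite rpredB // rpredZ.
set w := g - ep *: R; have ws : w \is symmetric by rewrite rpredB // rpredZ.
have [|C oC] := @qop_repr_ex (0, 0, 0) (1, 0, 0) w _ ws; first by rewrite /= mulr0.
have [|D oD] := @qop_repr_ex (1, 0, 0) (0, 0, 0) r _ rs; first by rewrite /= mulr0.
have [Cs _ Cl _] := oC; have [Ds _ Dl _] := oD.
have gk := msize_poly_op Rk Al; have wk : (msize w <= (mdeg m).+1)%N.
  by apply: msizeB_sup => //; apply: msizeZ_sup.
have Ck := msize_poly_op wk Cl.
have rk : (msize r <= (mdeg m).+1)%N by apply: leq_trans Br _.
have Dk := msize_poly_op rk Dl.
have CE : C = em *: w + (D - ep *: r).
  apply: (@lat_eq (mdeg m)) => //.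
  - by rewrite rpredD ?rpredB ?rpredZ.
  - by apply: msizeD_sup; [|apply: msizeB_sup => //]; apply: msizeZ_sup.
  move=> v _ _; rewrite (qop_repr_lat oC) qopB qopZ (qop_comm _ oA oB) -(qop_repr_lat oB).
  rewrite mevalD mevalB !mevalZ (qop_repr_lat oD) qopB qopZ -(qop_repr_lat oA).
  rewrite /r /w !mevalB !mevalZ; ring.
rewrite leqNgt; apply/negP => wm.
have w0 : w != 0 by apply: contraTneq wm => ->; rewrite msize0.
have kd : mdeg (mlead w) = mdeg m.
  by apply/eqP; rewrite -eqSS mlead_deg // eqn_leq wk.
have lc0 p : (msize p <= mdeg m)%N -> p@_(mlead w) = 0.
  by move=> h; apply: mcoeff_msize0; rewrite kd.
have rl : (mlead r <= mlead w)%O.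
  have [->|r0] := eqVneq r 0; first by rewrite mlead0 le0m.
  by apply/ltW/lt_mdeg_ltmc; rewrite kd mlead_deg.
have [_] := Cl _ (lexx _); rewrite CE mcoeffD mcoeffZ mcoeffB mcoeffZ (lc0 r) // mulr0 subr0.
have [_ ->] := Dl _ rl; rewrite (lc0 r) // mulr0 addr0 => /mulIf e.
have wm' : mlead w = m.
  apply: e_inj => //; first exact: part_mlead.
  by rewrite -e // mleadc_eq0.
have : w@_(mlead w) != 0 by rewrite mleadc_eq0.
have Rm : (mlead R <= m)%O by rewrite interp_lead lexx.
by have [_ gm] := Al m Rm; rewrite wm' mcoeffB mcoeffZ gm subrr eqxx.
Qed.

End OneInterp.
End Interp.

(** The coefficients of D_B, as functions and ([alT], [beT]) as triples of
    coefficients of powers of 1/u. *)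
Definition alB (F : fieldType) n (q t a b c d u : F) : F :=
  q * t ^+ n.-1 * (a - c / (q * u)) * (b + d / (q * u)).
Definition beB (F : fieldType) (c d u : F) : F := (1 - c / u) * (1 + d / u).
Definition alT (F : fieldType) n (q t a b c d : F) : F * F * F :=
  (q * (a * b) * t ^+ n.-1, t ^+ n.-1 * (a * d - b * c), - (c * d * t ^+ n.-1 / q)).
Definition beT (F : fieldType) (c d : F) : F * F * F := (1, d - c, - (c * d)).

Lemma lau_alT (F : fieldType) n (q t a b c d u : F) : q != 0 -> u != 0 ->
  laurent (alT n q t a b c d) u = alB n q t a b c d u.
Proof. by move=> q0 u0; rewrite /laurent /alT /alB /=; field; rewrite q0 u0. Qed.
Lemma lau_beT (F : fieldType) (c d u : F) : u != 0 -> laurent (beT c d) u = beB c d u.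
Proof. by move=> u0; rewrite /laurent /beT /beB /=; field. Qed.

Section DB.
Variables (F : fieldType) (q t c : F) (n : nat).
Hypotheses (two0 : (2%:R : F) != 0) (qt : qt_free q t) (c0 : c != 0).
Hypothesis e_inj : forall m k : 'X_{1..n}, is_partition m -> is_partition k ->
  eigsum q t 0 1 m = eigsum q t 0 1 k -> m = k.
Implicit Types (m k v : 'X_{1..n}) (i j : 'I_n) (p r : {mpoly F[n]}).

Local Notation pt_ := (lat q t c).
Local Notation qop_repr := (@qop_repr F n q t).
Let q0 := qt_q0 qt.
Let t0 := qt_t0 qt.

Section Coefficients.
Variables (a b d : F).
Local Notation al := (alT n q t a b c d).
Local Notation be := (beT c d).
Definition eigsumB m := eigsum q t (q * (a * b) * t ^+ n.-1) 1 m.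

(** The relation that makes the operator act on polynomials. *)
Lemma alT_beT_cond : al.2 = t ^+ n.-1 * q^-1 * be.2.
Proof. by rewrite /alT /beT /=; ring. Qed.

(** The operator D_B is a combination of the two Macdonald operators and of an
    operator that lowers the degree. *)
Lemma DB_low m R g : is_partition m -> interp q t c m R -> qop_repr al be R g ->
  (msize (g - eigsumB m *: R)%R <= mdeg m)%N.
Proof.
move=> mp iR og; have [Rs Rk _] := iR.
have [|A oA] := @qop_repr_ex F q t n two0 qt (1, 0, 0) (0, 0, 0) R _ Rs; first by rewrite /= mulr0.
have [|B oB] := @qop_repr_ex F q t n two0 qt (0, 0, 0) (1, 0, 0) R _ Rs; first by rewrite /= mulr0.
have [|D oD] := @qop_repr_ex F q t n two0 qt (0, al.1.2, al.2) (0, be.1.2, be.2) R _ Rs.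
  exact: alT_beT_cond.
have [As _ Al _] := oA; have [Bs _ Bl _] := oB; have [Ds _ Dl Dd] := oD.
have [gs _ gl _] := og.
have gE : g = (q * (a * b) * t ^+ n.-1) *: A + B + D.
  apply: (@lat_eq F q t c n qt c0 (mdeg m)) => //.
  - by rewrite !rpredD ?rpredZ.
  - exact: msize_poly_op Rk gl.
  - apply: msizeD_sup; last exact: msize_poly_op Rk Dl.
    apply: msizeD_sup; last exact: msize_poly_op Rk Bl.
    by apply: msizeZ_sup; apply: msize_poly_op Rk Al.
  move=> v _ _; rewrite !mevalD mevalZ
    !(qop_repr_lat qt c0 oA, qop_repr_lat qt c0 oB, qop_repr_lat qt c0 oD, qop_repr_lat qt c0 og).
  rewrite /qop mulr_sumr -!big_split; apply: eq_bigr => j _ /=; rewrite /laurent /=.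
  by rewrite !mul0r !addr0; ring.
have -> : g - eigsumB m *: R = (q * (a * b) * t ^+ n.-1) *: (A - eigsum q t 1 0 m *: R)
   + (B - eigsum q t 0 1 m *: R) + D.
  have -> : eigsumB m = (q * (a * b) * t ^+ n.-1) * eigsum q t 1 0 m + eigsum q t 0 1 m.
    rewrite /eigsumB /eigsum mulr_sumr -big_split; apply: eq_bigr => j _ /=; ring.
  by rewrite gE scalerBr scalerA scalerDl opprD [LHS]addrAC [X in X + D = _]addrACA.
apply: msizeD_sup; last exact: Dd.
apply: msizeD_sup; last by exact: (interp_minus two0 qt c0 iR oB).
by apply: msizeZ_sup; apply: (interp_plus two0 qt c0 e_inj mp iR oA).
Qed.

Variables (K : nat) (Rf : 'X_{1..n} -> {mpoly F[n]}).
Hypothesis hR : forall k, is_partition k -> (mdeg k < K)%N -> interp q t c k (Rf k).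

Definition phi k i := alB n q t a b c d (pt_ k i) * Ap t (pt_ k) i.
Definition DB_at p v := qop q t (alB n q t a b c d) (beB c d) p (pt_ v).

Lemma DB_at_repr p g v : qop_repr al be p g -> g.@[pt_ v] = DB_at p v.
Proof.
move=> og; rewrite (qop_repr_lat qt c0 og); apply: qop_eq => j.
  by rewrite lau_alT // lat_neq0.
by rewrite lau_beT // lat_neq0.
Qed.

(** Both D_B R_m - E_m R_m and the sum on the right have degree less than |m|
    and the same values, by [interp_down], at the points of degree less than
    |m|. The sum runs over all partitions of size below a bound K instead of the
    m - e_i, because the latter need not be partitions. *)
Lemma DB_lat m v : is_partition m -> (mdeg m < K)%N -> is_partition v ->
  DB_at (Rf m) v = eigsumB m * (Rf m).@[pt_ v] +
    \sum_(k : 'X_{1..n < K} | is_partition k)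
      \sum_i (k + U_(i) == m)%MM%:R * phi k i * (Rf k).@[pt_ v].
Proof.
move=> mp mK vp; have iR := hR mp mK; have [Rs Rk Rv] := iR.
have [g og] := qop_repr_ex two0 qt alT_beT_cond Rs; have [gs _ gl _] := og.
have low := DB_low mp iR og.
set T := \sum_(k : 'X_{1..n < K} | is_partition k)
  \sum_i ((k + U_(i) == m)%MM%:R * phi k i) *: Rf k.
have TE w : T.@[pt_ w] = \sum_(k : 'X_{1..n < K} | is_partition k)
      \sum_i (k + U_(i) == m)%MM%:R * phi k i * (Rf k).@[pt_ w].
  rewrite raddf_sum; apply: eq_bigr => k _; rewrite raddf_sum; apply: eq_bigr => i _.
  by rewrite /= mevalZ.
rewrite -TE -(DB_at_repr v og) -mevalZ -mevalD; congr meval.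
apply/eqP; rewrite addrC -subr_eq; apply/eqP.
set h := g - eigsumB m *: Rf m in low *.
have hs : h \is symmetric by rewrite rpredB // rpredZ.
have Ts : T \is symmetric.
  apply: rpred_sum => k kp; apply: rpred_sum => i _; rewrite rpredZ //.
  by have [] := hR kp (bmdeg k).
have Tk : (msize T <= mdeg m)%N.
  apply: leq_trans (msize_sum _ _ _) _; apply/bigmax_leqP => k kp.
  apply: leq_trans (msize_sum _ _ _) _; apply/bigmax_leqP => i _.
  case: eqP => [e|_]; last by rewrite mul0r scale0r msize0.
  apply: msizeZ_sup; have [_ h1 _] := hR kp (bmdeg k).
  by apply: leq_trans h1 _; rewrite -e mdegD mdeg1 addn1.
case: (posnP (mdeg m)) => [m0|m0].
  have z p : (msize p <= mdeg m)%N -> p = 0.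
    by rewrite m0 leqn0 msize_poly_eq0 => /eqP.
  by rewrite (z _ low) (z _ Tk).
apply: (@lat_eq F q t c n qt c0 (mdeg m).-1) => //; rewrite ?prednK //.
move=> w wp wm; have wm' : (mdeg w < mdeg m)%N by rewrite -(prednK m0) ltnS.
have wK : (mdeg w < K)%N := ltn_trans wm' mK.
rewrite mevalB mevalZ (DB_at_repr w og) Rv // ?(ltnW wm') //.
have -> : (w == m) = false by apply: contraTF wm' => /eqP ->; rewrite ltnn.
rewrite mulr0 subr0 TE /DB_at.
have -> := @interp_down F q t c n qt c0 m (Rf m) iR (alB n q t a b c d) (fun u => 1 + d / u) w wp wm'.
rewrite (bigD1 (BMultinom wK)) //= [X in _ + X]big1 ?addr0 => [|k /andP[kp kw]].
  have [_ _ ww] := hR wp wK; rewrite ww // eqxx.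
  by apply: eq_bigr => i _; rewrite mulr1.
rewrite big1 // => i _; case: eqP => [e|_]; last by rewrite !mul0r.
have [_ _ kk] := hR kp (bmdeg k); rewrite kk //.
  case: eqP => [e'|_]; last by rewrite mulr0.
  by case/eqP: kw; apply/eqP; rewrite bmeqP /= e'.
by rewrite -ltnS (leq_trans wm') // -e mdegD mdeg1 addn1.
Qed.
End Coefficients.
End DB.

(** * Eigenfunctions as sums over paths of partitions *)

Section PathSum.
Variables (F : fieldType) (q t c s : F) (n : nat).
Hypotheses (two0 : (2%:R : F) != 0) (qt : qt_free q t) (c0 : c != 0).
Hypothesis e_inj : forall m k : 'X_{1..n}, is_partition m -> is_partition k ->
  eigsum q t 0 1 m = eigsum q t 0 1 k -> m = k.
Local Notation Es := (eigsum q t (q * s * t ^+ n.-1) 1).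
Hypothesis E_inj : forall m k : 'X_{1..n}, is_partition m -> is_partition k ->
  Es m = Es k -> m = k.
Implicit Types (m k v : 'X_{1..n}) (i j : 'I_n) (p r f : {mpoly F[n]}).

Local Notation pt_ := (lat q t c).
Let q0 := qt_q0 qt.
Let t0 := qt_t0 qt.

(** An eigenfunction of D_B of degree at most |m|, normalized at the exponent m,
    with the eigenvalue equation required at the points c q^v t^rho only. The
    eigenvalue depends on a and b through s = a b. *)
Definition eigenfun a b d m f := [/\ f \is symmetric, (msize f <= (mdeg m).+1)%N, f@_m = 1
  & forall v, is_partition v -> DB_at q t c a b d f v = Es m * f.@[pt_ v]].

(** The contribution of the box of column k (counted from 0) of row i. *)
Definition box a b d i (k : nat) := alB n q t a b c d (c * q ^+ k * t ^+ rho i).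

Variable lam : 'X_{1..n}.
Hypothesis lamP : is_partition lam.

(** The sum over the ways of reaching [lam] from k by adding d boxes of the
    products of A_i^+ / (E_lam - E_k) over the steps; independent of a, b, d
    for given s = a b. *)
Fixpoint path_sum_steps (d : nat) k : F :=
  if d is d'.+1 then (\sum_i Ap t (pt_ k) i * path_sum_steps d' (k + U_(i))%MM) / (Es lam - Es k)
  else (k == lam)%:R.
Definition path_sum k := path_sum_steps (mdeg lam - mdeg k) k.

Lemma path_sum_rec k : is_partition k -> (mdeg k < mdeg lam)%N ->
  (Es lam - Es k) * path_sum k = \sum_i Ap t (pt_ k) i * path_sum (k + U_(i))%MM.
Proof.
move=> kp kl; have E0 : Es lam - Es k != 0.
  rewrite subr_eq0; apply: contraTneq kl => /E_inj -> //.
  by rewrite ltnn.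
rewrite /path_sum; case e : (mdeg lam - mdeg k)%N => [|d]; first by lia.
rewrite /= mulrC divfK //; apply: eq_bigr => i _.
by rewrite mdegD mdeg1 addn1 subnS e.
Qed.

Lemma path_sum_supp k i : (lam i < k i)%N -> path_sum k = 0.
Proof.
rewrite /path_sum; move: (mdeg lam - mdeg k)%N => d; elim: d k => [|d IH] k h /=.
  by case: eqP h => // ->; rewrite ltnn.
rewrite big1 ?mul0r // => j _; rewrite IH ?mulr0 //.
by rewrite mnmDE (leq_trans h) // leq_addr.
Qed.

Lemma path_sum_top k : mdeg k = mdeg lam -> path_sum k = (k == lam)%:R.
Proof. by move=> e; rewrite /path_sum e subnn. Qed.

Definition skew_boxes a b d k := \prod_i \prod_(k i <= l < lam i) box a b d i l.

Lemma skew_boxes_rec a b d k i : (k i < lam i)%N ->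
  box a b d i (k i) * skew_boxes a b d (k + U_(i))%MM = skew_boxes a b d k.
Proof.
move=> ki; rewrite /skew_boxes (bigD1 i) //= [RHS](bigD1 i) //= mulrA; congr (_ * _).
  by rewrite mnmDE mnm1E eqxx addn1 [RHS]big_ltn.
by apply: eq_bigr => j ji; rewrite mnmDE mnm1E eq_sym (negPf ji) addn0.
Qed.

(** The factor of phi_i^+ depending on a, b, d is the contribution of the added
    box, so that it can be absorbed into the product over the skew diagram. *)
Lemma coef_rec a b d k : is_partition k -> (mdeg k < mdeg lam)%N ->
  (Es lam - Es k) * (skew_boxes a b d k * path_sum k) =
  \sum_i phi q t c a b d k i * (skew_boxes a b d (k + U_(i))%MM * path_sum (k + U_(i))%MM).
Proof.
move=> kp kl; rewrite mulrCA path_sum_rec // mulr_sumr; apply: eq_bigr => i _.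
case: (ltnP (k i) (lam i)) => h.
  rewrite -(skew_boxes_rec _ _ _ h) /phi -/(box a b d i (k i)); ring.
by rewrite (@path_sum_supp _ i) ?mulr0 // mnmDE mnm1E eqxx addn1 ltnS.
Qed.

Lemma interp_family K : exists Rf : 'X_{1..n} -> {mpoly F[n]},
  forall k, is_partition k -> (mdeg k < K)%N -> interp q t c k (Rf k).
Proof.
have H (k : 'X_{1..n < K}) : exists R, is_partition k -> interp q t c k R.
  case: (boolP (is_partition k)) => kp; last by exists 0.
  by have [R h] := interp_ex qt c0 kp; exists R.
have [f hf] := fin_all_exists H.
exists (fun k => if insub k is Some x then f x else 0) => k kp kK.
by rewrite (insubT (fun m : 'X_{1..n} => mdeg m < K)%N kK); apply: (hf (BMultinom kK)).
Qed.

(** The difference of two eigenfunctions would be an eigenfunction with the same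
    eigenvalue, hence with leading exponent [lam], where its coefficient
    is 0. *)
Lemma eigenfun_uniq a b d f f' : a * b = s ->
  eigenfun a b d lam f -> eigenfun a b d lam f' -> f = f'.
Proof.
move=> ab [fs fk fl fe] [fs' fk' fl' fe']; apply/eqP; rewrite -subr_eq0.
set h := f - f'; apply/negPn/negP => h0.
have hs : h \is symmetric by rewrite rpredB.
have [g og] := qop_repr_ex two0 qt (alT_beT_cond q t c n a b d) hs.
have [gs _ gl _] := og.
have hk : (msize h <= (mdeg lam).+1)%N by apply: msizeB_sup.
have gE : g = Es lam *: h.
  apply: (@lat_eq F q t c n qt c0 (mdeg lam)) => //; first by rewrite rpredZ.
  - exact: msize_poly_op hk gl.
  - exact: msizeZ_sup.
  move=> v vp _; rewrite (DB_at_repr qt c0 v og) mevalZ /DB_at qopB -!/(DB_at _ _ _ _ _ _ _ _).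
  by rewrite fe // fe' // mevalB mulrBr.
have [_] := gl _ (lexx _); rewrite gE mcoeffZ /= ab => /mulIf e.
have : mlead h = lam.
  apply: E_inj => //; first exact: part_mlead.
  by rewrite -e // mleadc_eq0.
move=> e'; have : h@_(mlead h) != 0 by rewrite mleadc_eq0.
by rewrite e' mcoeffB fl fl' subrr eqxx.
Qed.

(** The eigenfunction is the sum of the R_k with coefficients
    skew_boxes k * path_sum k, normalized by the leading coefficient of R_lam; at
    c t^rho only the term with k = 0 survives. The constant W is the same for all
    a, b, d with the same product a b. *)
Theorem eigenfun_value : exists W, forall a b d, a * b = s ->
  (exists f, eigenfun a b d lam f) /\
  (forall f, eigenfun a b d lam f ->
    f.@[pt_ 0%MM] = W * \prod_i \prod_(0 <= l < lam i) box a b d i l).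
Proof.
pose K := (mdeg lam).+1; have [Rf hR] := interp_family K.
have iL := hR lam lamP (leqnn _).
have Ll : mlead (Rf lam) = lam := interp_lead two0 qt c0 e_inj lamP iL.
have lc0 : (Rf lam)@_lam != 0.
  by have := interp_neq0 lamP iL; rewrite -mleadc_eq0 Ll.
exists (((Rf lam)@_lam)^-1 * path_sum 0%MM) => a b d ab.
pose X k := skew_boxes a b d k * path_sum k.
pose f := ((Rf lam)@_lam)^-1 *: \sum_(k : 'X_{1..n < K} | is_partition k) X k *: Rf k.
have fE : eigenfun a b d lam f.
  split.
  - rewrite rpredZ // rpred_sum // => k kp; rewrite rpredZ //.
    by have [] := hR _ kp (bmdeg k).
  - apply: msizeZ_sup; apply: leq_trans (msize_sum _ _ _) _; apply/bigmax_leqP => k kp.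
    have [_ h _] := hR _ kp (bmdeg k); apply: msizeZ_sup.
    by apply: leq_trans h _; apply: bmdeg.
  - rewrite mcoeffZ raddf_sum (bigD1 (BMultinom (leqnn K))) //= big1 ?addr0.
      rewrite mcoeffZ /X path_sum_top // eqxx mulr1 /skew_boxes.
      by rewrite big1 ?mul1r ?mulVf // => i _; rewrite big_geq.
    move=> k /andP[kp kl]; rewrite mcoeffZ /X.
    have := bmdeg k; rewrite ltnS leq_eqVlt => /orP[/eqP e|lt].
      rewrite path_sum_top //; case: eqP => [e'|_]; last by rewrite mulr0 mul0r.
      by case/eqP: kl; apply/eqP; rewrite bmeqP /= e'.
    have [_ h _] := hR _ kp (bmdeg k).
    by rewrite (mcoeff_msize0 (leq_trans h lt)) mulr0.
  move=> v vp; rewrite /f /DB_at qopZ mevalZ mulrCA; congr (_ * _).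
  rewrite qop_sum raddf_sum mulr_sumr /=.
  (* T k collects what the terms R_(k + e_i) contribute to R_k *)
  pose T k := \sum_i phi q t c a b d k i * X (k + U_(i))%MM.
  transitivity (\sum_(k : 'X_{1..n < K} | is_partition k) (X k * Es k + T k) * (Rf k).@[pt_ v]).
    under [RHS]eq_bigr => k _ do rewrite mulrDl.
    rewrite big_split /=.
    under eq_bigr => k kp.
      rewrite qopZ -/(DB_at _ _ _ _ _ _ _ _) (DB_lat two0 qt c0 e_inj a b d hR kp (bmdeg k) vp).
      rewrite mulrDr; over.
    rewrite big_split /=; congr (_ + _).
      by apply: eq_bigr => k _; rewrite /eigsumB ab mulrA.
    under eq_bigr => k _ do rewrite mulr_sumr.
    rewrite exchange_big /=; apply: eq_bigr => k kp; rewrite /T mulr_suml.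
    under eq_bigr => m _ do rewrite mulr_sumr.
    rewrite exchange_big /=; apply: eq_bigr => i _.
    case: (boolP (is_partition (k + U_(i))%MM)) => pk; last first.
      rewrite /phi Ap_lat0 // !(mulr0, mul0r) big1 // => m _.
      by rewrite !(mulr0, mul0r).
    case: (ltnP (mdeg (k + U_(i))%MM) K) => h.
      rewrite (bigD1 (BMultinom h)) //= eqxx mul1r big1 ?addr0 => [|m /andP[_ mk]].
        by rewrite mulrA [X _ * _]mulrC.
      case: eqP => [e|_]; last by rewrite !mul0r mulr0.
      by case/eqP: mk; apply/eqP; rewrite bmeqP /= e.
    have -> : X (k + U_(i))%MM = 0.
      rewrite /X /path_sum; have -> : (mdeg lam - mdeg (k + U_(i))%MM)%N = 0%N by lia.
      by rewrite /=; case: eqP => [e|_]; [move: h; rewrite e ltnn | rewrite mulr0].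
    rewrite mulr0 mul0r big1 // => m _; case: eqP => [e|_]; last by rewrite !mul0r mulr0.
    by move: h; rewrite e leqNgt bmdeg.
  apply: eq_bigr => k kp; rewrite mevalZ mulrA; congr (_ * _).
  have := bmdeg k; rewrite ltnS leq_eqVlt => /orP[/eqP e|lt].
    have -> : T k = 0.
      rewrite /T big1 // => i _; rewrite /X /path_sum mdegD mdeg1 e.
      have -> : (mdeg lam - (mdeg lam + 1))%N = 0%N by lia.
      rewrite /=; case: eqP => [e'|_]; last by rewrite !mulr0.
      by move: (congr1 mdeg e'); rewrite mdegD mdeg1; lia.
    rewrite addr0 /X path_sum_top //; case: eqP => [->|_]; first by rewrite mulrC.
    by rewrite !(mulr0, mul0r).
  by rewrite /T /X -coef_rec // /X; ring.
split; first by exists f.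
move=> f' f'E; rewrite (eigenfun_uniq ab f'E fE) /f mevalZ -mulrA; congr (_ * _).
have P0 : is_partition (0%MM : 'X_{1..n}) by apply/partP => i j _; rewrite !mnm0E.
have K0 : (mdeg (0%MM : 'X_{1..n}) < K)%N by rewrite mdeg0.
rewrite raddf_sum (bigD1 (BMultinom K0)) //= big1 ?addr0 => [|k /andP[kp k0]].
  have [_ _ h] := hR _ P0 K0; rewrite mevalZ h // eqxx mulr1 /X mulrC; congr (_ * _).
  by apply: eq_bigr => i _; rewrite mnm0E.
have [_ _ h] := hR _ kp (bmdeg k); rewrite mevalZ h ?mdeg0 //.
case: eqP => [e|_]; last by rewrite mulr0.
by case/eqP: k0; apply/eqP; rewrite bmeqP /= e.
Qed.
End PathSum.

(** * The proposed value *)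

Section Target.
Variables (F : fieldType) (n : nat) (q t : F).
Implicit Types (a b c d s : F) (lam : 'X_{1..n}).

Definition Delta_factor s lam (j k : 'I_n) : F :=
  (qpoch q (q * s * t ^+ (rho j + rho k).+1) (lam j + lam k)
    * qpoch q (t ^+ (k - j).+1) (lam j - lam k))
  / (qpoch q (q * s * t ^+ (rho j + rho k)) (lam j + lam k)
    * qpoch q (t ^+ (k - j)) (lam j - lam k)).

Definition Delta_s s lam : F := \prod_(j < n) \prod_(k < n | (j < k)%N) Delta_factor s lam j k.

(** The product of (-(q b c / d) t^rho; q)_l, d^l and q^(l(l-1)/2) is written
    without division, so that d = 0 is allowed. *)
Definition row_factor a b c d (i : 'I_n) (l : nat) : F :=
  qpoch q (q * a * t ^+ rho i) l * qpoch q (q * (a * b) * t ^+ rho i) l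
  / qpoch q (q * (a * b) * t ^+ (2 * rho i)) (2 * l)
  * \prod_(k < l) (d * q ^+ k + b * c * q ^+ (2 * k).+1 * t ^+ rho i).

Definition eval_rhs a b c d lam : F :=
  Delta_s (a * b) lam * \prod_(i < n) row_factor a b c d i (lam i).
End Target.

Lemma qpochS (F : fieldType) (q u : F) l : qpoch q u l.+1 = (1 - u) * qpoch q (u * q) l.
Proof.
rewrite /qpoch big_ord_recl expr0 mulr1; congr (_ * _); apply: eq_bigr => i _.
by rewrite /= exprS mulrA.
Qed.
Lemma qpoch0 (F : fieldType) (q u : F) : qpoch q u 0 = 1.
Proof. by rewrite /qpoch big_ord0. Qed.

Section Alg.
Variables (F : fieldType) (q t s : F).
Hypotheses (qt : qt_free q t) (s1 : forall i j, 1 - s * q ^+ i * t ^+ j != 0).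
Let q0 := qt_q0 qt.
Let t0 := qt_t0 qt.

Lemma qpoch_s_neq0 i j l : qpoch q (s * q ^+ i * t ^+ j) l != 0.
Proof.
apply/prodf_neq0 => k _; have := s1 (i + k) j.
by rewrite exprD; congr (_ != 0); ring.
Qed.

Lemma qpoch_t_neq0 j l : (0 < j)%N -> qpoch q (t ^+ j) l != 0.
Proof.
move=> j0; apply/prodf_neq0 => k _; rewrite subr_eq0; apply/eqP => e.
have [|_ /esym/eqP] := @qt 0 0 k j; first by rewrite !expr0 mul1r e mulrC.
by rewrite gtn_eqF.
Qed.

Let G e := (1 - q * s * t ^+ e) * (1 - q ^+ 2 * s * t ^+ e).
Let G0 e : G e != 0.
Proof.
rewrite mulf_neq0 //; [have := s1 1 e | have := s1 2 e]; congr (_ != 0); ring.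
Qed.

Lemma qs_shift e l : qpoch q (q * s * t ^+ e) l.+2 = G e * qpoch q (q * (q ^+ 2 * s) * t ^+ e) l.
Proof.
rewrite !qpochS mulrA /G; congr (_ * (1 - _) * qpoch q _ _); ring.
Qed.

Lemma Delta_factor_shift n (lam : 'X_{1..n}) j k :
  Delta_factor q t s (lam + onem n)%MM j k =
  Delta_factor q t (q ^+ 2 * s) lam j k * (G (rho j + rho k).+1 / G (rho j + rho k)).
Proof.
rewrite /Delta_factor !mnmDE !(mnmE _ j) !(mnmE _ k).
have -> : (lam j + 1 + (lam k + 1))%N = (lam j + lam k).+2 by lia.
have -> : (lam j + 1 - (lam k + 1))%N = (lam j - lam k)%N by lia.
rewrite !qs_shift !invfM; ring.
Qed.

Lemma G_telescope n (j : 'I_n) :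
  \prod_(k < n | (j < k)%N) (G (rho j + rho k).+1 / G (rho j + rho k))
   = G (2 * rho j) / G (rho j).
Proof.
pose f k := (G (rho j + (n - k)))^-1.
have f0 k : f k != 0 by rewrite invr_eq0.
rewrite -(big_geq_mkord j.+1 n xpredT
   (fun k => G (rho j + (n - k.+1)).+1 / G (rho j + (n - k.+1)))).
case: (ltnP j.+1 n) => jn; last first.
  have -> : rho j = 0%N by rewrite /rho; have := ltn_ord j; lia.
  by rewrite big_geq // muln0 divff.
rewrite (@telescope_prodf_eq _ j.+1 n f) //.
  rewrite /f subnn addn0 invrK mulrC; congr (G _ / _).
  by rewrite /rho mul2n addnn.
move=> k /andP[jk kn]; rewrite /f invrK [RHS]mulrC; congr (G _ / _); lia.
Qed.

Lemma Delta_s_shift n (lam : 'X_{1..n}) :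
  Delta_s q t s (lam + onem n)%MM =
  Delta_s q t (q ^+ 2 * s) lam * \prod_(i < n) (G (2 * rho i) / G (rho i)).
Proof.
rewrite /Delta_s -big_split; apply: eq_bigr => j _ /=.
by rewrite -G_telescope -big_split; apply: eq_bigr => k _; rewrite Delta_factor_shift.
Qed.

(** Matches [Zmul_eig]: adding a column to lam multiplies the proposed value
    by z_1 ... z_n at c t^rho. *)
Lemma eval_rhs_shift n c (lam : 'X_{1..n}) :
  eval_rhs q t (q * s) q^-1 c 0 (lam + onem n)%MM =
  (\prod_(i < n) (c * t ^+ rho i)) * eval_rhs q t (q * s) q c 0 lam.
Proof.
rewrite /eval_rhs mulrCA.
have -> : q * s * q^-1 = s by rewrite mulrAC divff ?mul1r.
have -> : q * s * q = q ^+ 2 * s by ring.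
rewrite Delta_s_shift -!mulrA; congr (_ * _); rewrite -!big_split; apply: eq_bigr => i _ /=.
rewrite /row_factor mnmDE mnmE addn1.
have -> : q * s * q^-1 = s by rewrite mulrAC divff ?mul1r.
have -> : q * s * q = q ^+ 2 * s by ring.
have -> : (2 * (lam i).+1)%N = (2 * lam i).+2 by lia.
set m := rho i; set l := lam i.
have -> : \prod_(k < l.+1) (0 * q ^+ k + q^-1 * c * q ^+ (2 * k).+1 * t ^+ m) =
   c * t ^+ m * \prod_(k < l) (0 * q ^+ k + q * c * q ^+ (2 * k).+1 * t ^+ m).
  rewrite big_ord_recl; congr (_ * _).
    by rewrite mul0r add0r muln0; field.
  apply: eq_bigr => k _; rewrite !mul0r !add0r /=.
  have -> : (2 * k.+1).+1 = ((2 * k).+1).+2 by lia.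
  by rewrite !exprS; field.
rewrite qs_shift.
have -> : qpoch q (q * (q * s) * t ^+ m) l.+1 * qpoch q (q * s * t ^+ m) l.+1 =
   G m * (qpoch q (q * (q * s) * t ^+ m) l * qpoch q (q * (q ^+ 2 * s) * t ^+ m) l).
  rewrite !qpochS /G.
  have -> : q * (q * s) * t ^+ m * q = q * (q ^+ 2 * s) * t ^+ m by ring.
  have -> : q * s * t ^+ m * q = q * (q * s) * t ^+ m by ring.
  by ring.
have P0 : qpoch q (q * (q ^+ 2 * s) * t ^+ (2 * m)) (2 * l) != 0.
  by have := qpoch_s_neq0 3 (2 * m) (2 * l); congr (qpoch _ _ _ != 0); ring.
by field; rewrite P0 !G0.
Qed.

Hypothesis s0 : s != 0.

(** Matches [rst_eig]: the pairs (i, n), which have no counterpart in n - 1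
    variables, contribute exactly the change in the factors of the rows. *)
Lemma eval_rhs_mext n c (lam : 'X_{1..n}) :
  eval_rhs q t q^-1 (q * s) c 0 (mext lam) = eval_rhs q t (t ^+ 2 / q) (q * s) (c * t) 0 lam.
Proof.
have rl (i : 'I_n) : rho (lift ord_max i) = (rho i).+1.
  by rewrite /rho lift_max subSn.
have rm : @rho n.+1 ord_max = 0%N by rewrite /rho subnn.
have el (i : 'I_n) : mext lam (lift ord_max i) = lam i by rewrite mnmE liftK.
have em := mext_max lam.
have wl (i : 'I_n) : widen_ord (leqnSn n) i = lift ord_max i.
  by apply: ord_inj; rewrite lift_max.
rewrite /eval_rhs.
have -> : q^-1 * (q * s) = s by rewrite mulKf.
have -> : t ^+ 2 / q * (q * s) = t ^+ 2 * s by field.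
rewrite /Delta_s big_ord_recr /= [X in _ * X * _]big1 ?mulr1; last first.
  by move=> k; rewrite ltnNge -ltnS ltn_ord.
rewrite big_ord_recr /= {2}/row_factor em qpoch0.
rewrite muln0 !qpoch0 big_ord0 !(mulr1, divr1) -!big_split; apply: eq_bigr => i _ /=.
rewrite big_mkcond big_ord_recr /= -big_mkcond /= (ltn_ord i) wl.
(* the pairs of i with the first n indices give the factors for t^2 s; the
   pair of i with the last index is left over *)
rewrite [X in X * _ = _](_ : _ = \prod_(k < n | (i < k)%N) Delta_factor q t (t ^+ 2 * s) lam i k *
    Delta_factor q t s (mext lam) (lift ord_max i) ord_max); last first.
  congr (_ * _); rewrite big_mkcond [RHS]big_mkcond; apply: eq_bigr => k _ /=.
  case: ifP => // ik; rewrite wl /Delta_factor !el !rl !lift_max.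
  have -> e : q * (t ^+ 2 * s) * t ^+ e = q * s * t ^+ e.+2 by rewrite !exprS; ring.
  have -> e : q * (t ^+ 2 * s) * t ^+ e = q * s * t ^+ e.+2 by rewrite !exprS; ring.
  by rewrite addSn addnS.
rewrite -[LHS]mulrA; congr (_ * _).
rewrite /row_factor /Delta_factor !el !rl rm em addn0 subn0 addn0 lift_max.
have -> : (n - i)%N = (rho i).+1 by rewrite /rho; have := ltn_ord i; lia.
set m := rho i; set l := lam i.
have -> : q^-1 * (q * s) = s by rewrite mulKf.
have -> : t ^+ 2 / q * (q * s) = t ^+ 2 * s by field.
have -> : q * q^-1 * t ^+ m.+1 = t ^+ m.+1 by rewrite divff ?mul1r.
have -> : q * (t ^+ 2 / q) * t ^+ m = t ^+ m.+2 by rewrite !exprS; field.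
have -> : q * (t ^+ 2 * s) * t ^+ m = q * s * t ^+ m.+2 by rewrite !exprS; ring.
have -> : q * (t ^+ 2 * s) * t ^+ (2 * m) = q * s * t ^+ (2 * m.+1).
  by rewrite mulnS !exprS; ring.
have -> : \prod_(k < l) (0 * q ^+ k + q * s * (c * t) * q ^+ (2 * k).+1 * t ^+ m)
   = \prod_(k < l) (0 * q ^+ k + q * s * c * q ^+ (2 * k).+1 * t ^+ m.+1).
  by apply: eq_bigr => k _; rewrite [t ^+ m.+1]exprS; ring.
have P1 : qpoch q (q * s * t ^+ m.+1) l != 0.
  by have := qpoch_s_neq0 1 m.+1 l; congr (qpoch _ _ _ != 0); ring.
have P2 : qpoch q (q * s * t ^+ (2 * m.+1)) (2 * l) != 0.
  by have := qpoch_s_neq0 1 (2 * m.+1) (2 * l); congr (qpoch _ _ _ != 0); ring.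
have P3 := qpoch_t_neq0 l (ltn0Sn m).
by field; rewrite P1 P2 P3.
Qed.

End Alg.

(** * Induction on the partition and on the number of variables *)

(** The proposed value depends on (a, b, d), for a given product a b, in the
    same way as the true one in [eigenfun_value]. *)
Lemma eval_rhs_box (F : fieldType) (n : nat) (q t s c : F) (lam : 'X_{1..n}) :
  q != 0 -> t != 0 -> c != 0 ->
  exists C, forall a b d, a * b = s ->
    eval_rhs q t a b c d lam = C * \prod_i \prod_(0 <= l < lam i) box q t c a b d i l.
Proof.
move=> q0 t0 c0.
(* the ratio of the k-th factor of the row to the contribution of its box *)
pose kap (i : 'I_n) k := - (q ^+ k.+1 * t ^+ rho i) *
  (c * q ^+ (2 * k).+1 * t ^+ rho i) / (q * t ^+ n.-1).
exists (Delta_s q t s lam * \prod_i (qpoch q (q * s * t ^+ rho i) (lam i)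
   / qpoch q (q * s * t ^+ (2 * rho i)) (2 * lam i) * \prod_(k < lam i) kap i k)).
move=> a b d ab; rewrite /eval_rhs ab -mulrA; congr (_ * _); rewrite -big_split /=.
apply: eq_bigr => i _; rewrite /row_factor ab big_mkord.
have E : qpoch q (q * a * t ^+ rho i) (lam i)
    * (\prod_(k < lam i) (d * q ^+ k + b * c * q ^+ (2 * k).+1 * t ^+ rho i))
  = (\prod_(k < lam i) kap i k) * \prod_(k < lam i) box q t c a b d i k.
  rewrite /qpoch -!big_split /=; apply: eq_bigr => k _.
  rewrite /kap /box /alB !exprS mul2n -addnn exprD; field.
  by rewrite q0 c0 !expf_neq0.
rewrite -[RHS]mulrA -E; ring.
Qed.

(** What the induction needs from q, t and s. The eigenvalue condition is
    required for all s q^(2 i) t^(2 j), the values that s takes on the way. *)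
Record generic (F : fieldType) (q t s : F) : Prop := Generic {
  gen_qt : qt_free q t;
  gen_s0 : s != 0;
  gen_s1 : forall i j, 1 - s * q ^+ i * t ^+ j != 0;
  gen_e : forall n (m k : 'X_{1..n}), is_partition m -> is_partition k ->
    eigsum q t 0 1 m = eigsum q t 0 1 k -> m = k;
  gen_E : forall n i j (m k : 'X_{1..n}), is_partition m -> is_partition k ->
    eigsum q t (q * (s * q ^+ (2 * i) * t ^+ (2 * j)) * t ^+ n.-1) 1 m
    = eigsum q t (q * (s * q ^+ (2 * i) * t ^+ (2 * j)) * t ^+ n.-1) 1 k -> m = k }.

Section GenericShift.
Variables (F : fieldType) (q t s : F).
Hypothesis gen : generic q t s.
Let q0 := qt_q0 (gen_qt gen).
Let t0 := qt_t0 (gen_qt gen).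

Lemma gen_E0 n (m k : 'X_{1..n}) : is_partition m -> is_partition k ->
  eigsum q t (q * s * t ^+ n.-1) 1 m = eigsum q t (q * s * t ^+ n.-1) 1 k -> m = k.
Proof. by have := @gen_E _ _ _ _ gen n 0 0 m k; rewrite !muln0 !expr0 !mulr1. Qed.

Lemma generic_q2 : generic q t (q ^+ 2 * s).
Proof.
case: gen => h1 h2 h3 h4 h5; split=> //; first by rewrite mulf_neq0 ?expf_neq0.
  by move=> i j; have := h3 (i + 2)%N j; congr (_ != 0); rewrite exprD; ring.
move=> n i j m k mp kp e; apply: (h5 n i.+1 j) => //.
have -> : s * q ^+ (2 * i.+1) * t ^+ (2 * j) = q ^+ 2 * s * q ^+ (2 * i) * t ^+ (2 * j).
  by rewrite mulnS exprD; ring.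
exact: e.
Qed.
Lemma generic_t2 : generic q t (t ^+ 2 * s).
Proof.
case: gen => h1 h2 h3 h4 h5; split=> //; first by rewrite mulf_neq0 ?expf_neq0.
  by move=> i j; have := h3 i (j + 2)%N; congr (_ != 0); rewrite exprD; ring.
move=> n i j m k mp kp e; apply: (h5 n i j.+1) => //.
have -> : s * q ^+ (2 * i) * t ^+ (2 * j.+1) = t ^+ 2 * s * q ^+ (2 * i) * t ^+ (2 * j).
  by rewrite mulnS exprD; ring.
exact: e.
Qed.
End GenericShift.

Section MulVariables.
Variables (F : fieldType) (q t : F).
Hypothesis two0 : (2%:R : F) != 0.

(** Conjugation by z_1 ... z_n multiplies the shifts by q and 1/q. For these
    parameters this turns the coefficients into those for (q s, q, 0), up to
    the factor 1/q, and the terms without shift add up to a constant by the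
    sums [sum_Ap], [sum_Am], [sum_Ap_div] and [sum_Am_div]. *)
Lemma Zmul_eig n c s (lam : 'X_{1..n}) g : generic q t s -> c != 0 ->
  eigenfun q t c (q ^+ 2 * s) (q * s) q 0 lam g ->
  eigenfun q t c s (q * s) q^-1 0 (lam + onem n)%MM ('X_[onem n] * g).
Proof.
move=> gen c0 [gs gk gl ge]; have qt := gen_qt gen.
have q0 := qt_q0 qt; have t0 := qt_t0 qt.
have t1 := qt_t1 qt.
split.
- rewrite rpredM //; apply/issymP => w; exact: msym_onem.
- have Zk : (msize ('X_[onem n] : {mpoly F[n]}) <= n.+1)%N by rewrite msizeX mdeg_onem.
  by have := msizeM_sup gk Zk; rewrite mulrC mdegD mdeg_onem addSn.
- by rewrite mulrC addmC mcoeffMX.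
move=> v vp; have gev := ge v vp.
have zi := lat_inj qt c0 : injective (lat q t c v).
have z0 i : lat q t c v i != 0 by apply: lat_neq0.
have n1 : (0 < n)%N -> t ^+ n.-1 != 0 by rewrite expf_neq0.
rewrite mevalM meval_onem mulrCA; set z := lat q t c v in gev zi z0 *.
pose S := \sum_(j < n) t ^+ j.
have Zs u j : \prod_l shift u j z l = u * \prod_l z l.
  rewrite (bigD1 j) //= [in RHS](bigD1 j) //= /shift eqxx -mulrA; congr (_ * (_ * _)).
  by apply: eq_bigr => l /negPf ->; rewrite mul1r.
have -> : DB_at q t c (q * s) q^-1 0 ('X_[onem n] * g) v = (\prod_l z l) *
   (q^-1 * DB_at q t c (q * s) q 0 g v + g.@[z] * ((q - 1) * (q * s * t ^+ n.-1 - q^-1) * S)).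
  have -> : (q - 1) * (q * s * t ^+ n.-1 - q^-1) * S =
     \sum_j (alB n q t (q * s) q^-1 c 0 (z j) * Ap t z j * (q - 1)
             + beB c 0 (z j) * Am t z j * (q^-1 - 1)).
    rewrite /alB /beB.
    transitivity (\sum_j ((q - 1) * (q * s * t ^+ n.-1) * Ap t z j + - ((q - 1) / q) * Am t z j
        + - ((q - 1) * (c / q) * t ^+ n.-1) * (Ap t z j / z j)
        + (q - 1) * (c / q) * (Am t z j / z j))).
      rewrite !big_split /= -!mulr_sumr sum_Ap // sum_Am // sum_Ap_div // sum_Am_div // -/S.
      by field.
    apply: eq_bigr => j _; field; by rewrite q0 z0.
  rewrite /DB_at /qop -/z !mulr_sumr -big_split mulr_sumr; apply: eq_bigr => j _ /=.
  rewrite !mevalM !meval_onem !Zs /alB /beB; field.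
  by rewrite q0 z0.
rewrite gev -/z; congr (_ * _).
have -> : eigsum q t (q * s * t ^+ n.-1) 1 (lam + onem n)%MM =
   q^-1 * eigsum q t (q * (q ^+ 2 * s) * t ^+ n.-1) 1 lam
   + (q - 1) * (q * s * t ^+ n.-1 - q^-1) * S.
  have -> : (q - 1) * (q * s * t ^+ n.-1 - q^-1) * S =
     \sum_(j < n) ((q - 1) * (q * s * t ^+ n.-1) * t ^+ rho j + (q^-1 - 1) * t ^+ j).
    rewrite big_split /= -!mulr_sumr.
    have -> : \sum_(j < n) t ^+ rho j = S.
      by rewrite /S [RHS](reindex_inj rev_ord_inj) /=.
    by rewrite -/S; field.
  rewrite /eigsum mulr_sumr -big_split; apply: eq_bigr => j _ /=.
  rewrite mnmDE mnmE addn1 !exprS; field.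
  by rewrite q0 expf_neq0.
ring.
Qed.
End MulVariables.

Section LastPoint.
Variables (F : fieldType) (n : nat) (c : F) (z : 'I_n -> F).

Lemma zext_lift j : zext c z (lift ord_max j) = z j.
Proof. by rewrite /zext liftK. Qed.
Lemma zext_max : zext c z ord_max = c.
Proof. by rewrite /zext unlift_none. Qed.
Lemma zext_shift u j : zext c (shift u j z) =1 shift u (lift ord_max j) (zext c z).
Proof.
move=> i; rewrite /shift /zext; case: unliftP => [l ->|->].
  by rewrite (inj_eq lift_inj).
by rewrite (negPf (neq_lift _ _)) mul1r.
Qed.

Lemma widen_lift (i : 'I_n) : widen_ord (leqnSn n) i = lift ord_max i.
Proof. by apply: ord_inj; rewrite lift_max. Qed.

Lemma Ap_zext t j : Ap t (zext c z) (lift ord_max j) = Ap t z j * ((c - t * z j) / (c - z j)).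
Proof.
rewrite /Ap big_mkcond big_ord_recr /= neq_lift zext_max zext_lift; congr (_ * _).
rewrite [RHS]big_mkcond; apply: eq_bigr => i _.
by rewrite widen_lift (inj_eq lift_inj) zext_lift.
Qed.
Lemma Am_zext t j : Am t (zext c z) (lift ord_max j) = Am t z j * ((z j - t * c) / (z j - c)).
Proof.
rewrite /Am big_mkcond big_ord_recr /= neq_lift zext_max zext_lift; congr (_ * _).
rewrite [RHS]big_mkcond; apply: eq_bigr => i _.
by rewrite widen_lift (inj_eq lift_inj) zext_lift.
Qed.
End LastPoint.

Section Induction.
Variables (F : fieldType) (q t : F).
Hypothesis two0 : (2%:R : F) != 0.

(** With a = 1/q both coefficients of the last term vanish at z_n = c; in the
    others the factors of A_j^+ and A_j^- for the pair (j, n) replace c by c t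
    and a = 1/q by t^2/q. *)
Lemma rst_eig n c s (lam : 'X_{1..n}) f : generic q t s -> c != 0 ->
  eigenfun q t c s q^-1 (q * s) 0 (mext lam) f ->
  eigenfun q t (c * t) (t ^+ 2 * s) (t ^+ 2 / q) (q * s) 0 lam (rst c f).
Proof.
move=> gen c0 [fs fk fl fe]; have qt := gen_qt gen.
have q0 := qt_q0 qt; have t0 := qt_t0 qt.
rewrite mdeg_mext in fk.
split; first exact: rst_sym.
- exact: leq_trans (msize_rst _ _) fk.
- by rewrite mcoeff_rst.
move=> v vp; have fev := fe _ (part_mext vp).
have le := lat_ext q t c v.
have ct0 : c * t != 0 by rewrite mulf_neq0.
have z0 j : lat q t (c * t) v j != 0 by apply: lat_neq0.
set z := lat q t (c * t) v in le z0 *.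
have zc j : c - z j != 0.
  rewrite subr_eq0 /z /lat; apply/eqP => e; have := @qt 0 0 (v j) (rho j).+1.
  case=> //; apply: (mulfI c0); rewrite !expr0 !mulr1 {1}e exprS; ring.
have zc' j : z j - c != 0 by rewrite -oppr_eq0 opprB.
move: fev; rewrite /DB_at (qop_ext _ _ _ _ _ le) -/z => fev.
rewrite meval_rst -(meval_eq f le).
have -> : eigsum q t (q * (t ^+ 2 * s) * t ^+ n.-1) 1 lam =
    eigsum q t (q * s * t ^+ n.+1.-1) 1 (mext lam).
  rewrite /eigsum big_ord_recr /= mext_max expr0 invr1 !subrr !mulr0 !addr0.
  apply: eq_bigr => j _; rewrite widen_lift mnmE liftK; congr (_ * _ + _).
  have -> : rho (lift ord_max j) = (rho j).+1 by rewrite /rho lift_max subSn.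
  have -> : t ^+ n = t * t ^+ n.-1 by rewrite -exprS prednK //; have := ltn_ord j; lia.
  by rewrite !exprS; ring.
rewrite -fev /qop big_ord_recr /= zext_max.
have -> : alB n.+1 q t q^-1 (q * s) c 0 c = 0.
  by rewrite /alB; field; rewrite q0 c0.
have -> : beB c 0 c = 0 by rewrite /beB divff // subrr mul0r.
rewrite !mul0r !addr0; apply: eq_bigr => j _.
rewrite widen_lift !(Ap_zext, Am_zext) zext_lift !meval_rst !(meval_eq f (zext_shift _ _ _ _)).
have -> : alB n q t (t ^+ 2 / q) (q * s) (c * t) 0 (z j) * Ap t z j =
   alB n.+1 q t q^-1 (q * s) c 0 (z j) * (Ap t z j * ((c - t * z j) / (c - z j))).
  rewrite /alB /=.
  have -> : t ^+ n = t * t ^+ n.-1 by rewrite -exprS prednK //; have := ltn_ord j; lia.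
  by field; rewrite q0 z0 zc.
have -> : beB (c * t) 0 (z j) * Am t z j =
   beB c 0 (z j) * (Am t z j * ((z j - t * c) / (z j - c))).
  by rewrite /beB; field; rewrite z0 zc'.
by [].
Qed.

Lemma eval_rhs0 n a b c d : eval_rhs q t a b c d (0%MM : 'X_{1..n}) = 1.
Proof.
rewrite /eval_rhs /Delta_s big1 ?mul1r => [|j _]; last first.
  by rewrite big1 // => k _; rewrite /Delta_factor !mnm0E /= !qpoch0 !mulr1 divr1.
by rewrite big1 // => i _; rewrite /row_factor mnm0E muln0 !qpoch0 big_ord0 !mulr1 divr1.
Qed.

(** The constants W of [eigenfun_value] and C of [eval_rhs_box] are compared by
    means of one triple with nonzero box product. *)
Lemma transfer n c s (lam : 'X_{1..n}) a0 b0 d0 f0 : generic q t s -> c != 0 ->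
  is_partition lam -> a0 * b0 = s -> eigenfun q t c s a0 b0 d0 lam f0 ->
  f0.@[lat q t c 0%MM] = eval_rhs q t a0 b0 c d0 lam ->
  (forall i l, (l < lam i)%N -> box q t c a0 b0 d0 i l != 0) ->
  forall a b d f, a * b = s -> eigenfun q t c s a b d lam f ->
    f.@[lat q t c 0%MM] = eval_rhs q t a b c d lam.
Proof.
move=> gen c0 lp ab0 fe0 fv0 bx a b d f ab fe; have qt := gen_qt gen.
have [W WE] := eigenfun_value two0 qt c0 (@gen_e _ _ _ _ gen n) (@gen_E0 _ _ _ _ gen n) lp.
have [C CE] := eval_rhs_box s lam (qt_q0 qt) (qt_t0 qt) c0.
have [_ /(_ _ fe) ->] := WE _ _ d ab; rewrite CE //; congr (_ * _).
have [_ /(_ _ fe0) e] := WE _ _ d0 ab0; move: e; rewrite fv0 CE // => /mulIf -> //.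
apply/prodf_neq0 => i _; rewrite big_mkord; apply/prodf_neq0 => l _; exact: bx.
Qed.

(** Induction on the number of variables and, inside it, on the last part of
    lam. *)
Theorem eig_eval n c s (lam : 'X_{1..n}) : generic q t s -> c != 0 -> is_partition lam ->
  forall a b d f, a * b = s -> eigenfun q t c s a b d lam f ->
    f.@[lat q t c 0%MM] = eval_rhs q t a b c d lam.
Proof.
elim: n c s lam => [|n IHn] c s lam gen c0 lp.
  move=> a b d f ab [_ _ fl _].
  have l0 : lam = 0%MM by apply/mnmP => -[].
  by rewrite l0 eval_rhs0 (nvar0_mpolyC f) mevalC -fl l0.
have [v vE] : exists v, lam ord_max = v by exists (lam ord_max).
have qt := gen_qt gen; have q0 := qt_q0 qt; have t0 := qt_t0 qt.
elim: v c s lam gen c0 lp vE => [|v IHv] c s lam gen c0 lp vE.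
  have [W WE] := eigenfun_value two0 qt c0 (@gen_e _ _ _ _ gen n.+1) (@gen_E0 _ _ _ _ gen n.+1) lp.
  (* lam_n = 0: the triple (1/q, q s, 0) *)
  have ab0 : q^-1 * (q * s) = s by rewrite mulKf.
  have [[f0 fe0] _] := WE _ _ 0 ab0.
  apply: (transfer gen c0 lp ab0 fe0).
    rewrite -(mext_rst vE) in fe0 *; rewrite (eval_rhs_mext qt (gen_s1 gen) (gen_s0 gen)).
    have ge := rst_eig gen c0 fe0.
    rewrite -(IHn _ _ _ (generic_t2 gen) _ (part_mrst lp) _ _ _ _ _ ge) ?mulf_neq0 //.
      rewrite meval_rst; apply: meval_eq => i; rewrite -lat_ext.
      by congr (lat _ _ _ _ _); apply/mnmP => j; rewrite mnm0E mnmE;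
        case: unlift => // l; rewrite mnm0E.
    by field.
  move=> i l li; rewrite /box /alB mul0r addr0.
  (* the last row is empty, so rho i > 0 and q^l t^(rho i) differs from 1 *)
  have il : (i < n)%N.
    have := ltn_ord i; rewrite ltnS leq_eqVlt => /orP[/eqP e|//].
    have ei : i = ord_max by apply: ord_inj.
    by move: li; rewrite ei vE.
  rewrite !mulf_neq0 ?expf_neq0 ?(gen_s0 gen) //.
  have -> : q^-1 - c / (q * (c * q ^+ l * t ^+ rho i)) =
     q^-1 * (q ^+ l * t ^+ rho i)^-1 * (q ^+ l * t ^+ rho i - 1).
    by field; rewrite q0 c0 !expf_neq0.
  rewrite !mulf_neq0 ?invr_eq0 ?mulf_neq0 ?expf_neq0 // subr_eq0; apply/eqP => e.
  have [|_] := @qt l (rho i) 0 0; first by rewrite e !expr0 mulr1.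
  by rewrite /rho; lia.
(* lam_n > 0: the first column is removed, and the triple is (q s, 1/q, 0) *)
pose lam' := [multinom (lam i).-1 | i < n.+1].
have lpos i : (0 < lam i)%N.
  have /partP h := lp; have := h i ord_max (leq_ord i); rewrite vE; lia.
have lE : (lam' + onem n.+1)%MM = lam.
  by apply/mnmP => i; rewrite mnmDE !mnmE addn1 prednK.
have lp' : is_partition lam'.
  apply/partP => i j ij; rewrite !mnmE; have /partP h := lp; have := h i j ij; lia.
have vE' : lam' ord_max = v by rewrite mnmE vE.
have qt' := gen_qt (generic_q2 gen).
have [W WE] := eigenfun_value two0 qt' c0 (@gen_e _ _ _ _ (generic_q2 gen) n.+1)
  (@gen_E0 _ _ _ _ (generic_q2 gen) n.+1) lp'.
have ab1 : q * s * q = q ^+ 2 * s by ring.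
have [[g ge] _] := WE _ _ 0 ab1.
have fe0 := Zmul_eig gen c0 ge; rewrite lE in fe0.
apply: (transfer gen c0 lp _ fe0); first by field.
  rewrite mevalM (IHv _ _ _ (generic_q2 gen) c0 lp' vE' _ _ _ _ ab1 ge) meval_onem -lE.
  rewrite (eval_rhs_shift qt (gen_s1 gen)); congr (_ * _); apply: eq_bigr => i _.
  by rewrite /lat mnm0E expr0 mulr1.
move=> i l li; rewrite /box /alB mul0r addr0.
rewrite !mulf_neq0 ?invr_eq0 ?expf_neq0 //.
have -> : q * s - c / (q * (c * q ^+ l * t ^+ rho i)) =
     - (q * q ^+ l * t ^+ rho i)^-1 * (1 - s * q ^+ l.+2 * t ^+ rho i).
  by rewrite !exprS; field; rewrite q0 c0 !expf_neq0.
by rewrite mulf_neq0 ?oppr_eq0 ?invr_eq0 ?mulf_neq0 ?expf_neq0 ?(gen_s1 gen).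
Qed.
End Induction.

(** * Monomial independence and genericity *)

(** A single condition that gives all parts of [generic], passes to the inverses
    of q, t and s, and holds for indeterminates. *)
Definition mono_indep (F : fieldType) (q t s : F) :=
  forall (J : finType) (e : J -> nat * nat * nat) (w : J -> bool), injective e -> J ->
    \sum_j (-1) ^+ w j * (q ^+ (e j).1.1 * t ^+ (e j).1.2 * s ^+ (e j).2) != 0.

Section Mono.
Variables (F : fieldType) (q t s : F).
Hypothesis mi : mono_indep q t s.

Lemma mono_eq e e' : q ^+ e.1.1 * t ^+ e.1.2 * s ^+ e.2 = q ^+ e'.1.1 * t ^+ e'.1.2 * s ^+ e'.2 ->
  e = e' :> nat * nat * nat.
Proof.
move=> h; apply/eqP/negPn/negP => ne.
have ei : injective (fun x : bool => if x then e else e').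
  by case=> [] [] //= E; move: ne; rewrite E eqxx.
have := mi id ei true.
by rewrite big_bool /= h expr1 expr0 mul1r mulN1r addNr eqxx.
Qed.

Lemma mono_qt : qt_free q t.
Proof.
move=> i j k l h; have := @mono_eq (i, j, 0)%N (k, l, 0)%N.
by rewrite /= h => /(_ erefl) [-> ->].
Qed.

Lemma mono_s0 : s != 0.
Proof.
apply/eqP => s0; have := @mono_eq (0, 0, 1)%N (0, 0, 2)%N.
by rewrite /= s0 !expr0n /= !mulr0 => /(_ erefl).
Qed.

(** Multiplication by a large power of q t s makes the exponents nonnegative
    again. *)
Lemma mono_inv : mono_indep q^-1 t^-1 s^-1.
Proof.
move=> J e w ei j0; have q0 := qt_q0 mono_qt; have t0 := qt_t0 mono_qt.
pose N := (\sum_j ((e j).1.1 + (e j).1.2 + (e j).2))%N.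
have eN j : ((e j).1.1 + (e j).1.2 + (e j).2 <= N)%N by rewrite /N (bigD1 j) //= leq_addr.
pose e' j := (N - (e j).1.1, N - (e j).1.2, N - (e j).2)%N.
have ei' : injective e'.
  move=> i j [] h1 h2 h3; apply: ei; have := eN i; have := eN j.
  case: (e i) (e j) h1 h2 h3 => [[x1 x2] x3] [[y1 y2] y3] /= h1 h2 h3 hi hj.
  by congr (_, _, _); lia.
have := mi w ei' j0; apply: contraNneq => h.
have -> : \sum_j (-1) ^+ w j * (q ^+ (e' j).1.1 * t ^+ (e' j).1.2 * s ^+ (e' j).2) =
  (q * t * s) ^+ N * \sum_j (-1) ^+ w j * (q^-1 ^+ (e j).1.1 * t^-1 ^+ (e j).1.2 * s^-1 ^+ (e j).2).
  rewrite mulr_sumr; apply: eq_bigr => j _ /=; have := eN j.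
  move: (e j) => [[x1 x2] x3] /= h'.
  have E (u : F) x : u != 0 -> (x <= N)%N -> u ^+ (N - x) = u ^+ N * u^-1 ^+ x.
    move=> u0 xN; have ux := expf_neq0 x u0.
    by apply: (mulIf ux); rewrite -exprD subnK // exprVn divfK.
  rewrite !E ?mono_s0 //; try lia.
  by rewrite !exprMn; ring.
by rewrite h mulr0.
Qed.

(** In the difference of the two eigenvalues the terms with m_l = k_l cancel. The
    others, indexed by the row l, by the choice of m or k and by the sign of
    the exponent of q, become distinct monomials after multiplication by a
    power of q. *)
Lemma mono_eigsum n (x : F) i j (m k : 'X_{1..n}) :
  x = 0 \/ x = s * q ^+ i * t ^+ j ->
  eigsum q t x 1 m = eigsum q t x 1 k -> m = k.
Proof.
move=> hx; have q0 := qt_q0 mono_qt; have t0 := qt_t0 mono_qt.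
move=> h; apply/eqP/negPn/negP => mk.
have [i0 hi0] : exists i0, m i0 != k i0.
  apply/existsP; apply: contraNT mk; rewrite negb_exists => /forallP a.
  by apply/eqP/mnmP => l; apply/eqP; have := a l; rewrite negbK.
pose xb := x != 0.
(* (l, b, c): the row, the choice of m or k, and whether the exponent of q is
   positive or negative; terms of the first kind are present if x != 0 *)
pose J := {y : 'I_n * bool * bool | (m y.1.1 != k y.1.1) && (y.2 ==> xb)}.
pose g (b : bool) := if b then m else k.
pose N := (mdeg m + mdeg k)%N.
have gN b l : (g b l <= N)%N.
  rewrite /g /N !mdegE; case: b; rewrite (bigD1 l) //=; first by lia.
  by rewrite [X in (_ <= _ + X)%N](bigD1 l) //=; lia.
(* the exponents after multiplication by q^N *)
pose e0 (y : 'I_n * bool * bool) := if y.2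
   then (N + i + g y.1.2 y.1.1, j + rho y.1.1, 1)%N
   else (N - g y.1.2 y.1.1, nat_of_ord y.1.1, 0)%N.
pose e (y : J) := e0 (val y).
pose w (y : J) := ~~ (val y).1.2.
have ei : injective e.
  move=> [[[l1 b1] c1] h1] [[[l2 b2] c2] h2] /= E; apply: val_inj => /=.
  move: (h1) (h2); rewrite /e /e0 /= in E; move: E => {h1 h2}.
  case: c1; case: c2 => //= -[] E1 E2 /andP[n1 _] _.
    have ll : l1 = l2.
      apply: ord_inj; move: E2; rewrite /rho; have := ltn_ord l1; have := ltn_ord l2; lia.
    subst l2; congr (_, _, _); move: E1 n1; rewrite /g; case: b1; case: b2 => //; lia.
  have ll : l1 = l2 by apply: ord_inj.
  subst l2; congr (_, _, _); have := gN b1 l1; have := gN b2 l1.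
  move: E1 n1; rewrite /g; case: b1; case: b2 => //; lia.
have j0 : J by exists (i0, true, false); rewrite /= hi0.
have := mi w ei j0; case/negP; apply/eqP.
pose f (y : 'I_n * bool * bool) := (-1) ^+ (~~ y.1.2) *
  (q ^+ (e0 y).1.1 * t ^+ (e0 y).1.2 * s ^+ (e0 y).2).
rewrite -[LHS]/(\sum_(y : J) f (val y)).
have -> : \sum_(y : J) f (val y) = \sum_(y | (m y.1.1 != k y.1.1) && (y.2 ==> xb)) f y.
  rewrite [RHS](reindex_omap (val : J -> _) insub) => [|y Py].
    by apply: eq_bigl => y; rewrite valK eqxx andbT; exact: esym (valP y).
  by rewrite insubT.
rewrite big_mkcond -(pair_bigA _ (fun p c => if (m p.1 != k p.1) && (c ==> xb) then f (p, c) else 0)) /=.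
rewrite -(pair_bigA _ (fun l b => \sum_c (if (m l != k l) && (c ==> xb) then f (l, b, c) else 0))) /=.
transitivity (q ^+ N * (eigsum q t x 1 m - eigsum q t x 1 k)); last by rewrite h subrr mulr0.
rewrite /eigsum -sumrB mulr_sumr; apply: eq_bigr => l _.
rewrite !big_bool /= /f /e0 /= andbT; case: (eqVneq (m l) (k l)) => [->|mkl] /=.
  by rewrite subrr !addr0 mulr0.
rewrite expr0 expr1 !mul1r !mulN1r expr0 !mulr1.
have E y : (y <= N)%N -> q ^+ (N - y) = q ^+ N / q ^+ y.
  move=> yN; have qy := expf_neq0 y q0.
  by apply: (mulIf qy); rewrite -exprD subnK // divfK.
rewrite !E ?(gN true) ?(gN false) //; case: hx => [x0|xE].
  rewrite /xb x0 eqxx /=; ring.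
have -> : xb = true by rewrite /xb xE !mulf_neq0 ?expf_neq0 ?mono_s0.
by rewrite xE /= !exprD; ring.
Qed.

Lemma mono_generic : generic q t s.
Proof.
have q0 := qt_q0 mono_qt; have t0 := qt_t0 mono_qt.
split; [exact: mono_qt|exact: mono_s0| | |].
- move=> i j; rewrite subr_eq0; apply/eqP => e.
  have := @mono_eq (0, 0, 0)%N (i, j, 1)%N; rewrite /= !expr0 !mul1r expr1.
  by rewrite mulrC mulrA => /(_ e).
- move=> n m k _ _; apply: (@mono_eigsum n 0 0 0); by left.
- move=> n i j m k _ _; apply: (@mono_eigsum n _ (2 * i).+1 (2 * j + n.-1)); right.
  by rewrite exprS exprD; ring.
Qed.
End Mono.

(** * The field of rational functions *)

(** Distinct triples of exponents give distinct monomials in the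
    indeterminates a, b, q, t. *)
Lemma mono_indep_E : mono_indep q t (a * b).
Proof.
move=> J e w ei j0.
pose mm (j : J) : 'X_{1..6} := ((U_(@Ordinal 6 4 isT) *+ (e j).1.1) + (U_(@Ordinal 6 5 isT) *+ (e j).1.2)
  + ((U_(@Ordinal 6 0 isT) + U_(@Ordinal 6 1 isT)) *+ (e j).2))%MM.
have mi : injective mm.
  move=> i j /mnmP h; apply: ei.
  have := h (@Ordinal 6 4 isT); have := h (@Ordinal 6 5 isT); have := h (@Ordinal 6 0 isT).
  rewrite !mnmDE !mulmnE !mnmDE !mnm1E /= !mul0n !mul1n !addn0 !add0n.
  by move: (e i) (e j) => [[x1 x2] x3] [[y1 y2] y3] /= -> -> ->.
have -> : \sum_j (-1) ^+ w j * (q ^+ (e j).1.1 * t ^+ (e j).1.2 * (a * b) ^+ (e j).2)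
   = tofrac (\sum_j (-1) ^+ w j * 'X_[mm j]).
  rewrite rmorph_sum; apply: eq_bigr => j _ /=.
  rewrite rmorphM rmorphXn rmorphN1 /mm !mpolyXD -!mpolyXn mpolyXD !rmorphM !rmorphXn /=.
  by rewrite rmorphM.
rewrite tofrac_eq0; apply/eqP => /(congr1 (mcoeff (mm j0))); rewrite mcoeff0 raddf_sum.
rewrite (bigD1 j0) //= big1 => [|j jj]; last first.
  by rewrite -signr_odd mulr_sign; case: (odd _);
    rewrite ?mcoeffN mcoeffX (inj_eq mi) (negPf jj) ?oppr0.
rewrite addr0 -signr_odd mulr_sign; case: (odd _); rewrite ?mcoeffN mcoeffX eqxx => /eqP.
  by rewrite oppr_eq0 oner_eq0.
by rewrite oner_eq0.
Qed.

(** This and the next three identities are applied in fields of fractions. *)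
Lemma lau_factor (K : fieldType) (Z w y1 y2 y3 : K) : w != 0 ->
  y1 * (Z * Z) + y2 * (Z * (Z / w)) + y3 * (Z / w * (Z / w)) = Z ^+ 2 * laurent (y1, y2, y3) w.
Proof. by move=> w0; rewrite /laurent /=; field. Qed.

Lemma plus_factor (K : fieldType) (q T a b c d w : K) : q != 0 -> w != 0 ->
  q * T * (a - c / (q * w)) * (b + d / (q * w))
  = laurent (q * (a * b) * T, T * (a * d - b * c), - (c * d * T * q^-1)) w.
Proof. by move=> q0 w0; rewrite /laurent /=; field; rewrite q0 w0. Qed.

Lemma minus_factor (K : fieldType) (c d w : K) : w != 0 ->
  (1 - c / w) * (1 + d / w) = laurent (1, d - c, - (c * d)) w.
Proof. by move=> w0; rewrite /laurent /=; field. Qed.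

Lemma Hterm_ring (K : comNzRingType) (Z l1 l2 A B v T p1 p2 : K) :
  Z ^+ 2 * l1 * (A * v) * p1 + T * (Z ^+ 2 * l2 * (B * v) * p2) =
  Z ^+ 2 * v * (l1 * A * p1 + l2 * (T * B) * p2).
Proof. by ring. Qed.

Section Frac.
Variables (F : fieldType) (n : nat).
Local Notation Fz := {fraction {mpoly F[n]}}.
Local Notation cst := (@cst F n).
Local Notation zv := (@zvar F n).

Lemma zvar_inj : injective zv.
Proof. by move=> i j /eqP; rewrite /zvar tofrac_eq => /eqP /mpolyXU_inj. Qed.
Lemma zvar_neq0 i : zv i != 0.
Proof. by rewrite /zvar tofrac_eq0 mpolyXU_neq0. Qed.
Lemma cstM : {morph cst : x y / x * y}.
Proof. by move=> x y; rewrite /Defs.cst mpolyCM rmorphM. Qed.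
Lemma cst1 : cst 1 = 1.
Proof. by rewrite /Defs.cst mpolyC1 rmorph1. Qed.
Lemma cstX k : {morph cst : x / x ^+ k}.
Proof. by move=> x; rewrite /Defs.cst !rmorphXn. Qed.
Lemma cstB : {morph cst : x y / x - y}.
Proof. by move=> x y; rewrite /Defs.cst mpolyCB rmorphB. Qed.
Lemma cstN : {morph cst : x / - x}.
Proof. by move=> x; rewrite /Defs.cst mpolyCN rmorphN. Qed.
Lemma cst_neq0 u : u != 0 -> cst u != 0.
Proof. by move=> u0; rewrite /Defs.cst tofrac_eq0 mpolyC_eq0. Qed.
Lemma cstV u : u != 0 -> cst u^-1 = (cst u)^-1.
Proof.
move=> u0; apply: (mulfI (cst_neq0 u0)).
by rewrite -cstM !divff ?cst1 // cst_neq0.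
Qed.

Lemma tofrac_vdm : tofrac (vandermonde F n) = (vandermonde Fz n).@[zv].
Proof.
rewrite meval_vdm /vandermonde rmorph_prod; apply: eq_bigr => i _.
by rewrite rmorph_prod; apply: eq_bigr => k _; rewrite rmorphB.
Qed.

(** The identity [vdm_dilate] at the generic point: the field of fractions is a
    field, and the variables form an injective point over it. *)
Lemma tofrac_vdm_dilate t j :
  tofrac (dilate t j (vandermonde F n)) = Ap (cst t) zv j * tofrac (vandermonde F n).
Proof.
rewrite tofrac_vdm -(vdm_dilate _ _ zvar_inj) meval_dilate meval_vdm.
have dX l : tofrac (dilate t j 'X_l) = shift (cst t) j zv l.
  rewrite /dilate comp_mpolyXU -tnth_nth tnth_mktuple -mul_mpolyC rmorphM /shift.
  by case: ifP => _ //; rewrite -/(cst 1) cst1.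
rewrite /vandermonde /dilate rmorph_prod rmorph_prod; apply: eq_bigr => i _.
rewrite rmorph_prod rmorph_prod; apply: eq_bigr => k _ /=.
by rewrite -/(dilate t j _) dilateB rmorphB /= !dX.
Qed.

Lemma tofrac_cpol j (y : F * F * F) :
  tofrac (cpol j y) = tofrac 'X_[onem n] ^+ 2 * laurent (cst y.1.1, cst y.1.2, cst y.2) (zv j).
Proof.
rewrite /cpol -!mul_mpolyC !mpolyXD !rmorphD !rmorphM /= -!/(cst _).
have -> : tofrac ('X_[onem n - U_(j)] : {mpoly F[n]}) = tofrac 'X_[onem n] / zv j.
  apply: (mulIf (zvar_neq0 j)); rewrite divfK ?zvar_neq0 // /zvar -rmorphM /=.
  by rewrite -mpolyXD onemBK.
exact: lau_factor (zvar_neq0 j).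
Qed.

Variables (a b c d q t : F).
Hypotheses (q0 : q != 0) (t0 : t != 0).

Lemma phi_plusE j : phi_plus a b c d q t j =
  laurent (cst (alT n q t a b c d).1.1, cst (alT n q t a b c d).1.2, cst (alT n q t a b c d).2) (zv j)
  * Ap (cst t) zv j.
Proof.
rewrite /phi_plus /Ap; congr (_ * _); rewrite /alT /=.
rewrite !(cstM, cstB, cstN, cstX, cstV) //.
exact: plus_factor (cst_neq0 q0) (zvar_neq0 j).
Qed.

Lemma phi_minusE j : phi_minus c d t j =
  laurent (cst (beT c d).1.1, cst (beT c d).1.2, cst (beT c d).2) (zv j) * Am (cst t) zv j.
Proof.
rewrite /phi_minus /Am; congr (_ * _); rewrite /beT /=.
rewrite !(cstM, cstB, cstN) cst1.
exact: minus_factor (zvar_neq0 j).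
Qed.

Lemma tofrac_Hpol p : tofrac (Hpol q t (alT n q t a b c d) (beT c d) p) =
  tofrac 'X_[onem n] ^+ 2 * tofrac (vandermonde F n) * D_B a b c d q t p.
Proof.
rewrite /Hpol /D_B rmorph_sum mulr_sumr; apply: eq_bigr => j _ /=.
rewrite phi_plusE phi_minusE -mul_mpolyC !rmorphD !rmorphM /= -!/(cst _).
rewrite !tofrac_cpol !tofrac_vdm_dilate cstX cstV // -(Am_Ap _ (cst_neq0 t0) zvar_inj).
rewrite /alT /beT /= -!rmorphD; exact: Hterm_ring.
Qed.

(** The equation in the field of fractions is one between polynomials after
    clearing denominators, and can be evaluated. *)
Lemma eigen_points (p : {mpoly F[n]}) x z :
  D_B a b c d q t p = tofrac (x *: p) -> injective z -> (forall i, z i != 0) ->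
  qop q t (alB n q t a b c d) (beB c d) p z = x * p.@[z].
Proof.
move=> Dp zi z0.
have H : Hpol q t (alT n q t a b c d) (beT c d) p = 'X_[onem n] ^+ 2 * vandermonde F n * (x *: p).
  by apply/eqP; rewrite -tofrac_eq tofrac_Hpol Dp -rmorphXn -!rmorphM.
have := meval_Hpol q (alT n q t a b c d) (beT c d) t0 p zi z0.
rewrite H !expr2 !mevalM mevalZ meval_onem.
have Z0 : \prod_l z l != 0 by apply/prodf_neq0 => l _.
have P0 : (\prod_l z l) * (\prod_l z l) * (vandermonde F n).@[z] != 0.
  by rewrite !mulf_neq0 ?meval_vdm_neq0.
move/(mulfI P0) => ->; apply: qop_eq => j; first by rewrite lau_alT.
by rewrite lau_beT.
Qed.

End Frac.

(** * The four evaluations *)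

Section Final.
Variables (F : fieldType) (n : nat).
Implicit Types (a b c d q t : F) (lam : 'X_{1..n}).

Lemma Delta_s_Delta a b q t lam : Delta a b q t lam = Delta_s q t (a * b) lam.
Proof.
rewrite /Delta /Delta_s; apply: eq_bigr => j _; apply: eq_bigr => k jk; rewrite /Delta_factor.
have -> : (2 * n - j.+1 - k.+1)%N = (rho j + rho k)%N.
  by rewrite /rho; have := ltn_ord j; have := ltn_ord k; lia.
by rewrite !addn1 mulrA.
Qed.

Lemma rho_ptE c q t : rho_pt c t =1 lat q t c (0%MM : 'X_{1..n}).
Proof. by move=> i; rewrite /rho_pt /lat mnm0E expr0 mulr1. Qed.

Lemma monic_basic a b c d q t lam P : is_partition lam ->
  is_monic_big_qJacobi a b c d q t lam P ->
  [/\ P \is symmetric, (msize P <= (mdeg lam).+1)%N & P@_lam = 1].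
Proof.
move=> lp [Ps [coef PE] _]; split=> //.
  rewrite PE; apply: msizeD_sup; first exact: msize_msymm.
  apply: leq_trans (msize_sum _ _ _) _; apply/bigmax_leqP => m _.
  by apply: msizeZ_sup; apply: leq_trans (msize_msymm _ _) _; apply: bmdeg.
rewrite PE mcoeffD mcoeff_msymm perm_refl raddf_sum /= big1 ?addr0 // => m /andP[mp /andP[_ ml]].
rewrite mcoeffZ mcoeff_msymm; case: (boolP (perm_eq lam m)) => [h|_]; last by rewrite mulr0.
by case/eqP: ml; apply: esym (part_perm_eq lp mp h).
Qed.

Lemma eigvalE a b q t lam : (0 < n)%N ->
  eigval a b q t lam = eigsum q t (q * (a * b) * t ^+ n.-1) 1 lam.
Proof.
move=> n0; apply: eq_bigr => j _; rewrite mul1r; congr (_ * _ + _).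
have -> : (2 * n - j.+1 - 1)%N = (n.-1 + rho j)%N.
  by rewrite /rho; have := ltn_ord j; lia.
by rewrite exprD; ring.
Qed.

Variables (q t : F).
Hypothesis two0 : (2%:R : F) != 0.

(** The eigenvalue equation at every point where it makes sense. In this form
    the parameters can be changed without reference to the field of
    fractions. *)
Definition eigenpoly a b c d lam (P : {mpoly F[n]}) :=
  [/\ P \is symmetric, (msize P <= (mdeg lam).+1)%N, P@_lam = 1 &
   forall z, injective z -> (forall i, z i != 0) ->
     qop q t (alB n q t a b c d) (beB c d) P z
     = eigsum q t (q * (a * b) * t ^+ n.-1) 1 lam * P.@[z]].

Lemma eigenpoly_swap a b c d lam P : eigenpoly a b c d lam P -> eigenpoly b a (- d) (- c) lam P.
Proof.
case=> h1 h2 h3 h4; split=> // z zi z0; rewrite [b * a]mulrC -h4 //.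
apply: qop_eq => j; rewrite ?/alB ?/beB !mulNr ?opprK.
  by ring.
by ring.
Qed.

Lemma eval_base a b c d lam P : generic q t (a * b) -> c != 0 -> is_partition lam ->
  eigenpoly a b c d lam P -> P.@[rho_pt c t] = eval_rhs q t a b c d lam.
Proof.
move=> gen c0 lp [h1 h2 h3 h4]; rewrite (meval_eq P (rho_ptE c q t)).
apply: (eig_eval two0 gen c0 lp erefl); split=> // v vp; apply: h4.
  by apply: (lat_inj (gen_qt gen)).
by move=> i; apply: lat_neq0 => //; apply: gen_qt gen.
Qed.

(** For d != 0 the division-free form of the last factor is the one of the
    theorem. *)
Lemma eval_rhs_fwd a b c d lam : d != 0 -> q != 0 ->
  eval_rhs q t a b c d lam = Delta a b q t lam *
    \prod_(i < n)
      (qpochs q [:: q * a * t ^+ (n - i.+1); q * a * b * t ^+ (n - i.+1);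
                    - (q * b * c / d) * t ^+ (n - i.+1)] (lam i)
       / qpoch q (q * a * b * t ^+ (2 * (n - i.+1))) (2 * lam i)
       * d ^+ lam i * q ^+ (lam i * (lam i - 1))./2).
Proof.
move=> d0 q0; rewrite /eval_rhs Delta_s_Delta; congr (_ * _); apply: eq_bigr => i _.
rewrite /row_factor /qpochs !big_cons big_nil mulr1 /rho -[q * a * b]mulrA.
set m := (n - i.+1)%N; set l := lam i.
have -> : \prod_(k < l) (d * q ^+ k + b * c * q ^+ (2 * k).+1 * t ^+ m) =
   qpoch q (- (q * b * c / d) * t ^+ m) l * d ^+ l * q ^+ (l * (l - 1))./2.
  have -> : d ^+ l = \prod_(k < l) d by rewrite prodr_const card_ord.
  have -> : q ^+ (l * (l - 1))./2 = \prod_(k < l) q ^+ k.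
    by rewrite prodrXr subn1 -bin2 -bin2_sum big_mkord.
  rewrite /qpoch -!big_split; apply: eq_bigr => k _ /=.
  by rewrite exprS mul2n -addnn exprD; field.
by ring.
Qed.
End Final.

Lemma collect_powers (F : fieldType) (T A g1 Q B g2 E g3 S g4 C : F) : Q != 0 -> S != 0 ->
  T * (A * (g1 * Q) * (B * (g2 * Q)) * (E * (g3 * (Q^-1 / Q / S))) * (g4 * S * C)) =
  A * (B * C) * E * (T * (g1 * g2 * g3 * g4)).
Proof. by move=> Q0 S0; field; rewrite Q0 S0. Qed.

Section Inv.
Variables (F : fieldType) (n : nat) (q t : F).
Implicit Types (a b c d : F) (lam : 'X_{1..n}).

(** Replacing (q, t) by their inverses exchanges the two halves of the operator,
    up to the factor q a b t^(2n-2). *)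
Lemma eigenpoly_inv a b c d lam P : (0 < n)%N -> q != 0 -> t != 0 -> a != 0 -> b != 0 ->
  eigenpoly q t a b c d lam P ->
  eigenpoly q^-1 t^-1 a^-1 b^-1 (c / (q * a)) (d / (q * b)) lam P.
Proof.
move=> n0 q0 t0 a0 b0 [h1 h2 h3 h4]; split=> // z zi z0.
have tn := expf_neq0 n.-1 t0; have tV : t^-1 != 0 by rewrite invr_eq0.
pose K := q * (a * b) * t ^+ n.-1 * t ^+ n.-1.
have K0 : K != 0 by rewrite !mulf_neq0.
apply: (mulfI K0); rewrite [RHS]mulrA.
have E : K * eigsum q^-1 t^-1 (q^-1 * (a^-1 * b^-1) * t^-1 ^+ n.-1) 1 lam =
    eigsum q t (q * (a * b) * t ^+ n.-1) 1 lam.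
  rewrite /eigsum mulr_sumr; apply: eq_bigr => j _.
  rewrite /K !exprVn invrK.
  have -> : t ^+ n.-1 = t ^+ j * t ^+ rho j.
    by rewrite -exprD; congr (_ ^+ _); rewrite /rho; have := ltn_ord j; lia.
  by field; rewrite q0 a0 b0 !expf_neq0.
transitivity (eigsum q t (q * (a * b) * t ^+ n.-1) 1 lam * P.@[z]); last by congr (_ * _).
rewrite -h4 // /qop mulr_sumr; apply: eq_bigr => j _.
rewrite invrK addrC mulrDr.
have A1 : Am t^-1 z j = Ap t z j / t ^+ n.-1.
  by rewrite -(Am_Ap _ tV zi) invrK exprVn mulrC.
have A2 : Ap t^-1 z j = Am t z j / t ^+ n.-1.
  by rewrite -(Am_Ap _ t0 zi) mulrC mulKf.
rewrite A1 A2 /alB /beB /K exprVn.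
congr (_ + _).
  by field; rewrite q0 a0 b0 tn z0.
by field; rewrite q0 a0 b0 tn z0.
Qed.

(** The power q^(-l(l-1)/2) that appears when a shifted factorial is inverted;
    the product form fits the products it is combined with. *)
Definition prod_invq l := \prod_(k < l) (q ^+ k)^-1.

Lemma prod_invq_neq0 l : q != 0 -> prod_invq l != 0.
Proof. by move=> q0; apply/prodf_neq0 => k _; rewrite invr_eq0 expf_neq0. Qed.

Lemma prod_invq_double l : prod_invq (2 * l) = prod_invq l ^+ 2 * \prod_(k < l) (q ^+ (2 * k).+1)^-1.
Proof.
rewrite /prod_invq; elim: l => [|l IH]; first by rewrite muln0 !big_ord0 expr1n mulr1.
have -> : (2 * l.+1)%N = (2 * l).+2 by lia.
rewrite !big_ord_recr /= IH exprMn.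
have -> : (q ^+ (2 * l))^-1 = (q ^+ l)^-1 ^+ 2 by rewrite mul2n -addnn exprD invfM.
by ring.
Qed.

Lemma qpoch_inv u l : q != 0 -> u != 0 ->
  qpoch q^-1 u^-1 l = qpoch q u l * ((- u^-1) ^+ l * prod_invq l).
Proof.
move=> q0 u0; have -> : (- u^-1) ^+ l = \prod_(k < l) (- u^-1) by rewrite prodr_const card_ord.
rewrite /qpoch /prod_invq -!big_split; apply: eq_bigr => k _ /=.
by rewrite exprVn; field; rewrite u0 expf_neq0.
Qed.

Lemma pow_ratio u v l : q != 0 -> u != 0 -> v != 0 ->
  ((- u^-1) ^+ l * prod_invq l) / ((- v^-1) ^+ l * prod_invq l) = (v / u) ^+ l.
Proof.
move=> q0 u0 v0; have Q0 := prod_invq_neq0 l q0.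
rewrite invfM mulrACA divff // mulr1 -expr_div_n; congr (_ ^+ _).
by rewrite invrN mulrNN invrK mulrC.
Qed.

Lemma Delta_factor_inv s lam (j k : 'I_n) : q != 0 -> t != 0 -> s != 0 -> is_partition lam ->
  (j < k)%N -> Delta_factor q^-1 t^-1 s^-1 lam j k = Delta_factor q t s lam j k * (t^-1 ^+ (2 * lam j)).
Proof.
move=> q0 t0 s0 /partP lp jk; rewrite /Delta_factor.
have E e : q^-1 * s^-1 * t^-1 ^+ e = (q * s * t ^+ e)^-1 by rewrite exprVn !invfM.
have N e : q * s * t ^+ e != 0 by rewrite !mulf_neq0 ?expf_neq0.
rewrite !E ![t^-1 ^+ (k - j).+1]exprVn ![t^-1 ^+ (k - j)]exprVn.
rewrite !qpoch_inv ?expf_neq0 //.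
have lkj := lp _ _ (ltnW jk).
have -> : t^-1 ^+ (2 * lam j) = t^-1 ^+ (lam j + lam k) * t^-1 ^+ (lam j - lam k).
  by rewrite -exprD; congr (_ ^+ _); lia.
have R1 := pow_ratio (lam j + lam k) q0 (N (rho j + rho k).+1) (N (rho j + rho k)).
have R2 := pow_ratio (lam j - lam k) q0 (expf_neq0 (k - j).+1 t0) (expf_neq0 (k - j) t0).
have -> : t^-1 ^+ (lam j + lam k) =
    (q * s * t ^+ (rho j + rho k) / (q * s * t ^+ (rho j + rho k).+1)) ^+ (lam j + lam k).
  by congr (_ ^+ _); rewrite exprS; field; rewrite q0 s0 t0 expf_neq0.
have -> : t^-1 ^+ (lam j - lam k) = (t ^+ (k - j) / t ^+ (k - j).+1) ^+ (lam j - lam k).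
  by congr (_ ^+ _); rewrite exprS; field; rewrite t0 expf_neq0.
by rewrite -R1 -R2 !invfM; ring.
Qed.

(** Each pair j < k contributes t^(-2 lam_j), and there are rho_j pairs with first
    entry j. *)
Lemma Delta_s_inv s lam : q != 0 -> t != 0 -> s != 0 -> is_partition lam ->
  Delta_s q^-1 t^-1 s^-1 lam = Delta_s q t s lam * \prod_(i < n) (t^-1 ^+ (2 * rho i)) ^+ lam i.
Proof.
move=> q0 t0 s0 lp; rewrite /Delta_s -big_split; apply: eq_bigr => j _ /=.
have -> : (t^-1 ^+ (2 * rho j)) ^+ lam j = \prod_(k < n | (j < k)%N) t^-1 ^+ (2 * lam j).
  rewrite -(big_geq_mkord j.+1 n xpredT (fun=> t^-1 ^+ (2 * lam j))) prodr_const_nat.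
  by rewrite -!exprM; congr (_ ^+ _); rewrite /rho; lia.
by rewrite -big_split; apply: eq_bigr => k jk; apply: Delta_factor_inv.
Qed.

(** The proposed value for the inverted parameters is the right-hand side of
    the third formula. *)
Lemma eval_rhs_bwd a b c d lam : q != 0 -> t != 0 -> a != 0 -> b != 0 -> c != 0 -> d != 0 ->
  is_partition lam ->
  eval_rhs q^-1 t^-1 a^-1 b^-1 (c / (q * a)) (d / (q * b)) lam = Delta a b q t lam *
    \prod_(i < n)
      (qpochs q [:: q * a * t ^+ (n - i.+1); q * a * b * t ^+ (n - i.+1);
                    - (q * a * d / c) * t ^+ (n - i.+1)] (lam i)
       / qpoch q (q * a * b * t ^+ (2 * (n - i.+1))) (2 * lam i)
       * (c / (q * a) * t ^- (n - i.+1)) ^+ lam i).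
Proof.
move=> q0 t0 a0 b0 c0 d0 lp; have ab0 : a * b != 0 by rewrite mulf_neq0.
rewrite /eval_rhs Delta_s_Delta -(invfM a b) Delta_s_inv // -mulrA; congr (_ * _).
rewrite -big_split; apply: eq_bigr => i _ /=.
rewrite /row_factor /qpochs !big_cons big_nil mulr1 -/(rho i) -!(mulrA q a b) -(invfM a b).
set m := rho i; set l := lam i.
have E x e : q^-1 * x^-1 * t^-1 ^+ e = (q * x * t ^+ e)^-1 by rewrite exprVn !invfM.
have N x e : x != 0 -> q * x * t ^+ e != 0 by move=> x0; rewrite !mulf_neq0 ?expf_neq0.
rewrite !E !qpoch_inv ?N // prod_invq_double.
have -> : \prod_(k < l) (d / (q * b) * q^-1 ^+ k + b^-1 * (c / (q * a)) * q^-1 ^+ (2 * k).+1 * t^-1 ^+ m)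
  = (c / (q * (a * b)) * (t ^+ m)^-1) ^+ l * \prod_(k < l) (q ^+ (2 * k).+1)^-1
    * qpoch q (- (q * a * d / c) * t ^+ m) l.
  have -> : (c / (q * (a * b)) * (t ^+ m)^-1) ^+ l = \prod_(k < l) (c / (q * (a * b)) * (t ^+ m)^-1).
    by rewrite prodr_const card_ord.
  rewrite /qpoch -!big_split; apply: eq_bigr => k _ /=.
  rewrite !exprVn !exprS mul2n -addnn exprD; field.
  by rewrite q0 a0 b0 c0 !expf_neq0.
have S0 : \prod_(k < l) (q ^+ (2 * k).+1)^-1 != 0.
  by apply/prodf_neq0 => k _; rewrite invr_eq0 expf_neq0.
have Q0 := prod_invq_neq0 l q0.
set S := \prod_(k < l) _ in S0 *; set Q := prod_invq l in Q0 *.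
set A := qpoch q (q * a * t ^+ m) l; set B := qpoch q (q * (a * b) * t ^+ m) l.
set C := qpoch q (- (q * a * d / c) * t ^+ m) l.
have -> : (c / (q * a) * t ^- m) ^+ l = (t^-1 ^+ (2 * m)) ^+ l * ((- (q * a * t ^+ m)^-1) ^+ l
   * (- (q * (a * b) * t ^+ m)^-1) ^+ l * ((- (q * (a * b) * t ^+ (2 * m))^-1) ^+ (2 * l))^-1
   * (c / (q * (a * b)) * (t ^+ m)^-1) ^+ l).
  rewrite [(- _) ^+ (2 * l)]exprM -[(_ ^+ l)^-1]exprVn -!exprMn; congr (_ ^+ _).
  rewrite exprVn mul2n -addnn !exprD; field.
  by rewrite q0 a0 b0 expf_neq0 ?oner_neq0.
rewrite !invfM; exact: collect_powers.
Qed.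

End Inv.

(** The second and fourth formulas are the first and third for the exchanged
    parameters (b, a, -d, -c). *)
Theorem big_qJacobi_eval (F : fieldType) (n : nat) (q t a b c d : F) (lam : 'X_{1..n})
    (P : {mpoly F[n]}) : (2%:R : F) != 0 -> a != 0 -> b != 0 -> c != 0 -> d != 0 ->
  mono_indep q t (a * b) -> (0 < n)%N -> is_partition lam ->
  is_monic_big_qJacobi a b c d q t lam P ->
  [/\ P.@[rho_pt c t] =
        Delta a b q t lam *
        \prod_(i < n)
          (qpochs q [:: q * a * t ^+ (n - i.+1); q * a * b * t ^+ (n - i.+1);
                        - (q * b * c / d) * t ^+ (n - i.+1)] (lam i)
           / qpoch q (q * a * b * t ^+ (2 * (n - i.+1))) (2 * lam i)
           * d ^+ lam i * q ^+ (lam i * (lam i - 1))./2),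
      P.@[rho_pt (- d) t] =
        Delta a b q t lam *
        \prod_(i < n)
          (qpochs q [:: q * b * t ^+ (n - i.+1); q * a * b * t ^+ (n - i.+1);
                        - (q * a * d / c) * t ^+ (n - i.+1)] (lam i)
           / qpoch q (q * a * b * t ^+ (2 * (n - i.+1))) (2 * lam i)
           * (- c) ^+ lam i * q ^+ (lam i * (lam i - 1))./2),
      P.@[rho_ptN (c / (q * a)) t] =
        Delta a b q t lam *
        \prod_(i < n)
          (qpochs q [:: q * a * t ^+ (n - i.+1); q * a * b * t ^+ (n - i.+1);
                        - (q * a * d / c) * t ^+ (n - i.+1)] (lam i)
           / qpoch q (q * a * b * t ^+ (2 * (n - i.+1))) (2 * lam i)
           * (c / (q * a) * t ^- (n - i.+1)) ^+ lam i)
    & P.@[rho_ptN (- (d / (q * b))) t] =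
        Delta a b q t lam *
        \prod_(i < n)
          (qpochs q [:: q * b * t ^+ (n - i.+1); q * a * b * t ^+ (n - i.+1);
                        - (q * b * c / d) * t ^+ (n - i.+1)] (lam i)
           / qpoch q (q * a * b * t ^+ (2 * (n - i.+1))) (2 * lam i)
           * (- (d / (q * b)) * t ^- (n - i.+1)) ^+ lam i)].
Proof.
move=> two0 a0 b0 c0 d0 mi n0 lp hP.
have gen := mono_generic mi; have geni := mono_generic (mono_inv mi).
have q0 := qt_q0 (gen_qt gen); have t0 := qt_t0 (gen_qt gen).
have [Ps Pk Pl] := monic_basic lp hP; have [_ _ DP] := hP.
have eP : eigenpoly q t a b c d lam P.
  split=> // z zi z0; rewrite -eigvalE //.
  by exact: (eigen_points q0 t0 DP zi z0).
have ePs := eigenpoly_swap eP.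
have genb : generic q t (b * a) by rewrite mulrC.
have swapD : Delta b a q t lam = Delta a b q t lam by rewrite !Delta_s_Delta mulrC.
have nd0 : - d != 0 by rewrite oppr_eq0.
have nc0 : - c != 0 by rewrite oppr_eq0.
have rN u : rho_ptN u t =1 rho_pt (n := n) u t^-1.
  by move=> i; rewrite /rho_ptN /rho_pt exprVn.
have nN (u v : F) : - u / - v = u / v by rewrite invrN mulrNN.
split.
- by rewrite (eval_base two0 gen c0 lp eP) eval_rhs_fwd.
- rewrite (eval_base two0 genb nd0 lp ePs) eval_rhs_fwd // swapD (mulrAC q b a).
  congr (_ * _); apply: eq_bigr => i _; congr (qpochs _ [:: _; _; - _ * _] _ / _ * _ * _).
  by rewrite mulrN nN.
- have geni' : generic q^-1 t^-1 (a^-1 * b^-1) by rewrite -invfM.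
  have ci : c / (q * a) != 0 by rewrite !mulf_neq0 ?invr_eq0 ?mulf_neq0.
  rewrite (meval_eq P (rN (c / (q * a)))).
  rewrite (eval_base two0 geni' ci lp (eigenpoly_inv n0 q0 t0 a0 b0 eP)).
  by rewrite eval_rhs_bwd.
have geni' : generic q^-1 t^-1 (b^-1 * a^-1) by rewrite mulrC -invfM.
have ci : - d / (q * b) != 0 by rewrite !mulf_neq0 ?invr_eq0 ?mulf_neq0.
rewrite -mulNr (meval_eq P (rN (- d / (q * b)))).
rewrite (eval_base two0 geni' ci lp (eigenpoly_inv n0 q0 t0 b0 a0 ePs)).
rewrite eval_rhs_bwd // swapD (mulrAC q b a) mulrN nN.
by [].
Qed.

Theorem theorem6p2 (n : nat) (lam : 'X_{1..n}) (P : {mpoly E[n]}) :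
  (1 <= n)%N ->
  is_partition lam ->
  is_monic_big_qJacobi a b c d q t lam P ->
  [/\ P.@[rho_pt c t] =
        Delta a b q t lam *
        \prod_(i < n)
          (qpochs q [:: q * a * t ^+ (n - i.+1); q * a * b * t ^+ (n - i.+1);
                        - (q * b * c / d) * t ^+ (n - i.+1)] (lam i)
           / qpoch q (q * a * b * t ^+ (2 * (n - i.+1))) (2 * lam i)
           * d ^+ lam i * q ^+ (lam i * (lam i - 1))./2),
      P.@[rho_pt (- d) t] =
        Delta a b q t lam *
        \prod_(i < n)
          (qpochs q [:: q * b * t ^+ (n - i.+1); q * a * b * t ^+ (n - i.+1);
                        - (q * a * d / c) * t ^+ (n - i.+1)] (lam i)
           / qpoch q (q * a * b * t ^+ (2 * (n - i.+1))) (2 * lam i)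
           * (- c) ^+ lam i * q ^+ (lam i * (lam i - 1))./2),
      P.@[rho_ptN (c / (q * a)) t] =
        Delta a b q t lam *
        \prod_(i < n)
          (qpochs q [:: q * a * t ^+ (n - i.+1); q * a * b * t ^+ (n - i.+1);
                        - (q * a * d / c) * t ^+ (n - i.+1)] (lam i)
           / qpoch q (q * a * b * t ^+ (2 * (n - i.+1))) (2 * lam i)
           * (c / (q * a) * t ^- (n - i.+1)) ^+ lam i)
    & P.@[rho_ptN (- (d / (q * b))) t] =
        Delta a b q t lam *
        \prod_(i < n)
          (qpochs q [:: q * b * t ^+ (n - i.+1); q * a * b * t ^+ (n - i.+1);
                        - (q * b * c / d) * t ^+ (n - i.+1)] (lam i)
           / qpoch q (q * a * b * t ^+ (2 * (n - i.+1))) (2 * lam i)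
           * (- (d / (q * b)) * t ^- (n - i.+1)) ^+ lam i)].

Proof.
have tn (p : {mpoly Rdefinitions.R[i][6]}) : p != 0 -> tofrac p != 0 by rewrite tofrac_eq0.
have xn k : indet k != 0 by apply: tn; apply: mpolyXU_neq0.
have two0 : (2%:R : E) != 0.
  rewrite -[2%:R](rmorph_nat (@tofrac _)); apply: tn.
  by rewrite -[2%:R](rmorph_nat (@mpolyC _ _)) mpolyC_eq0 Num.Theory.pnatr_eq0.
by move=> n1 lp hP; apply: big_qJacobi_eval mono_indep_E n1 lp hP; rewrite ?xn.
Qed.
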